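(* Let $f:(M,Q)\to\mathbb{R}^n$ be isothermic with Christoffel transform $f^c$ and let $r\in\mathbb{R}\setminus\{0\}$. Then $$\mathcal{T}_rf^c=\mathcal{D}_{-r}\mathcal{T}_rf\quad\text{modulo } \text{Möb}(n),$$ i.e. there are representatives $f_r$ of $\mathcal{T}_rf$ and $\hat f_r$ of $\mathcal{T}_rf^c$ (each being defined up to Möbius transformations) such that $\hat f_r$ is a Darboux transform $\mathcal{D}_{-r}f_r$ of $f_r$.
   Context: $C\ell_n$ is the real Clifford algebra of Euclidean $\mathbb{R}^n$, with $vw+wv=-2(v,w)1$; $\Gamma_n\subset C\ell_n^\times$ is the group generated by nonzero vectors; $a\mapsto a^t$ is the anti-involution fixing vectors. $SL(\Gamma_n)$ is the group of matrices $\begin{pmatrix}a&b\\ c&d\end{pmatrix}$ with $a,b,c,d\in\Gamma_n\cup\{0\}$, $ac^t,bd^t,a^tb,c^td\in\mathbb{R}^n$, $ad^t-bc^t=1$, acting on $\mathbb{R}^n\cup\{\infty\}$ by $x\mapsto(ax+b)(cx+d)^{-1}$, $\infty\mapsto ac^{-1}$; this action has image the Möbius group $\text{Möb}(n)$ of conformal diffeomorphisms of $S^n=\mathbb{R}^n\cup\{\infty\}$. For Clifford-valued 1-forms, $(\alpha\wedge\beta)(X,Y)=\alpha(X)\beta(Y)-\alpha(Y)\beta(X)$. A polarised Riemann surface $(M,Q)$ is a Riemann surface with a nonzero holomorphic quadratic differential $Q$. A conformal immersion $f:(M,Q)\to\mathbb{R}^n$ is isothermic if there is $f^c:M\to\mathbb{R}^n$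 (the Christoffel transform, unique up to translation) with $df\wedge df^c=0$ and $(df,df^c)^{2,0}=Q$, where $(\alpha,\beta)^{2,0}=(\alpha(\partial_z),\beta(\partial_z))dz^2$. Away from the zeros of $Q$, $f^c$ is isothermic on $(M,Q)$ with Christoffel transform $f$. $T$-transform: $\mathcal{T}_rf=F_r\cdot0$ where $F_r:M\to SL(\Gamma_n)$ solves $F_r^{-1}dF_r=\begin{pmatrix}0&df\\ r\,df^c&0\end{pmatrix}$; it is defined up to $\text{Möb}(n)$ and is isothermic on $(M,Q)$. Similarly $\mathcal{T}_rf^c$ uses $\begin{pmatrix}0&df^c\\ r\,df&0\end{pmatrix}$. For isothermic $f$ on $(M,Q)$ and $s\neq0$, $\mathcal{D}_sf$ denotes any $f+g$ with $dg=s\,g\,df^c\,g-df$, $g$ nowhere zero (products in $C\ell_n$). Statements are local: $M$ is simply connected, maps are considered where $\mathbb{R}^n$-valued (after a Möbius transformation if necessary) and away from the zeros of $Q$. *)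

(* Defs.v *)
From HB Require Import structures.
From mathcomp Require Import all_boot all_order all_algebra all_field.
From mathcomp Require Import all_classical all_reals all_analysis.
From mathcomp Require Import complex ring.

Set Implicit Arguments.
Unset Strict Implicit.
Unset Printing Implicit Defensive.

Import Order.TTheory GRing.Theory Num.Theory.
Import numFieldNormedType.Exports.

Local Open Scope classical_set_scope.
Local Open Scope ring_scope.

Section SymmetricDifference.
Variable I : finType.
Implicit Types S T U : {set I}.

Definition symdiff S T : {set I} := [set i | (i \in S) (+) (i \in T)]%SET.

Lemma symdiffA : associative symdiff.
Proof. by move=> S T U; apply/setP=> i; rewrite !inE addbA. Qed.

Lemma symdiffC : commutative symdiff.
Proof. by move=> S T; apply/setP=> i; rewrite !inE addbC. Qed.

Lemma symdiff0s : left_id finset.set0 symdiff.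
Proof. by move=> S; apply/setP=> i; rewrite !inE. Qed.

Lemma symdiffs0 : right_id finset.set0 symdiff.
Proof. by move=> S; rewrite symdiffC symdiff0s. Qed.

Lemma symdiffss S : symdiff S S = finset.set0.
Proof. by apply/setP=> i; rewrite !inE addbb. Qed.

Lemma symdiffK S : involutive (symdiff S).
Proof. by move=> T; rewrite symdiffA symdiffss symdiff0s. Qed.

End SymmetricDifference.

(* The real Clifford algebra of Euclidean R^n, with v w + w v = - 2 (v, w) 1,
   in the basis e_S = e_(i_1) ... e_(i_k) for S = {i_1 < ... < i_k}.
   Sorting e_S e_T costs a sign for every pair i \in S, j \in T with j < i,
   and e_i e_i = - 1 costs a sign for every i \in S :&: T; hence
   e_S e_T = (-1) ^ (number of pairs with j <= i) e_(symdiff S T). *)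
Definition cl_exp n (S T : {set 'I_n}) : nat :=
  (\sum_(i in S) \sum_(j in T) (j <= i))%N.

Definition clifford (R : realType) (n : nat) : Type :=
  {ffun {set 'I_n} -> R^o}.

Section CliffordAlgebra.
Variables (R : realType) (n : nat).
Local Notation Cl := (clifford R n).
Local Notation sgn S T := ((-1) ^+ @cl_exp n S T : R).

HB.instance Definition _ := Vector.copy Cl {ffun {set 'I_n} -> R^o}.

Definition cl_coef (a : Cl) (S : {set 'I_n}) : R := (a : {ffun _ -> _}) S.

Definition cl_make (c : {set 'I_n} -> R) : Cl := [ffun S => c S].

Lemma cl_makeE c S : cl_coef (cl_make c) S = c S.
Proof. by rewrite /cl_coef ffunE. Qed.

Lemma clP (a b : Cl) : (forall S, cl_coef a S = cl_coef b S) <-> a = b.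
Proof. by split=> [h|->//]; apply/ffunP=> S; apply: h. Qed.

Lemma cl_coefD (a b : Cl) S : cl_coef (a + b) S = cl_coef a S + cl_coef b S.
Proof. by rewrite /cl_coef ffunE. Qed.

Lemma cl_coefZ (k : R) (a : Cl) S : cl_coef (k *: a) S = k * cl_coef a S.
Proof. by rewrite /cl_coef ffunE. Qed.

Definition cl_mul (a b : Cl) : Cl := cl_make (fun U =>
  \sum_S sgn S (symdiff S U) * cl_coef a S * cl_coef b (symdiff S U)).

Definition cl_one : Cl := cl_make (fun S => (S == finset.set0)%:R).

Lemma cl_sgnDl (S T U : {set 'I_n}) : sgn (symdiff S T) U = sgn S U * sgn T U.
Proof.
rewrite -signr_odd -[sgn S U]signr_odd -[sgn T U]signr_odd -signr_addb.
congr (_ ^+ (nat_of_bool _)); rewrite /cl_exp.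
rewrite !(big_morph odd oddD (erefl : odd 0 = false)).
rewrite [LHS]big_mkcond [X in _ = X (+) _]big_mkcond.
rewrite [X in _ = _ (+) X]big_mkcond -big_split /=; apply: eq_bigr => i _.
rewrite inE; case: (i \in S); case: (i \in T) => //=.
- by rewrite addbb.
- by rewrite addbF.
Qed.

Lemma cl_sgnDr (S T U : {set 'I_n}) : sgn U (symdiff S T) = sgn U S * sgn U T.
Proof.
rewrite -signr_odd -[sgn U S]signr_odd -[sgn U T]signr_odd -signr_addb.
congr (_ ^+ (nat_of_bool _)); rewrite /cl_exp.
rewrite !(big_morph odd oddD (erefl : odd 0 = false)) -big_split /=.
apply: eq_bigr => i _.
rewrite !(big_morph odd oddD (erefl : odd 0 = false)).
rewrite [LHS]big_mkcond [X in _ = X (+) _]big_mkcond.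
rewrite [X in _ = _ (+) X]big_mkcond -big_split /=; apply: eq_bigr => j _.
rewrite inE; case: (j \in S); case: (j \in T) => //=.
- by rewrite addbb.
- by rewrite addbF.
Qed.

Lemma cl_sgn0l (S : {set 'I_n}) : sgn finset.set0 S = 1.
Proof. by rewrite /cl_exp big_set0 expr0. Qed.

Lemma cl_sgn0r (S : {set 'I_n}) : sgn S finset.set0 = 1.
Proof. by rewrite /cl_exp big1 ?expr0 // => i _; rewrite big_set0. Qed.

Lemma cl_mulA : associative cl_mul.
Proof.
move=> a b c; apply/clP => U; rewrite !cl_makeE.
under eq_bigr do rewrite cl_makeE mulr_sumr.
under [RHS]eq_bigr do rewrite cl_makeE mulr_sumr mulr_suml.
rewrite [RHS]exchange_big /=; apply: eq_bigr => P _.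
rewrite [RHS](reindex_inj (inv_inj (symdiffK P))) /=.
apply: eq_bigr => T _; rewrite symdiffK.
have -> : symdiff P U = symdiff T (symdiff (symdiff P T) U).
  by rewrite !symdiffA [symdiff T P]symdiffC -(symdiffA P) symdiffss symdiffs0.
rewrite symdiffK; set W := symdiff (symdiff P T) U.
rewrite cl_sgnDl cl_sgnDr; ring.
Qed.

Lemma cl_mul1 : left_id cl_one cl_mul.
Proof.
move=> a; apply/clP => U; rewrite cl_makeE (bigD1 finset.set0) //= cl_makeE eqxx.
rewrite symdiff0s cl_sgn0l !mul1r big1 ?addr0 // => S /negPf S0.
by rewrite cl_makeE S0 mulr0 mul0r.
Qed.

Lemma cl_mulr1 : right_id cl_one cl_mul.
Proof.
move=> a; apply/clP => U; rewrite cl_makeE (bigD1 U) //= cl_makeE.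
rewrite symdiffss eqxx cl_sgn0r mulr1 mul1r big1 ?addr0 // => S /negPf SU.
rewrite cl_makeE; case: eqP => [h|_]; last by rewrite mulr0.
by move: SU; rewrite -[U](symdiffK S) h symdiffs0 eqxx.
Qed.

Lemma cl_mulDl : left_distributive cl_mul +%R.
Proof.
move=> a b c; apply/clP => U; rewrite cl_coefD !cl_makeE -big_split /=.
by apply: eq_bigr => S _; rewrite cl_coefD mulrDr mulrDl.
Qed.

Lemma cl_mulDr : right_distributive cl_mul +%R.
Proof.
move=> a b c; apply/clP => U; rewrite cl_coefD !cl_makeE -big_split /=.
by apply: eq_bigr => S _; rewrite cl_coefD mulrDr.
Qed.

Lemma cl_one_neq0 : cl_one != 0.
Proof.
apply/eqP => /clP/(_ finset.set0); rewrite cl_makeE eqxx /cl_coef ffunE.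
exact/eqP/oner_neq0.
Qed.

HB.instance Definition _ := GRing.Zmodule_isNzRing.Build Cl
  cl_mulA cl_mul1 cl_mulr1 cl_mulDl cl_mulDr cl_one_neq0.

Lemma cl_coefM (a b : Cl) U : cl_coef (a * b) U =
  \sum_S sgn S (symdiff S U) * cl_coef a S * cl_coef b (symdiff S U).
Proof. exact: cl_makeE. Qed.

Lemma cl_scaleAl (k : R) (a b : Cl) : k *: (a * b) = (k *: a) * b.
Proof.
apply/clP => U; rewrite cl_coefZ !cl_coefM mulr_sumr.
by apply: eq_bigr => S _; rewrite cl_coefZ !mulrA [k * _]mulrC.
Qed.

Lemma cl_scaleAr (k : R) (a b : Cl) : k *: (a * b) = a * (k *: b).
Proof.
apply/clP => U; rewrite cl_coefZ !cl_coefM mulr_sumr.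
by apply: eq_bigr => S _; rewrite cl_coefZ mulrCA.
Qed.

HB.instance Definition _ := GRing.Lmodule_isLalgebra.Build R Cl cl_scaleAl.
HB.instance Definition _ := GRing.Lalgebra_isAlgebra.Build R Cl cl_scaleAr.
HB.instance Definition _ := Algebra_isFalgebra.Build R Cl.


Definition cl_base (S : {set 'I_n}) : Cl := cl_make (fun T => (T == S)%:R).

Lemma cl_baseM S T : cl_base S * cl_base T = sgn S T *: cl_base (symdiff S T).
Proof.
apply/clP => U; rewrite cl_coefM cl_coefZ !cl_makeE (bigD1 S) //= !cl_makeE eqxx.
rewrite big1 ?addr0 => [|V /negPf VS]; last by rewrite cl_makeE VS mulr0 mul0r.
rewrite mulr1; have -> : (symdiff S U == T) = (U == symdiff S T).
  by rewrite -(inj_eq (inv_inj (symdiffK S))) symdiffK.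
by case: eqP => [->|_]; rewrite ?symdiffK ?mulr0.
Qed.

Definition cl_vec (v : 'rV[R]_n) : Cl :=
  \sum_i v 0 i *: cl_base [set i]%SET.

Definition cl_unvec (a : Cl) : 'rV[R]_n := \row_i cl_coef a [set i]%SET.

Definition cl_tr (a : Cl) : Cl :=
  cl_make (fun S => (-1) ^+ 'C(#|S|, 2) * cl_coef a S).

Lemma cl_coef_vec v i : cl_coef (cl_vec v) [set i]%SET = v 0 i.
Proof.
have -> : cl_coef (cl_vec v) [set i]%SET =
    \sum_j v 0 j * cl_coef (cl_base [set j]%SET) [set i]%SET.
  rewrite /cl_vec; elim/big_rec2: _ => [|j y1 y2 _ <-].
    by rewrite /cl_coef ffunE.
  by rewrite cl_coefD cl_coefZ.
rewrite (bigD1 i) //= cl_makeE eqxx mulr1 big1 ?addr0 // => j ji.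
by rewrite cl_makeE (inj_eq set1_inj) eq_sym (negPf ji) mulr0.
Qed.

Lemma cl_vecK : cancel cl_vec cl_unvec.
Proof. by move=> v; apply/rowP => i; rewrite mxE cl_coef_vec. Qed.

Lemma cl_base0 : cl_base finset.set0 = 1.
Proof. by []. Qed.

Lemma cl_base1M i j : i != j ->
  cl_base [set i]%SET * cl_base [set j]%SET =
  - (cl_base [set j]%SET * cl_base [set i]%SET).
Proof.
move=> ij; rewrite !cl_baseM /cl_exp !big_set1 symdiffC -scaleNr.
congr (_ *: _); case: ltngtP => [_|_|/val_inj eij].
- by rewrite ?expr0 ?expr1 ?opprK.
- by rewrite ?expr0 ?expr1 ?opprK.
- by rewrite eij eqxx in ij.
Qed.

Lemma cl_base1K i : cl_base [set i]%SET * cl_base [set i]%SET = -1.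
Proof.
by rewrite cl_baseM /cl_exp !big_set1 leqnn symdiffss cl_base0 expr1 scaleN1r.
Qed.

Lemma cl_clifford (v w : 'rV[R]_n) :
  cl_vec v * cl_vec w + cl_vec w * cl_vec v = (- 2 * \sum_i v 0 i * w 0 i)%:A.
Proof.
rewrite {1 4}/cl_vec mulr_suml mulr_sumr -big_split /=.
rewrite mulr_sumr scaler_suml; apply: eq_bigr => i _.
rewrite /cl_vec mulr_sumr mulr_suml -big_split /= (bigD1 i) //= big1 => [|j ji].
  rewrite addr0 -!scalerAl -!scalerAr !scalerA cl_base1K [w 0 i * _]mulrC.
  rewrite -scalerDl -mulr2n -[-1 in LHS]scaleN1r scalerA; congr (_ *: _).
  by rewrite /GRing.scale /=; ring.
rewrite -!scalerAl -!scalerAr !scalerA [w 0 j * _]mulrC -scalerDr.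
by rewrite (cl_base1M ji) subrr scaler0.
Qed.

Lemma cl_exp_diag (S : {set 'I_n}) : cl_exp S S = ('C(#|S|, 2) + #|S|)%N.
Proof.
move: {2}#|S| (erefl #|S|) => k; elim: k S => [|k IHk] S Sk.
  by move/eqP: Sk; rewrite cards_eq0 => /eqP->; rewrite cards0 /cl_exp big_set0.
have /card_gt0P[m mS] : (0 < #|S|)%N by rewrite Sk.
pose T := (S :\ m)%SET; have mT : m \notin T by rewrite !inE eqxx.
have ST : S = (m |: T)%SET by rewrite finset.setD1K.
have Tk : #|T| = k by apply: succn_inj; rewrite -Sk ST cardsU1 mT.
have -> : cl_exp S S =
    (1 + \sum_(j in T) (j <= m) + \sum_(i in T) (m <= i) + cl_exp T T)%N.
  rewrite /cl_exp ST big_setU1 //= big_setU1 //= leqnn -!addnA; congr (_ + (_ + _))%N.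
  rewrite -big_split /=; apply: eq_bigr => i iT.
  by rewrite big_setU1.
rewrite IHk // -(addnA 1%N) -[(\sum_(j in T) (j <= m) + _)%N]big_split /=.
rewrite (eq_bigr (fun=> 1%N)) => [|j jT].
  by rewrite sum1_card Sk Tk binS bin1; ring.
case: ltngtP => //= /val_inj jm; by rewrite jm (negPf mT) in jT.
Qed.

Lemma cl_tr_base (S : {set 'I_n}) : cl_tr (cl_base S) = (-1) ^+ 'C(#|S|, 2) *: cl_base S.
Proof.
apply/clP => T; rewrite cl_coefZ !cl_makeE.
by case: eqP => [->|_]; rewrite ?mulr0.
Qed.

Lemma cl_trK : involutive cl_tr.
Proof.
by move=> a; apply/clP => S; rewrite !cl_makeE mulrA -exprMn mulrNN mulr1 expr1n mul1r.
Qed.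

Lemma cl_tr_sgn (S : {set 'I_n}) :
  (-1) ^+ 'C(#|S|, 2) = sgn S S * (-1) ^+ #|S|.
Proof.
by rewrite cl_exp_diag exprD -mulrA -expr2 sqrr_sign mulr1.
Qed.

Lemma card_symdiff_sgn (S T : {set 'I_n}) :
  (-1) ^+ #|symdiff S T| = (-1) ^+ #|S| * (-1) ^+ #|T| :> R.
Proof.
rewrite -signr_odd -[_ ^+ #|S|]signr_odd -[_ ^+ #|T|]signr_odd -signr_addb.
congr (_ ^+ nat_of_bool _); rewrite -!sum1_card.
rewrite !(big_morph odd oddD (erefl : odd 0 = false)).
rewrite [LHS]big_mkcond [X in _ = X (+) _]big_mkcond.
rewrite [X in _ = _ (+) X]big_mkcond -big_split /=; apply: eq_bigr => i _.
by rewrite inE; case: (i \in S); case: (i \in T).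
Qed.

Lemma cl_trM a b : cl_tr (a * b) = cl_tr b * cl_tr a.
Proof.
apply/clP => U; rewrite cl_makeE !cl_coefM mulr_sumr.
have UK : involutive (fun S => symdiff S U).
  by move=> S; rewrite -symdiffA symdiffss symdiffs0.
rewrite (reindex_inj (inv_inj UK)) /=; apply: eq_bigr => T _.
rewrite !cl_makeE UK.
have UE : U = symdiff (symdiff T U) T.
  by rewrite [symdiff _ T]symdiffC symdiffK.
move: (symdiff T U) UE => S ->.
rewrite !cl_tr_sgn !card_symdiff_sgn !cl_sgnDl !cl_sgnDr.
have sq (A B : {set 'I_n}) : sgn A B * sgn A B = 1.
  by rewrite -exprMn mulrNN mulr1 expr1n.
have := sq S T; move: (sgn S T) (sgn T S) => x y hx.
transitivity ((x * x) * y * (sgn S S * (-1) ^+ #|S| * (sgn T T * (-1) ^+ #|T|)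
  * (cl_coef a S * cl_coef b T))); last by rewrite hx; ring.
ring.
Qed.

Lemma cl_tr_vec v : cl_tr (cl_vec v) = cl_vec v.
Proof.
apply/clP => S; rewrite cl_makeE.
have [/cards1P[i ->]|S1] := boolP (#|S| == 1%N); first by rewrite cards1 mul1r.
suff -> : cl_coef (cl_vec v) S = 0 by rewrite mulr0.
rewrite /cl_vec; elim/big_rec: _ => [|i a _ ha]; first by rewrite /cl_coef ffunE.
rewrite cl_coefD cl_coefZ ha cl_makeE addr0; case: eqP => [Si|]; last by rewrite mulr0.
by rewrite Si cards1 in S1.
Qed.

End CliffordAlgebra.

Local Open Scope complex_scope.

Definition dot (K : nzRingType) (n : nat) (v w : 'rV[K]_n) : K :=
  \sum_i v 0 i * w 0 i.

(* The subgroup of the units of the Clifford algebra generated by the nonzero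
   vectors. *)
Inductive clifford_group (R : realType) (n : nat) : clifford R n -> Prop :=
| clifford_group_vec v : v != 0 -> clifford_group (cl_vec v)
| clifford_group1 : clifford_group 1
| clifford_groupM a b :
    clifford_group a -> clifford_group b -> clifford_group (a * b)
| clifford_groupV a : clifford_group a -> clifford_group a^-1.

Definition is_vector (R : realType) (n : nat) (a : clifford R n) : Prop :=
  exists v, a = cl_vec v.

Definition mx2 (A : Type) (a b c d : A) : 'M[A]_2 :=
  \matrix_(i, j) if i == 0 then (if j == 0 then a else b)
                 else (if j == 0 then c else d).

Definition SL_Gamma (R : realType) (n : nat) (F : 'M[clifford R n]_2) : Prop :=
  let a := F 0 0 in let b := F 0 1 in let c := F 1 0 in let d := F 1 1 in
  [/\ forall i j, F i j = 0 \/ clifford_group (F i j),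
      is_vector (a * cl_tr c) /\ is_vector (b * cl_tr d),
      is_vector (cl_tr a * b) /\ is_vector (cl_tr c * d) &
      a * cl_tr d - b * cl_tr c = 1].

(* The action on R^n \cup {oo}, where oo is None. For F in SL_Gamma the
   denominator is zero or invertible, and the quotient is a vector, so that
   cl_unvec loses nothing. *)
Definition moebius (R : realType) (n : nat) (F : 'M[clifford R n]_2)
    (x : option 'rV[R]_n) : option 'rV[R]_n :=
  let num := if x is Some v then F 0 0 * cl_vec v + F 0 1 else F 0 0 in
  let den := if x is Some v then F 1 0 * cl_vec v + F 1 1 else F 1 0 in
  if den == 0 then None else Some (cl_unvec (num / den)).

Section Topology.
Variables (R : realType) (M : topologicalType).

Definition path_connected : Prop :=
  forall x y : M, exists c : R -> M,
    [/\ {within `[0, 1], continuous c}, c 0 = x & c 1 = y].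

Definition loops_contract : Prop :=
  forall c : R -> M, {within `[0, 1], continuous c} -> c 0 = c 1 ->
  exists H : R * R -> M,
    [/\ {within `[0, 1] `*` `[0, 1], continuous H},
        forall t, t \in `[0, 1] -> H (t, 0) = c t,
        forall t, t \in `[0, 1] -> H (t, 1) = c 0 &
        forall s, s \in `[0, 1] -> H (0, s) = c 0 /\ H (1, s) = c 0].

Definition simply_connected : Prop := path_connected /\ loops_contract.

End Topology.

Definition holomorphic (R : realType) (D : set R[i]^o) (f : R[i]^o -> R[i]^o) :
  Prop := forall z, D z -> derivable f z 1.

Record chart (R : realType) (M : topologicalType) := Chart {
  chart_dom : set M;
  chart_img : set R[i]^o;
  chart_map :> M -> R[i]^o;
  chart_inv : R[i]^o -> M;
  chart_dom_open : open chart_dom;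
  chart_img_open : open chart_img;
  chart_map_img : forall p, chart_dom p -> chart_img (chart_map p);
  chart_inv_dom : forall z, chart_img z -> chart_dom (chart_inv z);
  chart_mapK : forall p, chart_dom p -> chart_inv (chart_map p) = p;
  chart_invK : forall z, chart_img z -> chart_map (chart_inv z) = z;
  chart_map_continuous : {within chart_dom, continuous chart_map};
  chart_inv_continuous : {within chart_img, continuous chart_inv}
}.

Definition transition (R : realType) (M : topologicalType) (c c' : chart R M) :
  R[i]^o -> R[i]^o := c' \o chart_inv c.

Definition overlap (R : realType) (M : topologicalType) (c c' : chart R M) :
  set R[i]^o := chart_img c `&` chart_inv c @^-1` chart_dom c'.

Record riemannSurface (R : realType) := RiemannSurface {
  rs_space :> topologicalType;
  rs_atlas : set (chart R rs_space);
  rs_hausdorff : hausdorff_space rs_space;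
  rs_connected : connected [set: rs_space];
  rs_cover : forall p : rs_space, exists2 c, rs_atlas c & chart_dom c p;
  rs_holomorphic : forall c c', rs_atlas c -> rs_atlas c' ->
    holomorphic (overlap c c') (transition c c')
}.

(* Q = qd_coef c dz^2 in the chart c with coordinate z. *)
Record quadraticDifferential (R : realType) (M : riemannSurface R) :=
  QuadraticDifferential {
  qd_coef : chart R M -> R[i]^o -> R[i]^o;
  qd_holomorphic : forall c, rs_atlas c ->
    holomorphic (chart_img c) (qd_coef c);
  qd_transition : forall c c', rs_atlas c -> rs_atlas c' ->
    forall z, overlap c c' z ->
    qd_coef c z =
      qd_coef c' (transition c c' z) * (derive1 (transition c c') z) ^+ 2
}.

Definition qd_nonzero (R : realType) (M : riemannSurface R)
    (Q : quadraticDifferential M) : Prop :=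
  exists c z, [/\ rs_atlas c, chart_img c z & qd_coef Q c z != 0].

Section Calculus.
Variable R : realType.
Local Notation C := (R[i]^o).

(* The real derivative at z in the direction v; the coordinate z = x + i y has
   d/dx in the direction 1 and d/dy in the direction 'i. *)
Definition line (v z : C) (t : R) : C := z + t%:C * v.

Definition pd (v : C) (u : C -> R) (z : C) : R := derive1 (u \o line v z) 0.

Fixpoint class_C (k : nat) (D : set C) (u : C -> R) : Prop :=
  {within D, continuous u} /\
  if k is k'.+1 then
    forall v, v = 1 \/ v = 'i ->
      (forall z, D z -> derivable (u \o line v z) (0 : R) (1 : R)) /\
      class_C k' D (pd v u)
  else True.

Definition pd_vec n (v : C) (f : C -> 'rV[R]_n) (z : C) : 'rV[R]_n :=
  \row_j pd v (fun w => f w 0 j) z.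

Definition pd_cl n (v : C) (a : C -> clifford R n) (z : C) : clifford R n :=
  cl_make (fun S => pd v (fun w => cl_coef (a w) S) z).

Definition pd_mx n (v : C) (F : C -> 'M[clifford R n]_2) (z : C) :
  'M[clifford R n]_2 := \matrix_(i, j) pd_cl v (fun w => F w i j) z.

(* d/dz = (d/dx - i d/dy) / 2 *)
Definition dz_vec n (f : C -> 'rV[R]_n) (z : C) : 'rV[R[i]]_n :=
  \row_j ((pd_vec 1 f z 0 j / 2) +i* (- (pd_vec 'i f z 0 j / 2))).

End Calculus.

Section Surface.
Variables (R : realType) (M : riemannSurface R).

Definition smooth_on (U : set M) (u : M -> R) : Prop :=
  forall c, rs_atlas c -> forall k,
  class_C k (chart_img c `&` chart_inv c @^-1` U) (u \o chart_inv c).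

Definition smooth_vec_on n (U : set M) (f : M -> 'rV[R]_n) : Prop :=
  forall j, smooth_on U (fun p => f p 0 j).

(* Identities between 1-forms and 2-forms are stated on d/dx and d/dy in every
   chart. *)
Definition in_charts (U : set M) (P : chart R M -> R[i]^o -> Prop) : Prop :=
  forall c z, rs_atlas c -> chart_img c z -> U (chart_inv c z) -> P c z.

Definition conformal_immersion_on n (U : set M) (f : M -> 'rV[R]_n) : Prop :=
  smooth_vec_on U f /\
  in_charts U (fun c z =>
    let fx := pd_vec 1 (f \o chart_inv c) z in
    let fy := pd_vec 'i (f \o chart_inv c) z in
    [/\ dot fx fx = dot fy fy, dot fx fy = 0 &
        forall s t : R, s *: fx + t *: fy = 0 -> s = 0 /\ t = 0]).

Variable Q : quadraticDifferential M.

(* df /\ dfc = 0 and (df, dfc)^(2,0) = Q *)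
Definition christoffel_on n (U : set M) (f fc : M -> 'rV[R]_n) : Prop :=
  smooth_vec_on U fc /\
  in_charts U (fun c z =>
    cl_vec (pd_vec 1 (f \o chart_inv c) z) *
    cl_vec (pd_vec 'i (fc \o chart_inv c) z) -
    cl_vec (pd_vec 'i (f \o chart_inv c) z) *
    cl_vec (pd_vec 1 (fc \o chart_inv c) z) = 0 /\
    dot (dz_vec (f \o chart_inv c) z) (dz_vec (fc \o chart_inv c) z) =
    qd_coef Q c z).

(* fh = f + g is a transform D_s f of the isothermic f, with
   dg = s g dfc g - df *)
Definition darboux_on n (U : set M) (s : R) (f fh : M -> 'rV[R]_n) : Prop :=
  conformal_immersion_on U f /\
  exists fc, christoffel_on U f fc /\
  let g := fun p => fh p - f p in
  [/\ smooth_vec_on U g,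
      forall p, U p -> g p != 0 &
      in_charts U (fun c z => forall v, v = 1 \/ v = 'i ->
        cl_vec (pd_vec v (g \o chart_inv c) z) =
        s *: (cl_vec (g (chart_inv c z)) *
              cl_vec (pd_vec v (fc \o chart_inv c) z) *
              cl_vec (g (chart_inv c z)))
        - cl_vec (pd_vec v (f \o chart_inv c) z))].

(* F^-1 dF = ((0, df), (r dfc, 0)) *)
Definition T_frame n (r : R) (f fc : M -> 'rV[R]_n)
    (F : M -> 'M[clifford R n]_2) : Prop :=
  [/\ forall i j S, smooth_on setT (fun p => cl_coef (F p i j) S),
      forall p, SL_Gamma (F p) &
      in_charts setT (fun c z => forall v, v = 1 \/ v = 'i ->
        pd_mx v (F \o chart_inv c) z =
        F (chart_inv c z) *m
          mx2 0 (cl_vec (pd_vec v (f \o chart_inv c) z))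
              (r *: cl_vec (pd_vec v (fc \o chart_inv c) z)) 0)].

(* phi is a representative of T_r f, where fc is the Christoffel transform of
   f. With F, all A F for A in SL_Gamma are frames, so that the image of a
   representative under a Moebius transformation is again one. *)
Definition T_transform n (r : R) (f fc : M -> 'rV[R]_n)
    (phi : M -> option 'rV[R]_n) : Prop :=
  exists2 F, T_frame r f fc F & forall p, phi p = moebius (F p) (Some 0).

Definition finite_locus n (phi : M -> option 'rV[R]_n) : set M :=
  [set p | phi p <> None].

Definition finite_part n (phi : M -> option 'rV[R]_n) (p : M) : 'rV[R]_n :=
  odflt 0 (phi p).

End Surface.

(* Main.v *)
(* Trivialise the flat connection by a frame F whose rows are (a, b) and (c, d).  That F takes
   values in SL(Gamma_n) is proved by showing that conjugation by F preserves the Minkowski space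
   of matrices ((v, s), (t, -v)): the entries of F X F^-1 solve a linear system, so the linear
   conditions expressing this propagate from a base point, and the Cartan-Dieudonne theorem puts
   the entries of such an F in Gamma_n or {0}.

   Then f_r = F . 0 = b d^-1 represents T_r f.  Exchanging the columns of F (after rescaling, and
   after composing with the volume element when r > 0, which restores the determinant 1) solves
   the system of T_r f^c, so that F . oo = a c^-1 represents T_r f^c.  With g = a c^-1 - b d^-1 =
   (d^-1)^t c^-1 one finds df_r = (d^-1)^t df d^-1 and d(a c^-1) = - r (c^-1)^t df^c c^-1, while
   the closed form d df^c d^t integrates to a Christoffel transform f_r^c of f_r with
   g df_r^c g = (c^-1)^t df^c c^-1; hence dg = - r g df_r^c g - df_r. *)
Require Import Defs.
From HB Require Import structures.
From mathcomp Require Import all_boot all_order all_algebra all_field.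
From mathcomp Require Import all_classical all_reals all_analysis.
From mathcomp Require Import complex ring lra.

Set Implicit Arguments.
Unset Strict Implicit.
Unset Printing Implicit Defensive.

Import Order.TTheory GRing.Theory Num.Theory.
Import numFieldNormedType.Exports.

Local Open Scope classical_set_scope.
Local Open Scope ring_scope.
Local Open Scope complex_scope.

(** * Linear differential equations on the line *)

Section RealCalculus.
Variable R : realType.
Implicit Types (f g : R -> R) (s t a b e : R).

(** The group [SL(Gamma_n)] is cut out by non-linear conditions, so [F] is first integrated in the
    linear space of all Clifford-valued matrices; membership in the group is recovered from
    conditions that are linear in the pairings of two rows of [F]. Flatness amounts to the
    closedness of [df] and [df^c] together with [df ^ df^c = 0] and its transpose.

    The initial matrix is [((1, 0), (w, 1))] with [w] a nonzero vector and not the identity: at the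
    identity [F . oo] is infinite, whereas here [b d^-1] and [a c^-1] are both finite at the base
    point.

    Exchanging the columns with the factors [k r] and [k] multiplies the determinant by [- k^2 r],
    whence [k = |r|^(-1/2)]. For [r > 0] the remaining sign is removed by a diagonal matrix built
    from the volume element: its determinant is [-1], yet it fixes every point of [R^n], so the
    represented map is still [a c^-1].

    The locus where [c] and [d] are both nonzero need not be simply connected. The Christoffel
    transform of [f_r] is therefore integrated over all of [M], which is possible because
    [d df^c d^t] is defined and closed at the zeros of [d] as well. *)

Lemma is_derive_continuous f t (d : R) : is_derive t 1 f d -> {for t, continuous f}.
Proof.
by move=> [df _]; apply/differentiable_continuous/derivable1_diffP.
Qed.

Lemma mean_value_le f (df : R -> R) t0 e (C : R) :
  (forall t, `|t - t0| < e -> is_derive t 1 f (df t)) ->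
  (forall t, `|t - t0| < e -> `|df t| <= C) ->
  forall s t, `|s - t0| < e -> `|t - t0| < e -> `|f t - f s| <= C * `|t - s|.
Proof.
move=> fdf dfC s t; wlog st : s t / s <= t => [H hs ht|hs ht].
  have [|/ltW] := leP s t => st; first exact: H.
  by rewrite distrC (distrC t); apply: H.
have inB x : x \in `[s, t] -> `|x - t0| < e.
  rewrite in_itv /= => /andP[sx xt]; move: hs ht; rewrite !ltr_norml; lra.
have [||c cst ->] := @MVT_segment R f df s t st.
- by move=> x /subset_itv_oo_cc xst; apply/fdf/inB.
- apply: derivable_within_continuous => x /inB /fdf [].
  by [].
- by rewrite normrM ler_wpM2r // dfC // inB.
Qed.

Lemma primitive_exists g a b : continuous g ->
  exists G : R -> R, forall t, a < t -> t < b -> is_derive t 1 G (g t).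
Proof.
move=> cg; pose mu := @lebesgue_measure R.
have [ab|ba] := ltP a b; last first.
  by exists 0 => t at_ tb; have := lt_trans at_ tb; rewrite ltNge ba.
exists (fun x => (\int[mu]_(t in [set` `[a, x]]) (g t))%R) => t at_ tb.
have int : mu.-integrable `[a, b] (EFin \o g).
  apply: continuous_compact_integrable; first exact: segment_compact.
  exact: continuous_subspaceT.
have [dG eG] := continuous_FTC1_closed tb int at_ (cg t).
by split=> //; rewrite -derive1E.
Qed.

(** The increments telescope: [x m] is within [B / 2^n - B / 2^m] of [x n]. Hence every
    [x m - B / 2^m] lies below every [x n + B / 2^n], and the supremum of the former separates the
    two families. *)
Lemma dyadic_limit (x : nat -> R) (B : R) :
  (forall n, `|x n.+1 - x n| <= B / 2 ^+ n.+1) ->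
  exists l, forall n, `|l - x n| <= B / 2 ^+ n.
Proof.
move=> hx; have B0 : 0 <= B.
  have := le_trans (normr_ge0 _) (hx 0%N); rewrite expr1; lra.
have step n : B / 2 ^+ n.+1 = B / 2 ^+ n / 2 by rewrite exprS invfM mulrA mulrAC.
have far m n : (n <= m)%N -> `|x m - x n| <= B / 2 ^+ n - B / 2 ^+ m.
  elim: m => [|m IH]; first by rewrite leqn0 => /eqP->; rewrite !subrr normr0.
  rewrite leq_eqVlt => /predU1P[->|]; first by rewrite !subrr normr0.
  rewrite ltnS => /IH; have := hx m; rewrite step !ler_norml => /andP[? ?] /andP[? ?].
  by apply/andP; split; lra.
have pos n : 0 <= B / 2 ^+ n by rewrite divr_ge0 // exprn_ge0.
have cross m n : x m - B / 2 ^+ m <= x n + B / 2 ^+ n.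
  have [/far|/ltnW /far] := leqP n m; rewrite ler_norml => /andP[? ?];
  have := pos n; have := pos m; lra.
pose E := [set y | exists n, y = x n - B / 2 ^+ n].
have ubE n : ubound E (x n + B / 2 ^+ n) by move=> _ [m ->].
exists (sup E) => n; have E0 : E !=set0 by exists (x 0%N - B / 2 ^+ 0); exists 0%N.
have le1 : sup E <= x n + B / 2 ^+ n by apply: ge_sup.
have le2 : x n - B / 2 ^+ n <= sup E.
  by apply: ub_le_sup; [exists (x n + B / 2 ^+ n)|exists n].
by rewrite ler_norml; apply/andP; split; lra.
Qed.

Lemma dyadic_eq0 (x B : R) : (forall n, `|x| <= B / 2 ^+ n) -> x = 0.
Proof.
move=> hx; apply/eqP; rewrite -normr_le0 leNgt; apply/negP => x0.
have := hx (Num.bound (B / `|x|)); apply/negP; rewrite -ltNge.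
rewrite ltr_pdivrMr ?exprn_gt0 // -ltr_pdivrMl // mulrC.
apply: (lt_trans (archi_boundP _)).
  by rewrite divr_ge0 //; have := le_trans (normr_ge0 _) (hx 0%N); rewrite expr0 divr1.
by rewrite -natrX ltr_nat ltn_expl.
Qed.

End RealCalculus.

Section LinearODE.
Variables (R : realType) (J : finType).
Implicit Types (a : J -> J -> R -> R) (u v : J -> R -> R).

(** The retraction of the line onto the interval of radius [e] around [t0]. Composing with it lets
    the Picard operator act on functions on the whole line, with bounds valid everywhere. *)
Definition clamp (t0 e t : R) : R := Num.max (t0 - e) (Num.min (t0 + e) t).

Lemma clamp_near t0 e t : 0 <= e -> `|clamp t0 e t - t0| <= e.
Proof.
move=> e0; rewrite /clamp ler_norml; case: (leP (t0 + e) t) => h.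
  by case: (leP (t0 - e) (t0 + e)) => h'; apply/andP; split; lra.
by case: (leP (t0 - e) t) => h'; apply/andP; split; lra.
Qed.

Lemma clamp_id t0 e t : `|t - t0| <= e -> clamp t0 e t = t.
Proof.
rewrite /clamp ler_norml => /andP[h1 h2]; case: (leP (t0 + e) t) => h.
  by case: (leP (t0 - e) (t0 + e)) => h'; lra.
by case: (leP (t0 - e) t) => h'; lra.
Qed.

Lemma clamp_continuous t0 e : continuous (clamp t0 e).
Proof.
move=> t; apply: (@continuous_max _ _ (cst (t0 - e)) (fun t => Num.min (t0 + e) t)).
  exact: cst_continuous.
apply: (@continuous_min _ _ (cst (t0 + e)) id); first exact: cst_continuous.
by move=> ?; exact: cvg_id.
Qed.

Lemma continuous_sum (T : topologicalType) (I : finType) (F : I -> T -> R^o) (t : T) :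
  (forall i, {for t, continuous (F i)}) -> {for t, continuous (fun x => \sum_i F i x : R^o)}.
Proof.
move=> cF; apply: (@cvg_big _ _ +%R 0) => //.
  by move=> x; exact: add_continuous.
by move=> i _; exact: cF.
Qed.

Lemma sum_le_card (F : J -> R) C : (forall j, `|F j| <= C) ->
  `|\sum_j F j| <= #|J|%:R * C.
Proof.
move=> h; apply: le_trans (ler_norm_sum _ _ _) _.
apply: le_trans (ler_sum _ (fun j _ => h j)) _.
by rewrite sumr_const mulr_natl.
Qed.

Variables (a : J -> J -> R -> R) (t0 e K : R).
Hypothesis e0 : 0 < e.
Hypothesis aK : forall k j t, `|t - t0| <= e -> `|a k j t| <= K.
Hypothesis ac : forall k j t, `|t - t0| <= e -> {for t, continuous (a k j)}.
Hypothesis small : #|J|%:R * K * e <= 1 / 2.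

Let rhs u j t : R := \sum_k u k t * a k j (clamp t0 e t).

Let rhs_continuous u : (forall j, continuous (u j)) -> forall j, continuous (rhs u j).
Proof.
move=> cu j t; apply: continuous_sum => k; apply: cvgM; first exact: cu.
apply: continuous_comp; first exact: clamp_continuous.
by apply: ac; apply: clamp_near; exact: ltW.
Qed.

Let rhs_bound u (B : R) j t : (forall k t, `|u k t| <= B) -> `|rhs u j t| <= #|J|%:R * (B * K).
Proof.
move=> uB; apply: sum_le_card => k; rewrite normrM ler_pM //.
by apply: aK; apply: clamp_near; exact: ltW.
Qed.

(** The radius [e + 1] puts the closed interval of radius [e], in which [clamp] takes its values,
    inside the open interval where the primitive is differentiable. *)
Let prim (f : R -> R) : R -> R := xget 0 [set G : R -> R | forall t, `|t - t0| < e + 1 -> is_derive t 1 G (f t)].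

Let primP (f : R -> R) : continuous f -> forall t, `|t - t0| < e + 1 -> is_derive t 1 (prim f) (f t).
Proof.
move=> cf; rewrite /prim; case: xgetP => [G _ //|].
have [G hG] := primitive_exists (t0 - (e + 1)) (t0 + (e + 1)) cf.
move=> /(_ G) /= h; exfalso; apply: h => t; rewrite ltr_norml => /andP[? ?].
apply: hG; lra.
Qed.

Let picard (u0 : J -> R) u j t : R :=
  u0 j + (prim (rhs u j) (clamp t0 e t) - prim (rhs u j) t0).

Let clamp_near1 t : `|clamp t0 e t - t0| < e + 1.
Proof. by apply: le_lt_trans (clamp_near _ _ (ltW e0)) _; rewrite ltrDl. Qed.

Let t0_near1 : `|t0 - t0| < e + 1.
Proof. by rewrite subrr normr0 addr_gt0. Qed.

Let picard_continuous (u0 : J -> R) u : (forall j, continuous (u j)) -> forall j, continuous (picard u0 u j).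
Proof.
move=> cu j t; apply: cvgD; first exact: cvg_cst.
apply: cvgB; last exact: cvg_cst.
apply: (@continuous_comp _ _ _ (clamp t0 e) (prim (rhs u j))); first exact: clamp_continuous.
exact: is_derive_continuous (primP (@rhs_continuous _ cu j) (clamp_near1 t)).
Qed.

Let smallM (B : R) : 0 <= B -> #|J|%:R * (B * K) * e <= B / 2.
Proof.
move=> B0; have -> : #|J|%:R * (B * K) * e = B * (#|J|%:R * K * e) by ring.
by rewrite -[_ / 2](_ : B * (1 / 2) = _) ?ler_wpM2l //; field.
Qed.

(** Since [rhs] is linear, the difference of the two images has derivative [rhs (u - v)], of size at
    most [#|J| * B * K]; over a distance of at most [e] the hypothesis [small] turns this into the
    contraction factor [1 / 2]. *)
Let picard_lip (u0 : J -> R) u v (B : R) : (forall j, continuous (u j)) -> (forall j, continuous (v j)) ->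
  (forall j t, `|u j t - v j t| <= B) ->
  forall j t, `|picard u0 u j t - picard u0 v j t| <= B / 2.
Proof.
move=> cu cv uv j t; have B0 := le_trans (normr_ge0 _) (uv j t).
pose G s := prim (rhs u j) s - prim (rhs v j) s.
have -> : picard u0 u j t - picard u0 v j t = G (clamp t0 e t) - G t0.
  by rewrite /picard /G; ring.
apply: le_trans (smallM B0).
apply: (@le_trans _ _ (#|J|%:R * (B * K) * `|clamp t0 e t - t0|)); last first.
  apply: ler_wpM2l (clamp_near _ _ (ltW e0)).
  by apply: le_trans (normr_ge0 _) (@rhs_bound (fun k t => u k t - v k t) B j t uv).
apply: (@mean_value_le _ _ (rhs (fun k t => u k t - v k t) j) t0 (e + 1)) => //.
- move=> s hs; have := is_deriveB (primP (@rhs_continuous _ cu j) hs) (primP (@rhs_continuous _ cv j) hs).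
  congr (is_derive _ _ _ _); rewrite /rhs -sumrB; apply: eq_bigr => k _; ring.
- move=> s hs; exact: rhs_bound.
Qed.

Let iterates (u0 : J -> R) n : J -> R -> R := iter n (picard u0) (fun j => cst (u0 j)).

Let iterates_continuous (u0 : J -> R) n j : continuous (iterates u0 n j).
Proof.
by elim: n j => [|n IH] j; [exact: cst_continuous|exact: picard_continuous].
Qed.

Let iterates_step (u0 : J -> R) (B : R) : (forall j, `|u0 j| <= B) -> forall n j t,
  `|iterates u0 n.+1 j t - iterates u0 n j t| <= B / 2 ^+ n.+1.
Proof.
move=> uB; elim=> [|n IH] j t; last first.
  rewrite [_ ^+ _]exprSr invfM mulrA.
  rewrite -[iterates u0 n.+2 j t]/(picard u0 (iterates u0 n.+1) j t).
  rewrite -[iterates u0 n.+1 j t]/(picard u0 (iterates u0 n) j t).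
  apply: picard_lip => [k|k|k s].
  - exact: (@iterates_continuous u0 _ k).
  - exact: (@iterates_continuous u0 _ k).
  - exact: IH.
have B0 := le_trans (normr_ge0 _) (uB j).
rewrite /iterates /= /picard /cst addrC addKr expr1.
apply: le_trans (smallM B0).
apply: (@le_trans _ _ (#|J|%:R * (B * K) * `|clamp t0 e t - t0|)); last first.
  apply: ler_wpM2l (clamp_near _ _ (ltW e0)).
  exact: le_trans (normr_ge0 _) (@rhs_bound (fun k t => u0 k) B j t (fun k _ => uB k)).
apply: (@mean_value_le _ _ (rhs (fun k => cst (u0 k)) j) t0 (e + 1)) => //.
- move=> s hs; apply: primP => //; apply: rhs_continuous => k; exact: cst_continuous.
- by move=> s hs; apply: rhs_bound => k r; exact: uB.
Qed.

(** Picard iteration: the iterates converge geometrically to a fixed point of the contraction.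
    Thanks to the clamping, the bound [2 * B] holds at every [t]; the Frobenius argument uses it to
    bound a whole family of solutions uniformly. *)
Lemma linear_ode_exists (u0 : J -> R) : exists u : J -> R -> R,
  [/\ forall j, u j t0 = u0 j,
      forall B, (forall j, `|u0 j| <= B) -> forall j t, `|u j t| <= 2 * B &
      forall j t, `|t - t0| < e -> is_derive t 1 (u j) (\sum_k u k t * a k j t)].
Proof.
pose A := \sum_j `|u0 j|.
have uA j : `|u0 j| <= A by rewrite /A (bigD1 j) //= lerDl sumr_ge0.
pose u j t : R := xget 0 [set l | forall n, `|l - iterates u0 n j t| <= A / 2 ^+ n].
have uP j t n : `|u j t - iterates u0 n j t| <= A / 2 ^+ n.
  rewrite /u; case: xgetP => [l _ //|hl].
  have [l hl'] := dyadic_limit (fun n => iterates_step uA n j t).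
  by case: (hl l).
have uc j : continuous (u j).
  move=> t; apply/cvgrPdist_le => /= eps eps0.
  have [n hn] : exists n, A / 2 ^+ n <= eps / 3.
    exists (Num.bound (A / (eps / 3))).
    rewrite ler_pdivrMr ?exprn_gt0 // mulrC -ler_pdivrMr; last by lra.
    have A0 : 0 <= A by apply: sumr_ge0.
    apply/ltW; apply: lt_trans (archi_boundP _) _; first by rewrite divr_ge0 //; lra.
    by rewrite -natrX ltr_nat ltn_expl.
  have /cvgrPdist_le /(_ (eps / 3)) /= := @iterates_continuous (u0 : J -> R) n j t.
  have eps3 : 0 < eps / 3 by lra.
  move=> /(_ eps3); apply: filterS => s hs.
  have h1 := le_trans (uP j t n) hn; have h2 := le_trans (uP j s n) hn.
  move: h1 h2 hs; rewrite !ler_norml; lra.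
have uT j t : u j t = picard u0 u j t.
  apply/eqP; rewrite -subr_eq0; apply/eqP; apply: (@dyadic_eq0 _ _ A) => n.
  have h1 := uP j t n.+1.
  have := @picard_lip u0 u (iterates u0 n) (A / 2 ^+ n) uc (@iterates_continuous u0 n)
    (fun k s => uP k s n) j t.
  rewrite -[picard _ _ _ _ in X in `|X - _|]/(picard u0 u j t).
  have -> : picard u0 (iterates u0 n) j t = iterates u0 n.+1 j t by [].
  move: h1; rewrite exprS invfM mulrA mulrAC.
  move: (u j t) (picard u0 u j t) (iterates _ _ _ _) => x y z.
  rewrite !ler_norml; lra.
exists u; split.
- move=> j; rewrite uT /picard clamp_id ?subrr ?addr0 // normr0; exact: ltW.
- move=> B hB j t.
  (* The iterates do not depend on the constant used to estimate them, so the limit obtained with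
     [B] is the [u] obtained with [A]. *)
  have [l hl] := dyadic_limit (fun n => iterates_step hB n j t).
  have <- : l = u j t.
    apply/eqP; rewrite -subr_eq0; apply/eqP; apply: (@dyadic_eq0 _ _ (A + B)) => n.
    have := hl n; have := uP j t n; rewrite mulrDl.
    move: (l) (u j t) (iterates _ _ _ _) => x y z; rewrite !ler_norml; lra.
  have := hl 0%N; have := hB j; rewrite /iterates /= /cst expr0 divr1 !ler_norml; lra.
- move=> j t ht; have ht1 : `|t - t0| < e + 1 by lra.
  have := primP (@rhs_continuous _ uc j) ht1.
  have -> : rhs u j t = \sum_k u k t * a k j t.
    by rewrite /rhs clamp_id //; exact: ltW.
  move=> hd; pose c := u0 j - prim (rhs u j) t0.
  have hd' : is_derive t 1 (cst c + prim (rhs u j)) (rhs u j t).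
    have := is_deriveD (is_derive_cst c t 1) hd; rewrite add0r.
    by rewrite /rhs clamp_id //; exact: ltW.
  have hr : rhs u j t = \sum_k u k t * a k j t by rewrite /rhs clamp_id //; exact: ltW.
  rewrite -hr; apply: near_eq_is_derive hd'.
  have /(@open_nbhs_nbhs _ t): open_nbhs t [set s | `|s - t0| < e].
    split => //; rewrite (_ : [set s | _] = ball t0 e); first exact: ball_open.
    by apply/seteqP; split => s /=; rewrite distrC.
  apply: filterS => s /= hs; rewrite uT /picard clamp_id; last exact: ltW.
  by transitivity (c + prim (rhs u j) s) => //; rewrite /c; ring.
Qed.

End LinearODE.

(** * Derivatives as first-order approximations *)

Section EpsilonDerivative.
Variable R : realType.
Implicit Types (f : R -> R) (x d : R).

Lemma is_derive_approx f x d : is_derive x 1 f d -> forall eps, 0 < eps ->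
  exists2 del, 0 < del &
    forall h, `|h| < del -> `|f (x + h) - f x - h * d| <= eps * `|h|.
Proof.
move=> [+ <-] eps eps0; rewrite /derivable -/('D_1 f x) => /cvgrPdist_le /(_ _ eps0).
rewrite near_withinE => /nbhs_ballP[del /= del0 H]; exists del => // h hdel.
have [->|hN0] := eqVneq h 0; first by rewrite addr0 !mul0r !subrr !normr0 mulr0.
have := H h; rewrite /ball /= sub0r normrN => /(_ hdel hN0).
rewrite -/('D_1 f x) scaler1 [h + x]addrC.
move=> le1; have -> : f (x + h) - f x - h * 'D_1 f x =
    - h * ('D_1 f x - h^-1 *: (f (x + h) - f x)).
  rewrite /GRing.scale /= mulrBr !mulNr mulVKf //; ring.
by rewrite normrM normrN mulrC ler_wpM2r.
Qed.

Lemma approx_is_derive f x d : (forall eps, 0 < eps ->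
  exists2 del, 0 < del &
    forall h, `|h| < del -> `|f (x + h) - f x - h * d| <= eps * `|h|) ->
  is_derive x 1 f d.
Proof.
move=> H; have cvgd : h^-1 *: ((f \o shift x) (h *: 1) - f x) @[h --> 0^'] --> d.
  apply/cvgrPdist_le => /= eps eps0; rewrite near_withinE.
  have [del del0 hdel] := H _ eps0.
  apply/nbhs_ballP; exists del => // h; rewrite /ball /= sub0r normrN => hh hN0.
  rewrite scaler1 [h + x]addrC.
  have -> : d - h^-1 *: (f (x + h) - f x) = - h^-1 * (f (x + h) - f x - h * d).
    by rewrite /GRing.scale /= !mulrBr !mulNr mulrA mulVf // mul1r; ring.
  rewrite normrM normrN normfV mulrC ler_pdivrMr ?normr_gt0 //.
  by have := hdel h hh.
split; first by apply/cvg_ex; exists d.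
by apply/cvg_lim.
Qed.

Lemma is_derive_big (I : finType) (F : I -> R -> R) (d : I -> R) x :
  (forall i, is_derive x 1 (F i) (d i)) ->
  is_derive x 1 (fun s => \sum_i F i s) (\sum_i d i).
Proof.
move=> dF; elim: (index_enum I) => [|i r IH].
  under eq_fun do rewrite big_nil; rewrite big_nil; exact: is_derive_cst.
under eq_fun do rewrite big_cons; rewrite big_cons.
exact: is_deriveD (dF i) IH.
Qed.

End EpsilonDerivative.

(** * The Frobenius theorem on a small square *)

Section LocalFrobenius.
Variables (R : realType) (J : finType).

(** A Gronwall estimate by bootstrapping. With [X = 2 * (eta + e * zeta)], the mean value inequality
    improves the bound [X + M / 2^n] to [X + M / 2^(n+1)]; the a priori bound [M] thus disappears
    from the conclusion. *)
Lemma linear_stability (D E : J -> R -> R) (B : J -> J -> R -> R)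
    (y0 e K eta zeta M : R) :
  0 <= K -> 0 <= zeta -> #|J|%:R * K * e <= 1 / 2 ->
  (forall j y, `|y - y0| < e ->
     is_derive y 1 (D j) (\sum_k D k y * B k j y + E j y)) ->
  (forall k j y, `|y - y0| < e -> `|B k j y| <= K) ->
  (forall j y, `|y - y0| < e -> `|E j y| <= zeta) ->
  (forall j, `|D j y0| <= eta) ->
  (forall j y, `|y - y0| < e -> `|D j y| <= M) ->
  forall j y, `|y - y0| < e -> `|D j y| <= 2 * (eta + e * zeta).
Proof.
move=> K0 zeta0 small dD BK Ez Deta DM j y hy.
pose X := 2 * (eta + e * zeta).
have e0 : 0 < e by apply: le_lt_trans hy.
have iter n k s : `|s - y0| < e -> `|D k s| <= X + M / 2 ^+ n.
  elim: n k s => [|n IH] k s hs.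
    rewrite expr0 divr1; apply: le_trans (DM k s hs) _; rewrite lerDr.
    have := le_trans (normr_ge0 _) (Deta k); rewrite /X => eta0.
    by rewrite mulr_ge0 // addr_ge0 // mulr_ge0 // ltW.
  set Mn := X + M / 2 ^+ n in IH.
  have Mn0 : 0 <= Mn := le_trans (normr_ge0 _) (IH k s hs).
  have hy0 : `|y0 - y0| < e by rewrite subrr normr0.
  have := @mean_value_le _ (D k) _ y0 e (#|J|%:R * (Mn * K) + zeta) (dD k) _ y0 s hy0 hs.
  have -> : X + M / 2 ^+ n.+1 = (Mn + X) / 2.
    by rewrite /Mn exprS invfM; field; rewrite expf_neq0.
  move=> mv; have {mv} : `|D k s - D k y0| <= (#|J|%:R * (Mn * K) + zeta) * `|s - y0|.
    apply: mv => t ht; apply: le_trans (ler_normD _ _) _; apply: lerD; last exact: Ez.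
    by apply: sum_le_card => l; rewrite normrM ler_pM // ?IH ?BK.
  have : (#|J|%:R * (Mn * K) + zeta) * `|s - y0| <= Mn / 2 + e * zeta.
    apply: (@le_trans _ _ ((#|J|%:R * (Mn * K) + zeta) * e)).
      by apply: ler_wpM2l (ltW hs); rewrite addr_ge0 // mulr_ge0 // mulr_ge0.
    have -> : (#|J|%:R * (Mn * K) + zeta) * e = Mn * (#|J|%:R * K * e) + e * zeta by ring.
    by rewrite lerD2r -[_ / 2](_ : Mn * (1 / 2) = _) ?ler_wpM2l //; field.
  have XE : X = 2 * (eta + e * zeta) by [].
  have := Deta k; clearbody Mn X; move: (_ * `|s - y0|) (e * zeta) XE => P Q ->.
  move: (D k s) (D k y0) => p q; rewrite !ler_norml; lra.
rewrite leNgt; apply/negP => ltX.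
suff DX : `|D j y| - X = 0 by move: ltX; rewrite -subr_gt0 DX ltxx.
apply: (@dyadic_eq0 _ _ M) => n; rewrite ger0_norm; last by rewrite subr_ge0 ltW.
by rewrite lerBlDl; apply: iter.
Qed.

Variables (a b ay bx : J -> J -> R -> R -> R) (x0 y0 e K : R).
Hypothesis e0 : 0 < e.
Hypothesis small : #|J|%:R * K * e <= 1 / 2.
Let near0 x y := `|x - x0| <= e /\ `|y - y0| <= e.
Hypothesis aK : forall k j x y, near0 x y -> `|a k j x y| <= K.
Hypothesis bK : forall k j x y, near0 x y -> `|b k j x y| <= K.
Hypothesis bxK : forall k j x y, near0 x y -> `|bx k j x y| <= K.
Hypothesis bxl : forall k j x x' y, near0 x y -> near0 x' y ->
  `|bx k j x y - bx k j x' y| <= K * `|x - x'|.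
Hypothesis ac : forall k j x y, near0 x y -> {for x, continuous (a k j ^~ y)}.
Hypothesis bc : forall k j x y, near0 x y -> {for y, continuous (b k j x)}.
Hypothesis day : forall k j x y, near0 x y -> is_derive y 1 (a k j x) (ay k j x y).
Hypothesis dbx : forall k j x y, near0 x y -> is_derive x 1 (b k j ^~ y) (bx k j x y).
Hypothesis flat : forall k j x y, near0 x y ->
  ay k j x y + \sum_l b k l x y * a l j x y =
  bx k j x y + \sum_l a k l x y * b l j x y.

(** The system is solved along [y = y0] and then along every vertical line; what remains is the
    [x]-equation off [y = y0]. For fixed [h], the error [D] of the expected first-order expansion of
    [v] between [x] and [x + h] satisfies in [y] the linear system of [b] with a source [E].
    Flatness cancels the part of the source that is linear in [h], so [E] is quadratic in [h]; as
    [D] is [o(h)] on [y = y0], [linear_stability] keeps it [o(h)] on the whole vertical line. *)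
Lemma local_frobenius_real (v0 : J -> R) : exists v : J -> R -> R -> R,
  [/\ forall j, v j x0 y0 = v0 j,
      exists C, forall j x y, `|v j x y| <= C,
      forall j x y, `|x - x0| < e -> `|y - y0| < e ->
        is_derive x 1 (v j ^~ y) (\sum_k v k x y * a k j x y) &
      forall j x y, `|x - x0| < e -> `|y - y0| < e ->
        is_derive y 1 (v j x) (\sum_k v k x y * b k j x y)].
Proof.
have y00 : `|y0 - y0| <= e by rewrite subrr normr0 ltW.
have x00 : `|x0 - x0| <= e by rewrite subrr normr0 ltW.
have y00' : `|y0 - y0| < e by rewrite subrr normr0.
have x00' : `|x0 - x0| < e by rewrite subrr normr0.
have [u [u_x0 uB du]] := @linear_ode_exists R J (fun k j x => a k j x y0) x0 e K e0
  (fun k j x hx => @aK k j _ _ (conj hx y00)) (fun k j x hx => @ac k j _ _ (conj hx y00)) small v0.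
pose P x (w : J -> R -> R) := [/\ forall j, w j y0 = u j x,
  forall B, (forall j, `|u j x| <= B) -> forall j t, `|w j t| <= 2 * B &
  forall j t, `|t - y0| < e -> is_derive t 1 (w j) (\sum_k w k t * b k j x t)].
pose v j x y := xget (fun=> 0) [set w | P x w] j y.
have vP x : `|x - x0| <= e -> P x (fun j => v j x).
  move=> hx; rewrite /v; case: xgetP => [w -> //|].
  have [w hw] := @linear_ode_exists R J (fun k j y => b k j x y) y0 e K e0
    (fun k j y hy => @bK k j _ _ (conj hx hy)) (fun k j y hy => @bc k j _ _ (conj hx hy)) small (u^~ x).
  by move=> /(_ w) [].
pose V0 := \sum_j `|v0 j|.
have v0V j : `|v0 j| <= V0 by rewrite /V0 (bigD1 j) //= lerDl sumr_ge0.
have V00 : 0 <= V0 by apply: sumr_ge0.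
(* One factor 2 comes from solving along the horizontal line, the other from solving along the
   vertical ones. *)
pose V := 2 * (2 * V0).
have V0' : 0 <= V by rewrite /V !mulr_ge0.
have vV j x y : `|x - x0| <= e -> `|v j x y| <= V.
  by move=> hx; have [_ h _] := vP x hx; apply: h => k; apply: uB.
have dvy j x y : `|x - x0| < e -> `|y - y0| < e ->
    is_derive y 1 (v j x) (\sum_k v k x y * b k j x y).
  by move=> hx hy; have [_ _] := vP x (ltW hx); apply.
(* For [x] outside the interval the choice of [v] is uncontrolled; cutting it off there yields the
   global bound. *)
pose w j x y := if `|x - x0| <= e then v j x y else 0.
suff dvx j x y : `|x - x0| < e -> `|y - y0| < e ->
    is_derive x 1 (v j ^~ y) (\sum_k v k x y * a k j x y).
  have inb x : `|x - x0| < e -> \forall s \near x, w ^~ s = v ^~ s.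
    move=> hx; have /(@open_nbhs_nbhs _ x): open_nbhs x [set s | `|s - x0| < e].
      split => //; rewrite (_ : [set s | _] = ball x0 e); first exact: ball_open.
      by apply/seteqP; split => s /=; rewrite distrC.
    apply: filterS => s /= hs; apply/funext => j; apply/funext => y.
    by rewrite /w ltW.
  exists w; split.
  - by move=> j; rewrite /w x00; have [-> _ _] := vP x0 x00.
  - by exists V => j x y; rewrite /w; case: ifPn => [/vV|_]; rewrite ?normr0.
  - move=> j x y hx hy.
    have -> : \sum_k w k x y * a k j x y = \sum_k v k x y * a k j x y.
      by apply: eq_bigr => k _; rewrite /w (ltW hx).
    apply: near_eq_is_derive (dvx j x y hx hy).
    by apply: filterS (inb x hx) => s /(congr1 (fun F => F j y)) ->.
  - move=> j x y hx hy; rewrite /w (ltW hx); exact: dvy.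
move=> hx hy.
have K0 : 0 <= K := le_trans (normr_ge0 _) (@aK j j _ _ (conj (ltW hx) (ltW hy))).
pose N : R := #|J|%:R; have N0 : 0 <= N by rewrite ler0n.
pose va k x y := \sum_l v l x y * a l k x y.
have vaV k s t : `|s - x0| <= e -> `|t - y0| <= e -> `|va k s t| <= N * (V * K).
  by move=> hs ht; apply: sum_le_card => l; rewrite normrM ler_pM // ?vV ?aK.
pose C := N * (V * (2 * K)) + N * (N * (V * K) * K).
have C0 : 0 <= C by rewrite /C addr_ge0 // !mulr_ge0.
apply: approx_is_derive => eps eps0.
pose eps1 := eps / 4.
have eps10 : 0 < eps1 by rewrite /eps1; lra.
have [del del0 hdel] : exists2 del, 0 < del & forall k h, `|h| < del ->
    `|u k (x + h) - u k x - h * \sum_l u l x * a l k x y0| <= eps1 * `|h|.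
  have /(@fin_all_exists2 _ _ (fun=> [set d : R | 0 < d])
      (fun k d => forall h, `|h| < d -> `|u k (x + h) - u k x -
        h * \sum_l u l x * a l k x y0| <= eps1 * `|h|)) [d d0 hd] :
      forall k, exists2 d, 0 < d & forall h, `|h| < d -> `|u k (x + h) - u k x -
        h * \sum_l u l x * a l k x y0| <= eps1 * `|h|.
    by move=> k; apply: is_derive_approx; [exact: du|].
  exists (\big[Num.min/1]_k d k).
    by elim/big_ind: _ => [|p q p0 q0|k _]; rewrite ?lt_min ?p0 ?q0 //; exact: d0.
  move=> k h hh; apply: hd; apply: lt_le_trans hh _; exact: bigmin_le_cond.
(* The three constraints give: the expansion of [u] on the initial line; room for the interval of
   radius [2 * |h|] around [x], on which the second-order estimate of [b] is made; and
   [e * C * |h| <= eps1]. *)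
pose del2 := Num.min (Num.min del ((e - `|x - x0|) / 2)) (eps1 / (e * C + 1)).
have eC0 : 0 < e * C + 1 by rewrite ltr_wpDl // mulr_ge0 // ltW.
exists del2.
  by rewrite /del2 !lt_min del0 !divr_gt0 // subr_gt0.
move=> h; rewrite /del2 !lt_min => /andP[/andP[hd he] hC].
have hxh : `|x + h - x0| < e.
  rewrite addrAC; apply: le_lt_trans (ler_normD _ _) _; lra.
pose D k t := v k (x + h) t - v k x t - h * va k x t.
pose E k t := \sum_l v l x t * (b l k (x + h) t - b l k x t - h * bx l k x t)
  + h * \sum_l va l x t * (b l k (x + h) t - b l k x t).
have diffb k l t : `|t - y0| <= e -> `|b l k (x + h) t - b l k x t| <= K * `|h|.
  move=> ht; have -> : `|h| = `|x + h - x| by rewrite addrC addKr.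
  apply: (@mean_value_le _ (b l k ^~ t) (bx l k ^~ t) x0 e) => // s hs.
    by apply: dbx; split => //; exact: ltW.
  by apply: bxK; split => //; exact: ltW.
have diff2b k l t : `|t - y0| <= e ->
    `|b l k (x + h) t - b l k x t - h * bx l k x t| <= K * (2 * `|h|) * `|h|.
  move=> ht; pose G s := b l k s t - (s - x) * bx l k x t.
  have -> : b l k (x + h) t - b l k x t - h * bx l k x t = G (x + h) - G x.
    by rewrite /G; ring.
  have [->|h0] := eqVneq h 0.
    by rewrite addr0 subrr normr0 !mulr0.
  have hp : 0 < `|h| by rewrite normr_gt0.
  have -> : K * (2 * `|h|) * `|h| = K * (2 * `|h|) * `|x + h - x| by rewrite addrC addKr.
  have inx s : `|s - x| < 2 * `|h| -> `|s - x0| <= e.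
    move=> hs; have -> : s - x0 = (s - x) + (x - x0) by ring.
    by apply: le_trans (ler_normD _ _) _; lra.
  apply: (@mean_value_le _ G (fun s => bx l k s t - bx l k x t) x (2 * `|h|)).
  - move=> s /inx hs; have hb := @dbx l k _ _ (conj hs ht).
    have h1 := is_deriveB hb (is_deriveM (is_deriveB (is_derive_id s 1) (is_derive_cst x s 1))
      (is_derive_cst (bx l k x t) s 1)).
    apply: is_derive_eq h1 _; rewrite /GRing.scale /= /cst /=; ring.
  - move=> s hs; have hs' := inx s hs.
    apply: le_trans (@bxl l k _ _ _ (conj hs' ht) (conj (ltW hx) ht)) _.
    by rewrite ler_wpM2l // ltW.
  - by rewrite subrr normr0; lra.
  - by rewrite addrC addKr; lra.
have hx' := ltW hx; have hxh' := ltW hxh; have hy' := ltW hy.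
have dD k t : `|t - y0| < e ->
    is_derive t 1 (D k) (\sum_l D l t * b l k (x + h) t + E k t).
  move=> ht; have ht' := ltW ht.
  (* The only use of flatness: differentiating directly produces [ay + b a], which is replaced by
     [bx + a b], the terms that the expansion of [b] in [h] can cancel. *)
  have dva : is_derive t 1 (va k x) (\sum_l (v l x t * bx l k x t + va l x t * b l k x t)).
    have dl l : is_derive t 1 (fun s => v l x s * a l k x s)
        (v l x t * ay l k x t + (\sum_m v m x t * b m l x t) * a l k x t).
      have := is_deriveM (dvy l x t hx ht) (@day l k _ _ (conj hx' ht')).
      by rewrite /GRing.scale /= [a l k x t * _]mulrC.
    apply: is_derive_eq (is_derive_big dl) _.
    rewrite !big_split /=.
    under [X in _ + X = _]eq_bigr do rewrite mulr_suml.
    rewrite exchange_big /=.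
    under [X in _ = _ + X]eq_bigr do rewrite /va mulr_suml.
    rewrite [X in _ = _ + X]exchange_big /= -!big_split /=; apply: eq_bigr => l _.
    under eq_bigr do rewrite -mulrA; under [X in _ = _ + X]eq_bigr do rewrite -mulrA.
    by rewrite -!mulr_sumr -!mulrDr (flat l k (conj hx' ht')).
  have h1 := is_deriveB (is_deriveB (dvy k _ t hxh ht) (dvy k _ t hx ht)) (is_deriveZ h dva).
  apply: is_derive_eq h1 _.
  rewrite /E /GRing.scale /= !mulr_sumr -!sumrB -!big_split /=; apply: eq_bigr => l _.
  rewrite /D; ring.
have EC k t : `|t - y0| < e -> `|E k t| <= C * `|h| * `|h|.
  move=> ht; have ht' := ltW ht; apply: le_trans (ler_normD _ _) _.
  have -> : C * `|h| * `|h| = N * (V * (K * (2 * `|h|) * `|h|)) +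
      `|h| * (N * (N * (V * K) * (K * `|h|))) by rewrite /C; ring.
  apply: lerD.
    by apply: sum_le_card => l; rewrite normrM ler_pM // ?vV ?diff2b.
  rewrite normrM; apply: ler_wpM2l => //.
  by apply: sum_le_card => l; rewrite normrM ler_pM // ?vaV ?diffb.
have Dy0 k : `|D k y0| <= eps1 * `|h|.
  rewrite /D; have [-> _ _] := vP _ hxh'; have [-> _ _] := vP _ hx'.
  suff -> : va k x y0 = \sum_l u l x * a l k x y0 by exact: hdel.
  by apply: eq_bigr => l _; have [-> _ _] := vP _ hx'.
have DM k t : `|t - y0| < e -> `|D k t| <= V + V + `|h| * (N * (V * K)).
  move=> ht; have ht' := ltW ht.
  apply: le_trans (ler_normB _ _) _; apply: lerD.
    by apply: le_trans (ler_normB _ _) _; rewrite lerD // vV.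
  by rewrite normrM ler_wpM2l // vaV.
have zeta0 : 0 <= C * `|h| * `|h| by rewrite !mulr_ge0.
have bK' l m t : `|t - y0| < e -> `|b l m (x + h) t| <= K.
  by move=> ht; apply: bK; split=> //; exact: ltW.
apply: le_trans (linear_stability K0 zeta0 small dD bK' EC Dy0 DM j hy) _.
have -> : eps * `|h| = 2 * (eps1 * `|h| + eps1 * `|h|) by rewrite /eps1; field.
rewrite ler_pM2l // lerD2l mulrA ler_wpM2r //.
move: hC; rewrite ltr_pdivlMr // => hC; apply: le_trans (ltW hC).
by rewrite mulrA mulrC ler_wpM2l // lerDl.
Qed.

End LocalFrobenius.

(** * Smooth functions on the plane *)

Section ClassC.
Variable R : realType.
Local Notation C := (R[i]^o).
Implicit Types (D : set C) (u w : C -> R) (z v : C).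

Definition is_pd v u z (d : R) := is_derive (0 : R) 1 (u \o line v z) d.

Lemma line0 v z : line v z (0 : R) = z.
Proof. by rewrite /line mul0r addr0. Qed.

Lemma is_pd_val v u z d : is_pd v u z d -> pd v u z = d.
Proof. by move=> [_ <-]; rewrite /pd derive1E. Qed.

Lemma derivable_is_pd v u z : derivable (u \o line v z) (0 : R) (1 : R) ->
  is_pd v u z (pd v u z).
Proof. by move=> h; split=> //; rewrite /pd derive1E. Qed.

Lemma is_pd_add v u w z d e : is_pd v u z d -> is_pd v w z e ->
  is_pd v (fun x => u x + w x) z (d + e).
Proof. by move=> h1 h2; apply: (is_deriveD h1 h2). Qed.

Lemma is_pd_sub v u w z d e : is_pd v u z d -> is_pd v w z e ->
  is_pd v (fun x => u x - w x) z (d - e).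
Proof. by move=> h1 h2; apply: (is_deriveB h1 h2). Qed.

Lemma is_pd_cst v (c : R) z : is_pd v (fun=> c) z 0.
Proof. exact: (is_derive_cst c (0 : R) 1). Qed.

Lemma is_pd_mul v u w z d e : is_pd v u z d -> is_pd v w z e ->
  is_pd v (fun x => u x * w x) z (d * w z + u z * e).
Proof.
move=> h1 h2; apply: is_derive_eq (is_deriveM h1 h2) _.
by rewrite /GRing.scale /= !line0; ring.
Qed.

Lemma is_pd_scale v u z d (k : R) : is_pd v u z d ->
  is_pd v (fun x => k * u x) z (k * d).
Proof.
move=> h; have := is_pd_mul (is_pd_cst v k z) h; by rewrite mul0r add0r.
Qed.

Lemma is_pd_sum (I : finType) v (u : I -> C -> R) z (d : I -> R) :
  (forall i, is_pd v (u i) z (d i)) ->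
  is_pd v (fun x => \sum_i u i x) z (\sum_i d i).
Proof. by move=> h; apply: is_derive_big. Qed.

Lemma is_pd_inv v u z d : u z != 0 -> is_pd v u z d ->
  is_pd v (fun x => (u x)^-1) z (- d * ((u z)^-1 * (u z)^-1)).
Proof.
move=> u0 [du <-]; have u0' : (u \o line v z) 0 != 0 by rewrite /= line0.
split; first exact: derivableV.
rewrite deriveV // /= line0 /GRing.scale /= expr2 invfM; ring.
Qed.

Lemma line_continuous v z : continuous (line v z : R -> C).
Proof.
move=> t; apply/cvgrPdist_lt => e e0.
have [d d0 hd] : exists2 d : R, 0 < d & d%:C * `|v| < e.
  have ee : e = (complex.Re e)%:C by move: e0; rewrite ltcE; case: e => a b /= /andP[/eqP-> _].
  have nv : `|v| = (complex.Re `|v|)%:C by rewrite normc_def.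
  have e0' : 0 < complex.Re e by move: e0; rewrite {1}ee ltcR.
  have v0 : 0 <= complex.Re `|v| by have := normr_ge0 v; rewrite {1}nv lecR.
  exists (complex.Re e / (complex.Re `|v| + 1)); first by rewrite divr_gt0 // ltr_wpDl.
  rewrite nv ee -rmorphM ltcR mulrAC ltr_pdivrMr ?ltr_wpDl // ltr_pM2l //=.
  by rewrite ltrDl.
apply/nbhs_ballP; exists d => //= s; rewrite /ball /= => hs.
rewrite /line opprD addrACA subrr add0r -mulrBl -rmorphB normrM.
apply: le_lt_trans hd; apply: ler_wpM2r => //.
by rewrite normc_def /= expr0n addr0 sqrtr_sqr lecR ltW.
Qed.

Lemma is_pd_near v u w z d : (\forall x \near z, u x = w x) ->
  is_pd v u z d -> is_pd v w z d.
Proof.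
move=> uw; apply: near_eq_is_derive.
have := @line_continuous v z 0; rewrite /continuous_at line0 => /(_ _ uw).
exact.
Qed.

Lemma within_openP D u : open D ->
  {within D, continuous u} <-> forall z, D z -> {for z, continuous u}.
Proof.
move=> oD; rewrite continuous_open_subspace //; split => h z.
  by move=> Dz; apply: h; rewrite inE.
by rewrite inE; apply: h.
Qed.

(** Invariance of [class_C k] under changes off [D] enters as a hypothesis because [class_C_ext] is
    itself proved by induction from this lemma; [class_CS_step] is the version with that hypothesis
    discharged. *)
Lemma class_CS_intro k D u : open D -> (forall z, D z -> {for z, continuous u}) ->
  (forall v, v = 1 \/ v = 'i -> exists2 d, class_C k D d &
     forall z, D z -> is_pd v u z (d z)) ->
  (forall d d' : C -> R, (forall z, D z -> d z = d' z) -> class_C k D d -> class_C k D d') ->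
  class_C k.+1 D u.
Proof.
move=> oD cu du ext; split; first exact/within_openP.
move=> v hv; have [d dk hd] := du v hv; split.
  by move=> z /hd [].
by apply: ext dk => z Dz; rewrite (is_pd_val (hd z Dz)).
Qed.

Lemma class_C_continuous k D u : open D -> class_C k D u ->
  forall z, D z -> {for z, continuous u}.
Proof. by move=> oD; case: k => [|k] [cu _]; apply/within_openP. Qed.

Lemma class_CS_pd k D u v : v = 1 \/ v = 'i -> class_C k.+1 D u -> class_C k D (pd v u).
Proof. by move=> hv [_ /(_ v hv) []]. Qed.

Lemma class_CS_is_pd k D u v z : v = 1 \/ v = 'i -> class_C k.+1 D u -> D z ->
  is_pd v u z (pd v u z).
Proof. by move=> hv [_ /(_ v hv) [h _]] Dz; apply/derivable_is_pd/h. Qed.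

Lemma open_near (T : topologicalType) (D : set T) (z : T) (P : T -> Prop) : open D -> D z ->
  (forall x, D x -> P x) -> \forall x \near z, P x.
Proof. by move=> oD Dz DP; have := open_nbhs_nbhs (conj oD Dz); apply: filterS. Qed.

Lemma continuous_ext_open D u w z : open D -> (forall z, D z -> u z = w z) -> D z ->
  {for z, continuous u} -> {for z, continuous w}.
Proof.
move=> oD uw Dz cu P; rewrite -(uw z Dz) => /cu; apply: filterS2 (open_near oD Dz uw).
by move=> x /= <-.
Qed.

Lemma class_C_ext k D u w : open D -> (forall z, D z -> u z = w z) ->
  class_C k D u -> class_C k D w.
Proof.
move=> oD; elim: k u w => [|k IH] u w uw ku.
  split=> //; apply/within_openP => // z Dz.
  exact: continuous_ext_open oD uw Dz (class_C_continuous oD ku Dz).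
apply: class_CS_intro => // [z Dz|v hv].
  exact: continuous_ext_open oD uw Dz (class_C_continuous oD ku Dz).
exists (pd v u); first exact: class_CS_pd ku.
move=> z Dz; apply: is_pd_near (class_CS_is_pd hv ku Dz).
exact: open_near oD Dz uw.
Qed.

Lemma class_CS_step k D u : open D -> (forall z, D z -> {for z, continuous u}) ->
  (forall v, v = 1 \/ v = 'i -> exists2 d, class_C k D d &
     forall z, D z -> is_pd v u z (d z)) -> class_C k.+1 D u.
Proof.
move=> oD cu du; apply: class_CS_intro => // d d' dd'; exact: class_C_ext.
Qed.

Lemma class_CW k D u : class_C k.+1 D u -> class_C k D u.
Proof.
elim: k u => [|k IH] u [cu du]; split=> // v hv; have [h1 h2] := du v hv.
by split=> //; apply: IH.
Qed.

Lemma class_C_sub k D D' u : D' `<=` D -> class_C k D u -> class_C k D' u.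
Proof.
move=> DD'; elim: k u => [|k IH] u [cu du]; (split; first exact: continuous_subspaceW cu) => //.
move=> v hv; have [h1 h2] := du v hv; split; first by move=> z /DD' /h1.
exact: IH.
Qed.

Lemma class_C_cst k D (c : R) : class_C k D (fun=> c).
Proof.
elim: k c => [|k IH] c; (split; first exact/continuous_subspaceT/cst_continuous) => //.
move=> v hv; split=> [z _|]; first exact: derivable_cst.
have -> : pd v (fun=> c) = fun=> 0 by apply/funext => z; exact: is_pd_val (is_pd_cst v c z).
exact: IH.
Qed.

Lemma class_C_add k D u w : open D -> class_C k D u -> class_C k D w ->
  class_C k D (fun z => u z + w z).
Proof.
move=> oD; elim: k u w => [|k IH] u w hu hw.
  split=> //; apply/within_openP => // z Dz.
  exact: (continuousD (class_C_continuous oD hu Dz) (class_C_continuous oD hw Dz)).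
apply: class_CS_step => // [z Dz|v hv].
  exact: (continuousD (class_C_continuous oD hu Dz) (class_C_continuous oD hw Dz)).
exists (fun z => pd v u z + pd v w z).
  by apply: IH; apply: class_CS_pd.
by move=> z Dz; apply: is_pd_add; [exact: class_CS_is_pd hu Dz|exact: class_CS_is_pd hw Dz].
Qed.

Lemma class_C_mul k D u w : open D -> class_C k D u -> class_C k D w ->
  class_C k D (fun z => u z * w z).
Proof.
move=> oD; elim: k u w => [|k IH] u w hu hw.
  split=> //; apply/within_openP => // z Dz.
  exact: (continuousM (class_C_continuous oD hu Dz) (class_C_continuous oD hw Dz)).
apply: class_CS_step => // [z Dz|v hv].
  exact: (continuousM (class_C_continuous oD hu Dz) (class_C_continuous oD hw Dz)).
exists (fun z => pd v u z * w z + u z * pd v w z).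
  by apply: class_C_add => //; apply: IH; (exact: class_CS_pd || exact: class_CW).
by move=> z Dz; apply: is_pd_mul; [exact: class_CS_is_pd hu Dz|exact: class_CS_is_pd hw Dz].
Qed.

Lemma class_C_scale k D u (c : R) : open D -> class_C k D u -> class_C k D (fun z => c * u z).
Proof. by move=> oD; apply: class_C_mul => //; exact: class_C_cst. Qed.

Lemma class_C_sub_fun k D u w : open D -> class_C k D u -> class_C k D w ->
  class_C k D (fun z => u z - w z).
Proof.
move=> oD hu hw; have := class_C_add oD hu (class_C_scale (-1) oD hw).
by under eq_fun do rewrite mulN1r.
Qed.

Lemma class_C_sum (I : finType) k D (u : I -> C -> R) : open D ->
  (forall i, class_C k D (u i)) -> class_C k D (fun z => \sum_i u i z).
Proof.
move=> oD hu; elim: (index_enum I) => [|i r IH].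
  by under eq_fun do rewrite big_nil; exact: class_C_cst.
by under eq_fun do rewrite big_cons; apply: class_C_add.
Qed.

Lemma class_C_inv k D u : open D -> (forall z, D z -> u z != 0) -> class_C k D u ->
  class_C k D (fun z => (u z)^-1).
Proof.
move=> oD u0; elim: k => [|k IH] hu.
  split=> //; apply/within_openP => // z Dz.
  exact: (continuousV (u0 z Dz) (class_C_continuous oD hu Dz)).
apply: class_CS_step => // [z Dz|v hv].
  exact: (continuousV (u0 z Dz) (class_C_continuous oD hu Dz)).
exists (fun z => - 1 * pd v u z * ((u z)^-1 * (u z)^-1)).
  have hV := IH (class_CW hu).
  by do !apply: class_C_mul => //; [exact: class_C_cst|exact: class_CS_pd].
by move=> z Dz; rewrite mulN1r; apply: is_pd_inv; [exact: u0|exact: class_CS_is_pd hu Dz].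
Qed.

(** Regularity bootstrap: the equation writes the partial derivatives of the solutions as products
    of smooth coefficients and of functions whose class is already known. *)
Lemma linear_system_smooth (I : finType) D (y : I -> C -> R) (A : C -> I -> I -> C -> R) :
  open D ->
  (forall k v i j, v = 1 \/ v = 'i -> class_C k D (A v i j)) ->
  (forall j z, D z -> {for z, continuous (y j)}) ->
  (forall v j z, v = 1 \/ v = 'i -> D z -> is_pd v (y j) z (\sum_i y i z * A v i j z)) ->
  forall k j, class_C k D (y j).
Proof.
move=> oD sA cy dy; elim=> [|k IH] j.
  by split=> //; apply/within_openP => // z; exact: cy.
apply: class_CS_step => // [z|v hv]; first exact: cy.
exists (fun z => \sum_i y i z * A v i j z); last by move=> z; exact: dy.
by apply: class_C_sum => // i; apply: class_C_mul => //; exact: sA.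
Qed.

End ClassC.

(** * Differential calculus in the plane: mixed partials and the chain rule *)

Section PlaneCalculus.
Variable R : realType.
Local Notation C := (R[i]^o).
Local Notation Re := (@complex.Re R).
Local Notation Im := (@complex.Im R).
Implicit Types (D : set C) (u w : C -> R) (z v h : C).

Lemma ReD z h : Re (z + h) = Re z + Re h. Proof. by case: z; case: h. Qed.
Lemma ImD z h : Im (z + h) = Im z + Im h. Proof. by case: z; case: h. Qed.
Lemma ReB z h : Re (z - h) = Re z - Re h. Proof. by case: z; case: h. Qed.
Lemma ImB z h : Im (z - h) = Im z - Im h. Proof. by case: z; case: h. Qed.
Lemma ReZ (t : R) z : Re (t%:C * z) = t * Re z.
Proof. by case: z => a b /=; rewrite mul0r subr0. Qed.
Lemma ImZ (t : R) z : Im (t%:C * z) = t * Im z.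
Proof. by case: z => a b /=; rewrite mul0r addr0. Qed.

Lemma complex_normE z : `|z| = (Re `|z|)%:C.
Proof. by rewrite normc_def. Qed.

Lemma Re_normM z h : Re `|z * h| = Re `|z| * Re `|h|.
Proof. by rewrite normrM [`|z|]complex_normE [`|h|]complex_normE -rmorphM. Qed.

Lemma Re_le_norm z : `|Re z| <= Re `|z|.
Proof. by have := normc_ge_Re z; rewrite complex_normE lecR. Qed.

Lemma Im_le_norm z : `|Im z| <= Re `|z|.
Proof.
rewrite normc_def /= -[X in X <= _]sqrtr_sqr ler_wsqrtr // lerDr sqr_ge0 //.
Qed.

Lemma norm_le_ReIm z : Re `|z| <= `|Re z| + `|Im z|.
Proof.
rewrite normc_def /= -[X in _ <= X]ger0_norm ?addr_ge0 // -sqrtr_sqr ler_wsqrtr //.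
rewrite sqrrD !real_normK ?num_real //; have : 0 <= `|Re z| * `|Im z| by rewrite mulr_ge0.
move: (Re z ^+ 2) (Im z ^+ 2) (_ * _) => a b c; rewrite mulr2n; lra.
Qed.

Lemma nbhs_box z (P : C -> Prop) : (\forall x \near z, P x) ->
  exists2 e : R, 0 < e & forall h, `|Re h| < e -> `|Im h| < e -> P (z + h).
Proof.
move=> /nbhs_ballP[e /= e0 he].
have [eR e0'] : e = (Re e)%:C /\ 0 < Re e.
  by move: e0; rewrite ltcE; case: (e) => a b /= /andP[/eqP-> ->].
exists (Re e / 2); first by rewrite divr_gt0.
move=> h h1 h2; apply: he; rewrite /ball /= opprD addrA subrr sub0r normrN.
rewrite eR complex_normE ltcR; apply: le_lt_trans (norm_le_ReIm h) _; lra.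
Qed.

Lemma box_nbhs z (e : R) : 0 < e ->
  \forall x \near z, `|Re (x - z)| < e /\ `|Im (x - z)| < e.
Proof.
move=> e0; apply/nbhs_ballP; exists e%:C => /=; first by rewrite ltcR.
move=> x; rewrite /ball /= distrC complex_normE ltcR => h.
split; [exact: le_lt_trans (Re_le_norm _) h|exact: le_lt_trans (Im_le_norm _) h].
Qed.

Definition dir v := v = 1 \/ v = 'i.

Lemma dir_Re v : dir v -> `|Re v| <= 1.
Proof. by case=> -> /=; rewrite ?normr1 ?normr0. Qed.
Lemma dir_Im v : dir v -> `|Im v| <= 1.
Proof. by case=> -> /=; rewrite ?normr1 ?normr0. Qed.

Lemma line_line v z (s t : R) : line v (line v z s) t = line v z (s + t).
Proof. by rewrite /line rmorphD mulrDl addrA. Qed.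

Lemma lineC v v' z (s t : R) : line v (line v' z s) t = line v' (line v z t) s.
Proof. by rewrite /line addrAC. Qed.

Lemma is_pd_line v u z t d : is_pd v u (line v z t) d -> is_derive t 1 (u \o line v z) d.
Proof.
move=> h; apply: approx_is_derive => eps eps0.
have [del del0 hd] := is_derive_approx h eps0; exists del => // s hs.
by have := hd s hs; rewrite add0r /= !line_line addr0.
Qed.

Lemma nbhs_lines v v' z (P : C -> Prop) : dir v -> dir v' -> (\forall x \near z, P x) ->
  exists2 e : R, 0 < e & forall s t : R, `|s| < e -> `|t| < e ->
    P (line v (line v' z s) t).
Proof.
move=> hv hv' /nbhs_box[e e0 he]; exists (e / 2); first by rewrite divr_gt0.
move=> s t hs ht; rewrite /line -addrA; apply: he.
  rewrite ReD !ReZ; apply: le_lt_trans (ler_normD _ _) _; rewrite !normrM.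
  have := ler_wpM2l (normr_ge0 s) (dir_Re hv'); have := ler_wpM2l (normr_ge0 t) (dir_Re hv).
  rewrite !mulr1; lra.
rewrite ImD !ImZ; apply: le_lt_trans (ler_normD _ _) _; rewrite !normrM.
have := ler_wpM2l (normr_ge0 s) (dir_Im hv'); have := ler_wpM2l (normr_ge0 t) (dir_Im hv).
rewrite !mulr1; lra.
Qed.

(** Move from [z] along [v'], then along [v], and apply the mean value inequality on each leg to [u]
    minus its linear part. Keeping the two directions abstract covers both orders of differentiation
    needed for the mixed partials. *)
Lemma C1_approx_lines D u v v' z : open D -> class_C 1 D u -> dir v -> dir v' -> D z ->
  forall eps : R, 0 < eps -> exists2 del, 0 < del & forall s t : R, `|s| < del -> `|t| < del ->
    `|u (line v (line v' z s) t) - u z - s * pd v' u z - t * pd v u z| <= eps * (`|s| + `|t|).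
Proof.
move=> oD hu hv hv' Dz eps eps0.
have cpd x : dir x -> \forall w \near z, D w /\ `|pd x u z - pd x u w| <= eps.
  move=> hx; have h : \forall w \near z, `|pd x u z - pd x u w| <= eps.
    by move/cvgrPdist_le: (class_C_continuous oD (class_CS_pd hx hu) Dz); apply.
  have hD : \forall w \near z, D w by exact: open_near oD Dz _.
  by apply: filterS2 hD h => w; split.
have nb : \forall w \near z, (D w /\ `|pd v u z - pd v u w| <= eps) /\
                            (D w /\ `|pd v' u z - pd v' u w| <= eps).
  by apply: filterS2 (cpd v hv) (cpd v' hv') => w; split.
have [e e0 he] := nbhs_lines hv hv' nb; exists e => // s t hs ht.
have e00 : `|0 : R| < e by rewrite normr0.
have e0' x : `|x - 0| < e -> `|x| < e by rewrite subr0.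
have s1 : `|u (line v' z s) - u z - s * pd v' u z| <= eps * `|s|.
  have := @mean_value_le _ (fun x => u (line v' z x) - x * pd v' u z)
    (fun x => pd v' u (line v' z x) - pd v' u z) 0 e eps _ _ 0 s.
  rewrite subrr subr0 line0 mul0r subr0.
  have -> : u (line v' z s) - s * pd v' u z - u z = u (line v' z s) - u z - s * pd v' u z by ring.
  apply=> //.
    move=> x /e0' hx; have [_ [Dx _]] := he x 0 hx e00; rewrite line0 in Dx.
    have h1 := is_pd_line (class_CS_is_pd hv' hu Dx).
    have h2 := is_deriveB h1 (is_deriveM (is_derive_id x 1) (is_derive_cst (pd v' u z) x 1)).
    apply: is_derive_eq h2 _; rewrite /GRing.scale /= /cst; ring.
  by move=> x /e0' hx; have [_ [_]] := he x 0 hx e00; rewrite line0 distrC.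
have s2 : `|u (line v (line v' z s) t) - u (line v' z s) - t * pd v u z| <= eps * `|t|.
  have := @mean_value_le _ (fun x => u (line v (line v' z s) x) - x * pd v u z)
    (fun x => pd v u (line v (line v' z s) x) - pd v u z) 0 e eps _ _ 0 t.
  rewrite subrr subr0 line0 mul0r subr0.
  have -> : u (line v (line v' z s) t) - t * pd v u z - u (line v' z s) =
     u (line v (line v' z s) t) - u (line v' z s) - t * pd v u z by ring.
  apply=> //.
    move=> x /e0' hx; have [[Dx _] _] := he s x hs hx.
    have h1 := is_pd_line (class_CS_is_pd hv hu Dx).
    have h2 := is_deriveB h1 (is_deriveM (is_derive_id x 1) (is_derive_cst (pd v u z) x 1)).
    apply: is_derive_eq h2 _; rewrite /GRing.scale /= /cst; ring.
  by move=> x /e0' hx; have [[_ +] _] := he s x hs hx; rewrite distrC.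
have -> : u (line v (line v' z s) t) - u z - s * pd v' u z - t * pd v u z =
  (u (line v (line v' z s) t) - u (line v' z s) - t * pd v u z) +
  (u (line v' z s) - u z - s * pd v' u z) by ring.
apply: le_trans (ler_normD _ _) _; lra.
Qed.

Lemma C1_approx D u z : open D -> class_C 1 D u -> D z ->
  forall eps : R, 0 < eps -> exists2 del, 0 < del & forall h, `|Re h| < del -> `|Im h| < del ->
    `|u (z + h) - u z - Re h * pd 1 u z - Im h * pd 'i u z| <= eps * (`|Re h| + `|Im h|).
Proof.
move=> oD hu Dz eps eps0.
have [del d0 hd] := C1_approx_lines oD hu (or_intror erefl : dir 'i)
  (or_introl erefl : dir 1) Dz eps0.
exists del => // h h1 h2; have := hd _ _ h1 h2.
suff -> : line 'i (line 1 z (Re h)) (Im h) = z + h by [].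
rewrite /line -addrA; congr (_ + _).
by apply/eqP; rewrite eq_complex ReD ImD !ReZ !ImZ /= !mulr0 !mulr1 addr0 add0r !eqxx.
Qed.

(** The second difference over the square of side [h] is the increment over [[0, h]] of a difference
    of [u] along two parallel segments, whose derivative is [h * pd v' (pd v u) z] up to [o(h)] by
    the expansion of [pd v u]. The mean value inequality is applied on the radius [2 * h], where the
    tolerance [eps / 8] adds up to less than [eps * h]. *)
Lemma square_difference D u v v' z : open D -> class_C 2 D u -> dir v -> dir v' -> D z ->
  forall eps : R, 0 < eps -> exists2 del, 0 < del & forall h : R, 0 < h -> h < del ->
    `|u (line v (line v' z h) h) - u (line v' z h) - u (line v z h) + u z
      - h * (h * pd v' (pd v u) z)| <= eps * h * h.
Proof.
move=> oD hu hv hv' Dz eps eps0; have eps8 : 0 < eps / 8 by rewrite divr_gt0.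
have [del del0 hd] := C1_approx_lines oD (class_CS_pd hv hu) hv hv' Dz eps8.
have [e e0 he] := nbhs_lines hv hv' (open_near oD Dz (fun x Dx => Dx)).
exists (Num.min del e / 2); first by rewrite divr_gt0 // lt_min del0.
move=> h h0; rewrite ltr_pdivlMr // lt_min => /andP[hdel hee].
pose q := pd v' (pd v u) z.
have := @mean_value_le _ (fun x => u (line v (line v' z h) x) - u (line v z x) - x * (h * q))
  (fun x => pd v u (line v (line v' z h) x) - pd v u (line v z x) - h * q) 0 (2 * h) (eps * h)
  _ _ 0 h.
rewrite !line0 subrr subr0 mul0r subr0 (ger0_norm (ltW h0)) normr0.
have -> : u (line v (line v' z h) h) - u (line v z h) - h * (h * q) - (u (line v' z h) - u z) =
  u (line v (line v' z h) h) - u (line v' z h) - u (line v z h) + u z - h * (h * q) by ring.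
have hh : `|h| < del /\ `|h| < e by rewrite ger0_norm ?ltW //; split; lra.
have z0 : `|0 : R| < del /\ `|0 : R| < e by rewrite normr0.
apply; [|move=> x; rewrite subr0 => hx|lra|lra].
  move=> x; rewrite subr0 => hx; have hxe : `|x| < e by lra.
  have Dx1 := he h x hh.2 hxe; have Dx2 := he 0 x z0.2 hxe; rewrite line0 in Dx2.
  have h1 := is_pd_line (class_CS_is_pd hv hu Dx1).
  have h2 := is_pd_line (class_CS_is_pd hv hu Dx2).
  have h3 := is_deriveB (is_deriveB h1 h2)
    (is_deriveM (is_derive_id x 1) (is_derive_cst (h * q) x 1)).
  apply: is_derive_eq h3 _; rewrite /GRing.scale /= /cst; ring.
have hxd : `|x| < del by lra.
have := hd h x hh.1 hxd; have := hd 0 x z0.1 hxd; rewrite line0 mul0r normr0 -/q.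
rewrite (ger0_norm (ltW h0)) => n1 n2.
have -> : pd v u (line v (line v' z h) x) - pd v u (line v z x) - h * q =
  (pd v u (line v (line v' z h) x) - pd v u z - h * q - x * pd v (pd v u) z) -
  (pd v u (line v z x) - pd v u z - 0 - x * pd v (pd v u) z) by ring.
apply: le_trans (ler_normB _ _) _; apply: le_trans (lerD n2 n1) _.
have -> : eps / 8 * (h + `|x|) + eps / 8 * (0 + `|x|) = eps * (h / 8 + `|x| / 4) by field.
rewrite ler_pM2l //; lra.
Qed.

(** The second difference is symmetric in the two directions. Approximated by [h^2 p] and by [h^2 q]
    with tolerance [|p - q| / 3] each, it would give [|p - q| <= (2 / 3) |p - q|]. *)
Lemma mixed_partials D u z : open D -> class_C 2 D u -> D z ->
  pd 'i (pd 1 u) z = pd 1 (pd 'i u) z.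
Proof.
move=> oD hu Dz; have d1 : dir 1 by left.
have di : dir 'i by right.
apply/eqP; rewrite -subr_eq0 -normr_le0 leNgt; apply/negP => n0.
set p := pd 'i _ z in n0 *; set q := pd 1 (pd 'i u) z in n0 *.
have eps0 : 0 < `|p - q| / 3 by rewrite divr_gt0.
have [d d0 hd] := square_difference oD hu d1 di Dz eps0.
have [e e0 he] := square_difference oD hu di d1 Dz eps0.
pose h := Num.min d e / 2.
have [h0 hd' he'] : [/\ 0 < h, h < d & h < e].
  have m0 : 0 < Num.min d e by rewrite lt_min d0.
  have [m1 m2] : Num.min d e <= d /\ Num.min d e <= e by rewrite !ge_min !lexx orbT.
  by rewrite /h; split; lra.
clearbody h; have := hd h h0 hd'; have := he h h0 he'; rewrite lineC -/p -/q => n1 n2.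
have := lerD n1 n2; apply/negP; rewrite -ltNge.
have : `|h * (h * (p - q))| = h * (h * `|p - q|) by rewrite !normrM (ger0_norm (ltW h0)).
set X := u _; set Y := u _; set Z := u _; set W := u _ => eh.
apply: (@lt_le_trans _ _ (h * (h * `|p - q|))).
  have -> : `|p - q| / 3 * h * h + `|p - q| / 3 * h * h = h * (h * `|p - q|) * (2 / 3) by field.
  by rewrite gtr_pMr ?mulr_gt0 // ltr_pdivrMr // mul1r ltr_nat.
rewrite -eh; have -> : h * (h * (p - q)) =
  (X - Y - Z + W - h * (h * q)) - (X - Z - Y + W - h * (h * p)) by ring.
exact: ler_normB.
Qed.

Lemma complex_derivable_approx (tau : C -> C) z : derivable tau z 1 ->
  forall eps : R, 0 < eps -> exists2 del : R, 0 < del & forall h, `|Re h| < del -> `|Im h| < del ->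
    Re `|tau (z + h) - tau z - h * derive1 tau z| <= eps * Re `|h|.
Proof.
rewrite derive1E => dtau eps eps0.
have epsC : (0 : C) < eps%:C by rewrite ltcR.
move: dtau; rewrite /derivable -/('D_1 tau z) => /cvgrPdist_le /(_ _ epsC).
rewrite near_withinE => /nbhs_box[del del0 H]; exists del => // h h1 h2.
have [->|hN0] := eqVneq h 0; first by rewrite addr0 mul0r !subrr normr0 mulr0.
have := H h h1 h2; rewrite add0r => /(_ hN0).
rewrite -/('D_1 tau z) [h *: 1]mulr1 /= [h + z]addrC => le1.
have -> : tau (z + h) - tau z - h * 'D_1 tau z =
    - h * ('D_1 tau z - h^-1 *: (tau (z + h) - tau z)).
  rewrite /GRing.scale /= mulrBr !mulNr mulVKf //; ring.
move: le1; rewrite complex_normE lecR => le1.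
set X := _ - _ *: _ in le1 *.
apply: (@le_trans _ _ (Re `|- h| * Re `|X|)); first by rewrite -Re_normM.
rewrite normrN mulrC; apply: ler_wpM2r; last exact: le1.
by have := normr_ge0 h; rewrite complex_normE lecR.
Qed.

Lemma chain_rule D u (tau : C -> C) z v : open D -> class_C 1 D u -> D (tau z) ->
  derivable tau z 1 -> dir v ->
  is_pd v (u \o tau) z (Re (derive1 tau z * v) * pd 1 u (tau z) +
                        Im (derive1 tau z * v) * pd 'i u (tau z)).
Proof.
move=> oD hu Dz dtau hv.
set T := derive1 tau z * v; set p := pd 1 u _; set q := pd 'i u _.
apply: approx_is_derive => eps eps0.
(* The increment [k] of [tau] is at most [(|Re T| + |Im T| + 2) |t|], which the minimum with 1 in
   [eps1] guarantees; [eps2] controls the expansion of [u] at [k], and [eps1] the error of [tau]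
   once multiplied by the partials [p] and [q]. *)
pose eps2 := eps / (4 * (`|Re T| + `|Im T| + 2)).
pose eps1 := Num.min 1 (eps / (2 * (`|p| + `|q| + 1))).
have T0 : 0 < `|Re T| + `|Im T| + 2 by rewrite ltr_wpDl // addr_ge0.
have pq0 : 0 < `|p| + `|q| + 1 by rewrite ltr_wpDl // addr_ge0.
have eps20 : 0 < eps2 by rewrite divr_gt0 // mulr_gt0.
have eps10 : 0 < eps1 by rewrite lt_min ltr01 divr_gt0 // mulr_gt0.
have [del1 del10 h1] := complex_derivable_approx dtau eps10.
have [del2 del20 h2] := C1_approx oD hu Dz eps20.
pose del := Num.min del1 (del2 / (`|Re T| + `|Im T| + 2)).
exists del; first by rewrite lt_min del10 divr_gt0.
move=> t; rewrite lt_min ltr_pdivlMr // => /andP[ht1 ht2]; rewrite add0r /= line0.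
set k := tau (line v z t) - tau z.
have -> : tau (line v z t) = tau z + k by rewrite /k addrCA subrr addr0.
have vle : Re `|t%:C * v| <= `|t|.
  by rewrite normrM complex_normE; case: hv => ->; rewrite ?normr1 ?mulr1 normc_def /=
    ?expr0n ?expr1n ?addr0 ?add0r ?sqrtr1 ?sqrtr_sqr ?mulr1 ?mulr0 ?subr0.
have hRv := ler_wpM2l (normr_ge0 t) (dir_Re hv); have hIv := ler_wpM2l (normr_ge0 t) (dir_Im hv).
rewrite mulr1 in hRv; rewrite mulr1 in hIv.
have hr : `|Re (t%:C * v)| < del1 by rewrite ReZ normrM; exact: le_lt_trans hRv ht1.
have hi : `|Im (t%:C * v)| < del1 by rewrite ImZ normrM; exact: le_lt_trans hIv ht1.
have := h1 (t%:C * v) hr hi.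
have -> : tau (z + t%:C * v) - tau z - t%:C * v * derive1 tau z = k - t%:C * T.
  by rewrite /k /T /line -[t%:C * v * _]mulrA [v * _]mulrC.
move=> hk; have {}hk : Re `|k - t%:C * T| <= eps1 * `|t|.
  by apply: le_trans hk _; rewrite ler_wpM2l // ltW.
have rk := le_trans (Re_le_norm _) hk; have ik := le_trans (Im_le_norm _) hk.
rewrite ReB ReZ in rk; rewrite ImB ImZ in ik.
have e1 : eps1 <= 1 by rewrite /eps1 ge_min lexx.
have e1t : eps1 * `|t| <= `|t| by rewrite ler_piMl.
have rk' : `|Re k| <= (`|Re T| + 1) * `|t|.
  have -> : Re k = (Re k - t * Re T) + t * Re T by ring.
  apply: le_trans (ler_normD _ _) _; rewrite normrM mulrDl mul1r [leRHS]addrC.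
  by rewrite [`|t| * _]mulrC lerD2r; exact: le_trans e1t.
have ik' : `|Im k| <= (`|Im T| + 1) * `|t|.
  have -> : Im k = (Im k - t * Im T) + t * Im T by ring.
  apply: le_trans (ler_normD _ _) _; rewrite normrM mulrDl mul1r [leRHS]addrC.
  by rewrite [`|t| * _]mulrC lerD2r; exact: le_trans e1t.
have sumk : `|Re k| + `|Im k| <= (`|Re T| + `|Im T| + 2) * `|t|.
  move: (lerD rk' ik'); rewrite -mulrDl; congr (_ <= _ * _); ring.
have kd : `|Re k| + `|Im k| < del2 by apply: le_lt_trans sumk _; rewrite mulrC.
have kr : `|Re k| < del2 by have := normr_ge0 (Im k); lra.
have ki : `|Im k| < del2 by have := normr_ge0 (Re k); lra.
have := h2 k kr ki; rewrite -/p -/q => hu2.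
have -> : u (tau z + k) - u (tau z) - t * (Re T * p + Im T * q) =
  (u (tau z + k) - u (tau z) - Re k * p - Im k * q) +
  ((Re k - t * Re T) * p + (Im k - t * Im T) * q) by ring.
apply: le_trans (ler_normD _ _) _.
have b1 : `|u (tau z + k) - u (tau z) - Re k * p - Im k * q| <= eps / 4 * `|t|.
  apply: le_trans hu2 _; apply: (@le_trans _ _ (eps2 * ((`|Re T| + `|Im T| + 2) * `|t|))).
    by rewrite ler_wpM2l // ltW.
  rewrite mulrA ler_wpM2r // /eps2 le_eqVlt; apply/orP; left; apply/eqP; field.
  by rewrite gt_eqF.
have b2 : `|(Re k - t * Re T) * p + (Im k - t * Im T) * q| <= eps / 2 * `|t|.
  apply: le_trans (ler_normD _ _) _; rewrite !normrM.
  apply: (@le_trans _ _ (eps1 * `|t| * `|p| + eps1 * `|t| * `|q|)).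
    by rewrite lerD // ler_wpM2r.
  have -> : eps1 * `|t| * `|p| + eps1 * `|t| * `|q| = eps1 * (`|p| + `|q|) * `|t| by ring.
  rewrite ler_wpM2r //; apply: (@le_trans _ _ (eps1 * (`|p| + `|q| + 1))).
    by rewrite ler_pM2l //; lra.
  apply: (@le_trans _ _ (eps / (2 * (`|p| + `|q| + 1)) * (`|p| + `|q| + 1))).
    by rewrite ler_wpM2r ?(ltW pq0) // /eps1 ge_min lexx orbT.
  rewrite le_eqVlt; apply/orP; left; apply/eqP; field.
  by rewrite gt_eqF.
apply: le_trans (lerD b1 b2) _; rewrite -mulrDl ler_wpM2r //; lra.
Qed.

End PlaneCalculus.

(** * Monodromy over simply connected spaces *)

(** The target [A] may be [Prop]: several continuation arguments below consist in showing that the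
    truth value of a statement is locally constant. *)
Lemma locally_constant (X : topologicalType) (A : Type) (B : set X) (f : X -> A) :
  open B -> connected B -> (forall x, B x -> \forall y \near x, f y = f x) ->
  forall x y, B x -> B y -> f x = f y.
Proof.
move=> oB cB lf x y Bx By; pose S := B `&` [set z | f z = f x].
have oS : open S.
  rewrite openE => z [Bz /= fz]; have := open_nbhs_nbhs (conj oB Bz).
  by move: (lf z Bz); apply: filterS2 => w /= fw Bw; split=> //=; rewrite fw.
have oS' : open (B `&` [set z | f z <> f x]).
  rewrite openE => z [Bz /= fz]; have := open_nbhs_nbhs (conj oB Bz).
  by move: (lf z Bz); apply: filterS2 => w /= fw Bw; split=> //=; rewrite fw.
have SB : S = B.
  apply: cB; first by exists x; split.
  - by exists S => //; apply/seteqP; split => z; [move=> Sz; split=> //; case: Sz|case].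
  - exists (~` (B `&` [set z | f z <> f x])); first exact: open_closedC.
    apply/seteqP; split => z; first by move=> [Bz fz]; split=> // -[].
    by move=> [Bz nz]; split=> //=; apply: contrapT => fz; apply: nz.
have : S y by rewrite SB.
by case=> _ /= ->.
Qed.

Lemma continuous_within_comp (X Y Z : topologicalType) (A : set Y) (g : X -> Y) (c : Y -> Z) :
  continuous g -> (forall x, A (g x)) -> {within A, continuous c} -> continuous (c \o g).
Proof.
move=> cg gA /subspace_continuousP cc x P Pn.
have /cg := cc (g x) (gA x) P Pn.
by rewrite /= !nbhs_filterE /=; apply: filterS => y /=; apply; exact: gA.
Qed.

(** * Connectedness and gluing on the real line *)

Section RealLine.
Variable R : realType.

Lemma connected_ball (t e : R) : connected (ball t e).
Proof. by apply/connected_intervalP; rewrite ball_itv; exact: interval_is_interval. Qed.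

Lemma connected_line : connected [set: R].
Proof. by apply/connected_intervalP => x y _ _ z _. Qed.

Lemma locally_constant_line (A : Type) (f : R -> A) :
  (forall x, \forall y \near x, f y = f x) -> forall x y, f x = f y.
Proof.
move=> lf x y; apply: (locally_constant openT connected_line) => // z _; exact: lf.
Qed.

Lemma paste_near (a t : R) (P Q : R -> Prop) :
  (t <= a -> \forall s \near t, P s) -> (a <= t -> \forall s \near t, Q s) ->
  \forall s \near t, if s <= a then P s else Q s.
Proof.
move=> hP hQ; have [ta|at_|ta] := ltgtP t a.
- have : \forall s \near t, s < a by exact: lt_nbhsl.
  by apply: filterS2 (hP (ltW ta)) => s Ps sa; rewrite ltW.
- have : \forall s \near t, a < s by exact: lt_nbhsr.
  by apply: filterS2 (hQ (ltW at_)) => s Qs sa; rewrite leNgt sa.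
- have la : t <= a by rewrite ta. have ga : a <= t by rewrite ta.
  by apply: filterS2 (hP la) (hQ ga) => s Ps Qs; case: ifP.
Qed.

Lemma paste_continuous (T : topologicalType) (a : R) (f g : R -> T) :
  continuous f -> continuous g -> f a = g a ->
  continuous (fun t => if t <= a then f t else g t).
Proof.
move=> cf cg fg t P Pn; rewrite /= nbhs_filterE /=.
have : \forall s \near t, if s <= a then P (f s) else P (g s).
  apply: paste_near => [ta|at_].
    by apply: cf; move: Pn; rewrite ta.
  apply: cg; move: Pn; case: leP => // ta.
  by have -> : t = a by [apply/le_anti; rewrite ta at_]; rewrite fg.
by apply: filterS => s /=; case: (s <= a).
Qed.

Lemma continuous_compose (X Y Z : topologicalType) (f : X -> Y) (g : Y -> Z) :
  continuous f -> continuous g -> continuous (fun x => g (f x)).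
Proof. by move=> cf cg x; apply: continuous_comp; [exact: cf|exact: cg]. Qed.

Lemma line_compose (T : topologicalType) (f : R -> R) (g : R -> T) :
  continuous f -> continuous g -> continuous (fun x => g (f x)).
Proof. by move=> cf cg x; apply: continuous_comp; [exact: cf|exact: cg]. Qed.

Lemma affine_continuous (a b : R) : continuous (fun t : R => a * t + b).
Proof.
move=> t; apply: cvgD; last exact: cvg_cst.
by apply: cvgM; [exact: cvg_cst|exact: cvg_id].
Qed.

(** Paths and homotopies given on [[0, 1]] are precomposed with this retraction and so become
    continuous on the whole line or plane, where no subspace topology intervenes. *)
Definition clamp01 (t : R) := clamp (1 / 2) (1 / 2) t.

Lemma clamp01_itv t : clamp01 t \in `[0, 1].
Proof.
have : (0 : R) <= 1 / 2 by rewrite divr_ge0.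
move=> /(clamp_near (1 / 2) t); rewrite in_itv /= ler_norml -/(clamp01 t) => /andP[h1 h2].
by apply/andP; split; lra.
Qed.

Lemma clamp01_id t : 0 <= t -> t <= 1 -> clamp01 t = t.
Proof. by move=> t0 t1; apply: clamp_id; rewrite ler_norml; apply/andP; split; lra. Qed.

Lemma half_lt1 : (1 <= 1 / 2 :> R) = false.
Proof. by apply/negP => ?; lra. Qed.

Lemma clamp01_half t : [/\ 0 <= clamp01 t / 2, clamp01 t / 2 <= 1 / 2 & clamp01 t / 2 <= 1].
Proof. by have := clamp01_itv t; rewrite in_itv /= => /andP[? ?]; split; lra. Qed.

Lemma clamp01_onem_half t : [/\ 0 <= 1 - clamp01 t / 2, 1 - clamp01 t / 2 <= 1 &
  1 - clamp01 t / 2 <= 1 / 2 -> clamp01 t = 1].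
Proof. by have := clamp01_itv t; rewrite in_itv /= => /andP[? ?]; split; lra. Qed.

Lemma clamp01_addr_half t : [/\ 0 <= 1 / 2 + clamp01 t / 2, 1 / 2 + clamp01 t / 2 <= 1 &
  1 / 2 + clamp01 t / 2 <= 1 / 2 -> clamp01 t = 0].
Proof. by have := clamp01_itv t; rewrite in_itv /= => /andP[? ?]; split; lra. Qed.

Lemma clamp01_continuous : continuous clamp01.
Proof. exact: clamp_continuous. Qed.

Lemma clamp01_0 : clamp01 0 = 0. Proof. by apply: clamp01_id. Qed.
Lemma clamp01_1 : clamp01 1 = 1. Proof. by apply: clamp01_id. Qed.

End RealLine.

(* A covering with discrete fibre V, presented by local trivialisations Psi i (with inverses
   Phi i) over the open sets N i whose transition maps are locally constant. *)
Section Monodromy.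
Variables (R : realType) (T : topologicalType) (V I : Type).
Variables (N : I -> set T) (Phi Psi : I -> T -> V -> V).
Hypothesis N_open : forall i, open (N i).
Hypothesis N_cover : forall p, exists i, N i p.
Hypothesis PhiK : forall i p v, N i p -> Psi i p (Phi i p v) = v.
Hypothesis PsiK : forall i p v, N i p -> Phi i p (Psi i p v) = v.
Hypothesis trans : forall i j p v, N i p -> N j p ->
  \forall q \near p, Psi j q (Phi i q v) = Psi j p (Phi i p v).

(** A flat section along [h] near [x], that is, a local lift of [h] to the covering. The source is
    arbitrary because both paths and homotopies are lifted. *)
Definition parallel (X : topologicalType) (h : X -> T) (Y : X -> V) (x : X) :=
  forall i, N i (h x) -> \forall y \near x, Psi i (h y) (Y y) = Psi i (h x) (Y x).

Lemma parallel_one (X : topologicalType) (h : X -> T) Y x i : {for x, continuous h} ->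
  N i (h x) -> (\forall y \near x, Psi i (h y) (Y y) = Psi i (h x) (Y x)) -> parallel h Y x.
Proof.
move=> ch Ni hY j Nj.
have tr := ch _ (trans (Psi i (h x) (Y x)) Ni Nj).
have nN := ch _ (open_nbhs_nbhs (conj (N_open i) Ni)).
near=> y.
have e1 : Psi i (h y) (Y y) = Psi i (h x) (Y x) by near: y; exact: hY.
have Ny : N i (h y) by near: y; exact: nN.
have e2 : Psi j (h y) (Phi i (h y) (Psi i (h x) (Y x))) =
    Psi j (h x) (Phi i (h x) (Psi i (h x) (Y x))) by near: y; exact: tr.
by rewrite -{1}e1 !PsiK // in e2.
Unshelve. all: by end_near. Qed.

Lemma parallel_comp (X X' : topologicalType) (h : X -> T) Y (phi : X' -> X) x :
  {for x, continuous phi} -> parallel h Y (phi x) -> parallel (h \o phi) (Y \o phi) x.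
Proof. by move=> cphi pY i /pY /cphi. Qed.

Lemma parallel_unique (h : R -> T) Y Y' : continuous h ->
  (forall t, parallel h Y t) -> (forall t, parallel h Y' t) -> Y 0 = Y' 0 -> forall t, Y t = Y' t.
Proof.
move=> ch pY pY' e0 t.
suff -> : (Y t = Y' t) = (Y 0 = Y' 0) by [].
apply: (locally_constant_line (f := fun t => Y t = Y' t)) => x.
have [i Ni] := N_cover (h x).
have nN := ch _ _ (open_nbhs_nbhs (conj (N_open i) Ni)).
near=> y.
have Ny : N i (h y) by near: y; exact: nN.
have e1 : Psi i (h y) (Y y) = Psi i (h x) (Y x) by near: y; exact: pY.
have e2 : Psi i (h y) (Y' y) = Psi i (h x) (Y' x) by near: y; exact: pY'.
apply/propext; split => e.
  by rewrite -(PsiK (Y x) Ni) -(PsiK (Y' x) Ni) -e1 -e2 e.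
by rewrite -(PsiK (Y y) Ny) -(PsiK (Y' y) Ny) e1 e2 e.
Unshelve. all: by end_near. Qed.

Lemma parallel_const (Y : R -> V) p : (forall t, parallel (fun=> p) Y t) -> forall s t, Y s = Y t.
Proof.
move=> pY s t; have [i Ni] := N_cover p.
rewrite -(PsiK (Y s) Ni) -(PsiK (Y t) Ni); congr (Phi i p _).
by apply: (locally_constant_line (f := fun t => Psi i p (Y t))) => x; exact: pY.
Qed.

Lemma parallel_chart (h : R -> T) Y (t0 e : R) i : (forall t, ball t0 e t -> parallel h Y t) ->
  (forall t, ball t0 e t -> N i (h t)) -> forall s t, ball t0 e s -> ball t0 e t ->
  Psi i (h s) (Y s) = Psi i (h t) (Y t).
Proof.
move=> pY hN; apply: (locally_constant (f := fun t => Psi i (h t) (Y t))).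
- exact: ball_open.
- exact: connected_ball.
- by move=> x Bx; apply: pY => //; exact: hN.
Qed.

(** Over short intervals a trivialisation gives lifts, and lifts over adjacent intervals glue. Hence
    the truth of [f b], that [[0, b]] admits lifts from every initial value, is locally constant in
    [b]; it is vacuous at [b = -1], so it holds at [b = 1]. *)
Lemma path_lift (h : R -> T) v : continuous h -> exists Y : R -> V,
  Y 0 = v /\ forall t, parallel (h \o @clamp01 R) (Y \o @clamp01 R) t.
Proof.
move=> ch; pose L (a b : R) := forall v, exists Y : R -> V, Y a = v /\
  forall t, a <= t -> t <= b -> parallel h Y t.
have glue a b c : a <= b -> b <= c -> L a b -> L b c -> L a c.
  move=> ab bc Lab Lbc w; have [Y [Ya pY]] := Lab w; have [Y' [Y'b pY']] := Lbc (Y b).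
  exists (fun t => if t <= b then Y t else Y' t); rewrite ab Ya; split=> // t at_ tc i Ni.
  have : \forall s \near t, if s <= b then Psi i (h s) (Y s) = Psi i (h t) (if t <= b then Y t else Y' t)
      else Psi i (h s) (Y' s) = Psi i (h t) (if t <= b then Y t else Y' t).
    apply: paste_near => [tb|bt]; first by rewrite tb; exact: pY.
    case: leP => tb; last exact: pY'.
    have tbE : t = b by apply/le_anti; rewrite tb bt.
    by move: Ni; rewrite tbE -Y'b => Ni; apply: pY' => //; rewrite ?tbE.
  by apply: filterS => s /=; case: (s <= b).
have local t : exists2 e : R, 0 < e & forall a b, ball t e a -> ball t e b -> a <= b -> L a b.
  have [i Ni] := N_cover (h t).
  have /nbhs_ballP[e /= e0 he] := ch _ _ (open_nbhs_nbhs (conj (N_open i) Ni)).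
  exists e => // a b Ba Bb ab w; exists (fun s => Phi i (h s) (Psi i (h a) w)).
  split; first by apply: PsiK; exact: he.
  move=> s as_ sb; have Bs : ball t e s.
    move: Ba Bb; rewrite /ball /= !ltr_norml => /andP[? ?] /andP[? ?].
    by apply/andP; split; lra.
  apply: (parallel_one (i := i)); [exact: ch|exact: he|].
  have nN := ch _ _ (open_nbhs_nbhs (conj (N_open i) (he _ Bs))).
  near=> y; have Ny : N i (h y) by near: y; exact: nN.
  by rewrite !PhiK //; exact: he.
pose f (b : R) := 0 <= b -> L 0 b.
have step t e (a b : R) : 0 < e -> (forall a b, ball t e a -> ball t e b -> a <= b -> L a b) ->
    ball t e a -> ball t e b -> f a -> f b.
  move=> e0 he Ba Bb fa b0; have [a0|a0] := leP 0 a.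
    have [ab|ba] := leP a b; first by apply: (glue _ a) => //; [exact: fa|exact: he].
    move=> w; have [Y [Y0 pY]] := fa a0 w; exists Y; split=> // s s0 sb.
    by apply: pY => //; apply: le_trans sb _; exact: ltW.
  apply: he => //; move: Ba Bb; rewrite /ball /= !ltr_norml => /andP[? ?] /andP[? ?].
  by apply/andP; split; lra.
have f1 : f 1.
  suff -> : f 1 = f (-1) by move=> h1; move: h1; rewrite lerNr oppr0 ler10.
  apply: locally_constant_line => t; have [e e0 he] := local t.
  apply/nbhs_ballP; exists e => //= s Bs; apply/propext; split;
    by apply: (step t e) => //; exact: ballxx.
have [Y [Y0 pY]] := f1 ler01 v; exists Y; split=> // t.
apply: parallel_comp; first exact: clamp01_continuous.
by have := clamp01_itv t; rewrite in_itv /= => /andP[? ?]; exact: pY.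
Unshelve. all: by end_near. Qed.

(** Each horizontal line is lifted on its own, from the value [v]; what must be shown is flatness in
    both variables jointly. It holds at [t = 0], where [K] and the lifts are constant in [s], and it
    spreads along each line, its truth at [(t, s0)] being locally constant in [t]. *)
Lemma square_lift (K : R * R -> T) p v : continuous K -> (forall s, K (0, s) = p) ->
  (forall t s, K (t, s) = K (clamp01 t, s)) ->
  exists Y : R * R -> V, (forall s, Y (0, s) = v) /\ forall x, parallel K Y x.
Proof.
move=> cK K0 Kc.
have ct s : continuous (fun t => K (t, s)).
  move=> t; apply: (@continuous_comp _ _ _ (fun t => (t, s)) K); last exact: cK.
  by apply: (@cvg_pair _ _ _ _ (nbhs t) (nbhs s)); [exact: cvg_id|exact: cvg_cst].
have lift s : exists Y : R -> V, Y 0 = v /\ forall t, parallel (fun t => K (t, s)) Y t.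
  have [Y [Y0 pY]] := path_lift v (ct s); exists (Y \o @clamp01 R).
  rewrite /= clamp01_0; split=> // t; have := pY t.
  by rewrite (_ : _ \o _ = fun t => K (t, s)) //; apply/funext => r; rewrite [RHS]Kc.
have [Y hY] := choice lift; exists (fun x => Y x.2 x.1).
split=> [s|]; first by case: (hY s).
move=> [t0 s0].
have local t : exists e i, [/\ 0 < e, forall b : R, ball t e b -> N i (K (b, s0)) &
    forall b b' : R, ball t e b -> ball t e b' ->
    (\forall s \near s0, Psi i (K (b, s)) (Y s b) = Psi i (K (b, s0)) (Y s0 b)) ->
    parallel K (fun x => Y x.2 x.1) (b', s0)].
  have [i Ni] := N_cover (K (t, s0)).
  have [[Q1 Q2] /= [n1 n2] sub] := cK (t, s0) _ (open_nbhs_nbhs (conj (N_open i) Ni)).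
  move/nbhs_ballP: n1 => [e /= e0 he].
  have inN b s : ball t e b -> Q2 s -> N i (K (b, s)) by move=> /he ? ?; apply: (sub (b, s)).
  have Q2s0 := nbhs_singleton n2.
  exists e, i; split=> [//|b Bb|b b' Bb Bb' nearb]; first exact: inN.
  have chart s c d : Q2 s -> ball t e c -> ball t e d ->
      Psi i (K (c, s)) (Y s c) = Psi i (K (d, s)) (Y s d).
    move=> Qs; apply: (parallel_chart (h := fun t => K (t, s))) => r Br; last exact: inN.
    by have [_] := hY s; apply.
  apply: (parallel_one (i := i)); [exact: cK|exact: inN|].
  exists (ball t e, [set s | Q2 s /\ Psi i (K (b, s)) (Y s b) = Psi i (K (b, s0)) (Y s0 b)]).
    split=> /=; first by apply: open_nbhs_nbhs; split=> //; exact: ball_open.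
    by apply: filterS2 n2 nearb => s.
  move=> [t' s'] [/= Bt' [Qs' e']] /=.
  by rewrite (chart s' t' b) // e' (chart s0 b b').
suff -> : parallel K (fun x => Y x.2 x.1) (t0, s0) = parallel K (fun x => Y x.2 x.1) (0, s0).
  have [e [i [e0 Nb step]]] := local 0; apply: (step 0); [exact: ballxx|exact: ballxx|].
  have h0 s : Psi i (K (0, s)) (Y s 0) = Psi i (K (0, s0)) (Y s0 0).
    by rewrite !K0 (hY s).1 (hY s0).1.
  exact: filterE.
apply: (locally_constant_line (f := fun t => parallel K (fun x => Y x.2 x.1) (t, s0))) => t.
have [e [i [e0 Nb step]]] := local t.
have along b : ball t e b -> parallel K (fun x => Y x.2 x.1) (b, s0) ->
    \forall s \near s0, Psi i (K (b, s)) (Y s b) = Psi i (K (b, s0)) (Y s0 b).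
  move=> Bb /(_ i (Nb b Bb)) [[P1 P2] /= [n1 n2] sub].
  by apply: filterS n2 => s P2s; apply: (sub (b, s)); split=> //=; exact: nbhs_singleton n1.
apply/nbhs_ballP; exists e => //= b Bb; apply/propext; split => h.
  by apply: (step b) => //; [exact: ballxx|exact: along].
by apply: (step t) => //; [exact: ballxx|apply: along => //; exact: ballxx].
Qed.

Hypothesis T_connected : path_connected R T.
Hypothesis T_contract : loops_contract R T.
Hypothesis N_paths : forall i p, N i p -> \forall q \near p, exists c : R -> T,
  [/\ continuous c, c 0 = p, c 1 = q & forall t, N i (c t)].
Variables (p0 : T) (v0 : V).

(** The path [c] followed by the reverse of [c'] is a loop, and the square contracting it is lifted.
    On the three other sides the square stays at [p0], so the lift is constantly [v0] there; the two
    halves of the remaining side then carry the lifts of [c] and of [c'], which meet at the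
    midpoint. *)
Lemma lift_endpoint_unique (c c' : R -> T) (Y Y' : R -> V) :
  continuous c -> continuous c' ->
  c 0 = p0 -> c' 0 = p0 -> c 1 = c' 1 ->
  (forall t, parallel (c \o @clamp01 R) (Y \o @clamp01 R) t) ->
  (forall t, parallel (c' \o @clamp01 R) (Y' \o @clamp01 R) t) ->
  Y 0 = v0 -> Y' 0 = v0 -> Y 1 = Y' 1.
Proof.
move=> cc cc' c0 c'0 c1 pY pY' Y0 Y'0.
pose l t := if t <= 1 / 2 then c (2 * t + 0) else c' (-2 * t + 2).
have cl : continuous l.
  apply: paste_continuous.
  - exact: line_compose (@affine_continuous R 2 0) cc.
  - exact: line_compose (@affine_continuous R (-2) 2) cc'.
  - have -> : 2 * (1 / 2) + 0 = 1 :> R by field.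
    by rewrite c1; congr c'; field.
have l0 : l 0 = p0 by rewrite /l mulr0 addr0 divr_ge0.
have l1 : l 1 = p0.
  rewrite /l half_lt1.
  by rewrite mulr1 addNr.
have cl' : {within `[0, 1], continuous l} by exact: continuous_subspaceT.
have [H [cH H0 H1 Hs]] := T_contract cl' (etrans l0 (esym l1)).
rewrite l0 in H1 Hs.
pose K (x : R * R) := H (clamp01 x.1, clamp01 x.2).
have in01 (t : R) : clamp01 t \in `[0, 1]%R := clamp01_itv t.
have cK : continuous K.
  have c2 : continuous (fun x : R * R => (clamp01 x.1, clamp01 x.2)).
    move=> x; apply: (@cvg_pair _ _ _ _ (nbhs (clamp01 x.1)) (nbhs (clamp01 x.2))).
      by apply: (continuous_compose (f := fst)) => [y|]; [exact: cvg_fst|exact: clamp01_continuous].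
    by apply: (continuous_compose (f := snd)) => [y|]; [exact: cvg_snd|exact: clamp01_continuous].
  by apply: continuous_within_comp c2 _ cH => x; split=> /=; exact: in01.
have KE t s : K (t, s) = K (clamp01 t, s).
  by have := clamp01_itv t; rewrite in_itv /K /= => /andP[? ?]; rewrite [clamp01 (clamp01 t)]clamp01_id.
have K0 s : K (0, s) = p0 by rewrite /K /= clamp01_0; case: (Hs (clamp01 s) (in01 s)).
have K1 s : K (1, s) = p0 by rewrite /K /= clamp01_1; case: (Hs (clamp01 s) (in01 s)).
have KT t : K (t, 1) = p0 by rewrite /K /= clamp01_1 H1.
have KB t : 0 <= t -> t <= 1 -> K (t, 0) = l t.
  by move=> t0 t1; rewrite /K /= clamp01_0 clamp01_id // H0 // in_itv /= t0 t1.
have [Z [Z0 pZ]] := @square_lift K p0 v0 cK K0 KE.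
have cpair (s : R) : continuous (fun t : R => (t, s)).
  by move=> t; apply: (@cvg_pair _ _ _ _ (nbhs t) (nbhs s)); [exact: cvg_id|exact: cvg_cst].
have cpair' (s : R) : continuous (fun t : R => (s, t)).
  by move=> t; apply: (@cvg_pair _ _ _ _ (nbhs s) (nbhs t)); [exact: cvg_cst|exact: cvg_id].
have Ztop : Z (1, 1) = v0.
  rewrite -(Z0 1); apply: (@parallel_const (fun t => Z (t, 1)) p0) => t.
  have := parallel_comp (@cpair 1 t) (pZ (t, 1)).
  by rewrite (_ : K \o _ = fun=> p0) //; apply/funext.
have Z1 : Z (1, 0) = v0.
  rewrite -Ztop; apply: (@parallel_const (fun t => Z (1, t)) p0) => t.
  have := parallel_comp (@cpair' 1 t) (pZ (1, t)).
  by rewrite (_ : K \o _ = fun=> p0) //; apply/funext.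
(* [phi] runs over the first half of the side forwards, as [c] does, and [psi] over the second half
   backwards, as [c'] does. *)
pose phi (t : R) : R * R := (clamp01 t / 2, 0).
pose psi (t : R) : R * R := (1 - clamp01 t / 2, 0).
have chalf : continuous (fun t : R => clamp01 t / 2).
  by move=> t; apply: cvgM; [exact: clamp01_continuous|exact: cvg_cst].
have cphi : continuous phi by exact: continuous_compose chalf (@cpair 0).
have cpsi : continuous psi.
  apply: (continuous_compose (f := fun t => 1 - clamp01 t / 2)) (@cpair 0) => t.
  by apply: cvgB; [exact: cvg_cst|exact: chalf].
have e1 : Y 1 = Z (1 / 2, 0).
  have -> : Y 1 = (Y \o @clamp01 R) 1 by rewrite /= clamp01_1.
  have -> : Z (1 / 2, 0) = (Z \o phi) 1 by rewrite /= /phi clamp01_1.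
  apply: (@parallel_unique (c \o @clamp01 R)) => //.
  - exact: line_compose (@clamp01_continuous R) cc.
  - move=> t; have := parallel_comp (@cphi t) (pZ (phi t)).
    rewrite (_ : K \o phi = c \o @clamp01 R) //; apply/funext => s /=.
    have [s0 s1 s2] := clamp01_half s; rewrite KB // /l s1.
    by congr c; field.
  - by rewrite /= /phi clamp01_0 mul0r Z0.
have e2 : Y' 1 = Z (1 / 2, 0).
  have -> : Y' 1 = (Y' \o @clamp01 R) 1 by rewrite /= clamp01_1.
  have -> : Z (1 / 2, 0) = (Z \o psi) 1.
    by rewrite /= /psi clamp01_1; congr (Z (_, _)); field.
  apply: (@parallel_unique (c' \o @clamp01 R)) => //.
  - exact: line_compose (@clamp01_continuous R) cc'.
  - move=> t; have := parallel_comp (@cpsi t) (pZ (psi t)).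
    rewrite (_ : K \o psi = c' \o @clamp01 R) //; apply/funext => s /=.
    have [s0 s1 s2] := clamp01_onem_half s; rewrite KB // /l.
    case: ifPn => [/s2 ->|hs]; last by congr c'; field.
    by rewrite -c1; congr c; field.
  - by rewrite /= /psi clamp01_0 mul0r subr0 Z1.
by rewrite e1 e2.
Qed.

(** The value at [p] is the endpoint of a lift along a path from [p0], whichever path is taken. To
    compare it with the value at a nearby [q], the path to [p] is prolonged by a path inside [N i],
    along which the coordinate in the trivialisation [i] is constant. *)
Lemma global_section : exists y : T -> V, y p0 = v0 /\
  forall i p, N i p -> \forall q \near p, Psi i q (y q) = Psi i p (y p).
Proof.
have paths p : exists c : R -> T, [/\ continuous c, c 0 = p0 & c 1 = p].
  have [c [cc c0 c1]] := T_connected p0 p; exists (c \o @clamp01 R); split.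
  - apply: continuous_within_comp cc; first exact: clamp01_continuous.
    exact: clamp01_itv.
  - by rewrite /= clamp01_0.
  - by rewrite /= clamp01_1.
have [c hc] := choice paths.
have lifts p : exists Y : R -> V,
    Y 0 = v0 /\ forall t, parallel (c p \o @clamp01 R) (Y \o @clamp01 R) t.
  by apply: path_lift; case: (hc p).
have [Y hY] := choice lifts; exists (fun p => Y p 1).
have endpoint (d : R -> T) p Z : continuous d -> d 0 = p0 -> d 1 = p ->
    (forall t, parallel (d \o @clamp01 R) (Z \o @clamp01 R) t) -> Z 0 = v0 -> Z 1 = Y p 1.
  move=> cd d0 d1 pZ Z0; have [cc c0 c1] := hc p; have [Y0 pY] := hY p.
  by apply: (@lift_endpoint_unique d (c p)) => //; rewrite d1.
split.
  have cst : continuous (fun _ : R => p0) by exact: cst_continuous.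
  symmetry; apply: (endpoint _ p0 (fun=> v0) cst) => // t i Ni; by apply: filterE.
move=> i p Np; have := N_paths Np; apply: filterS => q [g [cg g0 g1 gN]].
have [cc c0 c1] := hc p.
pose d t := if t <= 1 / 2 then c p (2 * t + 0) else g (2 * t + -1).
have cd : continuous d.
  apply: paste_continuous.
  - exact: line_compose (@affine_continuous R 2 0) cc.
  - exact: line_compose (@affine_continuous R 2 (-1)) cg.
  - have -> : 2 * (1 / 2) + 0 = 1 :> R by field.
    by rewrite c1 -g0; congr g; field.
have [Z [Z0 pZ]] := path_lift v0 cd.
have half (t : R) : 0 <= clamp01 t /\ clamp01 t <= 1.
  by have := clamp01_itv t; rewrite in_itv /= => /andP.
have eq1 : Z 1 = Y q 1.
  apply: (endpoint d q Z) => //.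
    by rewrite /d mulr0 addr0 divr_ge0.
  rewrite /d half_lt1.
  by rewrite mulr1 -g1; congr g; ring.
have chalf : continuous (fun t : R => clamp01 t / 2).
  by move=> t; apply: cvgM; [exact: clamp01_continuous|exact: cvg_cst].
have eqp : Z (1 / 2) = Y p 1.
  have <- : (Z \o (fun t => clamp01 t / 2)) 1 = Z (1 / 2) by rewrite /= clamp01_1.
  apply: (endpoint (c p) p) => //.
  - move=> t; have := parallel_comp (@chalf t) (pZ (clamp01 t / 2)).
    have ch s : clamp01 (clamp01 s / 2) = clamp01 s / 2 :> R.
      by have [? ? ?] := clamp01_half s; rewrite clamp01_id.
    have cc01 s : clamp01 (clamp01 s) = clamp01 s :> R.
      by have [? ?] := half s; rewrite clamp01_id.
    rewrite (_ : (d \o _) \o _ = c p \o @clamp01 R); last first.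
      apply/funext => s /=; have [_ h _] := clamp01_half s; rewrite ch /d h.
      by congr (c p); field.
    rewrite (_ : (Z \o _) \o _ = (Z \o (fun t => clamp01 t / 2)) \o @clamp01 R) //.
    by apply/funext => s /=; rewrite ch cc01.
  - by rewrite /= clamp01_0 mul0r.
rewrite -eq1 -eqp.
pose k (t : R) : R := 1 / 2 + clamp01 t / 2.
have ck : continuous k by move=> t; apply: cvgD; [exact: cvg_cst|exact: chalf].
have dk t : d (k t) = g (clamp01 t).
  have [_ _ h] := clamp01_addr_half t; rewrite /d /k; case: ifPn => [/h ->|_]; last first.
    by congr g; field.
  by rewrite mul0r addr0 g0 -[RHS]c1; congr (c p); field.
have kc t : clamp01 (k t) = k t.
  by have [? ? _] := clamp01_addr_half t; rewrite clamp01_id.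
have k0 : k 0 = 1 / 2 by rewrite /k clamp01_0 mul0r addr0.
have k1 : k 1 = 1 by rewrite /k clamp01_1; field.
suff : Psi i (d (k 1)) (Z (k 1)) = Psi i (d (k 0)) (Z (k 0)).
  by rewrite !dk clamp01_0 clamp01_1 g0 g1 k0 k1.
apply: (locally_constant_line (f := fun t => Psi i (d (k t)) (Z (k t)))) => t.
have := parallel_comp (@ck t) (pZ (k t)) (i := i); rewrite /= !kc dk; move=> /(_ (gN _)).
by apply: filterS => s; rewrite !kc dk.
Qed.

End Monodromy.

(** * Flat linear systems *)

Section Planar.
Variable R : realType.
Local Notation C := (R[i]^o).
Local Notation Re := (@complex.Re R).
Local Notation Im := (@complex.Im R).
Implicit Types (D : set C) (u : C -> R) (z v : C).

(** Boxes replace balls because all estimates proceed along horizontal and vertical segments, which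
    stay inside a box. *)
Definition box z (e : R) : set C := [set x | `|Re x - Re z| < e /\ `|Im x - Im z| < e].

Lemma box_center z (e : R) : 0 < e -> box z e z.
Proof. by move=> e0; split; rewrite subrr normr0. Qed.

Lemma nbhs_boxP z (P : C -> Prop) : (\forall x \near z, P x) ->
  exists2 e : R, 0 < e & box z e `<=` P.
Proof.
move=> /nbhs_box[e e0 he]; exists e => // x [h1 h2].
by have := he (x - z); rewrite ReB ImB addrCA subrr addr0; apply.
Qed.

Lemma box_open z (e : R) : open (box z e).
Proof.
rewrite openE => x [h1 h2]; rewrite /interior /=.
pose d := Num.min (e - `|Re x - Re z|) (e - `|Im x - Im z|).
have d0 : 0 < d by rewrite lt_min !subr_gt0 h1.
apply: filterS (box_nbhs x d0) => y; rewrite ReB ImB /d !lt_min => -[/andP[a1 _] /andP[_ a2]].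
split.
  have -> : Re y - Re z = (Re y - Re x) + (Re x - Re z) by ring.
  by apply: le_lt_trans (ler_normD _ _) _; lra.
have -> : Im y - Im z = (Im y - Im x) + (Im x - Im z) by ring.
by apply: le_lt_trans (ler_normD _ _) _; lra.
Qed.

Lemma box_sub z (e e' : R) : e <= e' -> box z e `<=` box z e'.
Proof. by move=> ee x [h1 h2]; split; exact: lt_le_trans ee. Qed.

Lemma line1E z (t : R) : line 1 z t = (Re z + t) +i* Im z.
Proof.
by apply/eqP; rewrite /line mulr1 eq_complex ReD ImD /= addr0 !eqxx.
Qed.

Lemma lineiE z (t : R) : line 'i z t = Re z +i* (Im z + t).
Proof.
by apply/eqP; rewrite /line eq_complex ReD ImD ReZ ImZ /= mulr0 mulr1 addr0 !eqxx.
Qed.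

Lemma is_pd1P u z (d : R) : is_pd 1 u z d <-> is_derive (Re z) 1 (fun s => u (s +i* Im z)) d.
Proof.
split=> h; apply: approx_is_derive => eps eps0;
  have [del d0 hd] := is_derive_approx h eps0; exists del => // s hs;
  have := hd s hs; rewrite /= !line1E !add0r ?addr0; by case: (z).
Qed.

Lemma is_pdiP u z (d : R) : is_pd 'i u z d <-> is_derive (Im z) 1 (fun s => u (Re z +i* s)) d.
Proof.
split=> h; apply: approx_is_derive => eps eps0;
  have [del d0 hd] := is_derive_approx h eps0; exists del => // s hs;
  have := hd s hs; rewrite /= !lineiE !add0r ?addr0; by case: (z).
Qed.

Lemma box_mean_value u (ux uy : C -> R) z0 (e K : R) :
  (forall z, box z0 e z -> is_pd 1 u z (ux z)) ->
  (forall z, box z0 e z -> is_pd 'i u z (uy z)) ->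
  (forall z, box z0 e z -> `|ux z| <= K) -> (forall z, box z0 e z -> `|uy z| <= K) ->
  forall z w, box z0 e z -> box z0 e w ->
    `|u w - u z| <= K * (`|Re w - Re z| + `|Im w - Im z|).
Proof.
move=> dx dy bx by_ z w [zx zy] [wx wy].
have -> : u w - u z = (u w - u (Re w +i* Im z)) + (u (Re w +i* Im z) - u z) by ring.
rewrite mulrDr addrC; apply: le_trans (ler_normD _ _) _; apply: lerD.
  rewrite {2}(_ : z = Re z +i* Im z); last by case: (z).
  apply: (@mean_value_le _ (fun s => u (s +i* Im z)) (fun s => ux (s +i* Im z)) (Re z0) e) => //.
    by move=> t ht; have /is_pd1P := dx (t +i* Im z) (conj ht zy).
  by move=> t ht; apply: bx; split.
rewrite {1}(_ : w = Re w +i* Im w); last by case: (w).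
apply: (@mean_value_le _ (fun s => u (Re w +i* s)) (fun s => uy (Re w +i* s)) (Im z0) e) => //.
  by move=> t ht; have /is_pdiP := dy (Re w +i* t) (conj wx ht).
by move=> t ht; apply: by_; split.
Qed.

Lemma box_continuous u (ux uy : C -> R) z0 (e K : R) :
  (forall z, box z0 e z -> is_pd 1 u z (ux z)) ->
  (forall z, box z0 e z -> is_pd 'i u z (uy z)) ->
  (forall z, box z0 e z -> `|ux z| <= K) -> (forall z, box z0 e z -> `|uy z| <= K) ->
  forall z, box z0 e z -> {for z, continuous u}.
Proof.
move=> dx dy bx by_ z Bz; apply: (@cvgrPdist_le _ _ _ (nbhs z) _ u (u z)).2 => /= eps eps0.
have K0 : 0 <= K := le_trans (normr_ge0 _) (bx z Bz).
pose d := eps / (2 * (K + 1)).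
have K1 : 0 < K + 1 by lra.
have d0 : 0 < d by rewrite divr_gt0 // mulr_gt0.
have nB : \forall w \near z, box z0 e w by exact: open_near (@box_open z0 e) Bz _.
apply: filterS2 nB (box_nbhs z d0) => w Bw; rewrite ReB ImB => -[h1 h2].
rewrite distrC; apply: le_trans (box_mean_value dx dy bx by_ Bz Bw) _.
apply: (@le_trans _ _ ((K + 1) * (d + d))).
  by apply: ler_pM; rewrite ?addr_ge0 //; lra.
rewrite le_eqVlt; apply/orP; left; apply/eqP; rewrite /d; field; by rewrite gt_eqF.
Qed.

Lemma continuous_bounded u z : {for z, continuous u} ->
  \forall w \near z, `|u w| <= `|u z| + 1.
Proof.
move=> cu; have : \forall w \near z, `|u z - u w| <= 1.
  by move/cvgrPdist_le: cu; apply.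
apply: filterS => w /= h; have -> : u w = u z - (u z - u w) by ring.
by apply: le_trans (ler_normB _ _) _; lra.
Qed.

(** The connection satisfied by the inverse frame, minus the transpose, has minus the transposed
    curvature. *)
Lemma flat_transpose (J : finType) (a b : J -> J -> R) (da db : J -> J -> R) :
  (forall k j, da k j + \sum_l b k l * a l j = db k j + \sum_l a k l * b l j) ->
  forall k j, - da j k + \sum_l (- b l k) * (- a j l) = - db j k + \sum_l (- a l k) * (- b j l).
Proof.
move=> h k j; have := h j k.
under [X in _ + X = _]eq_bigr do rewrite mulrC.
under [X in _ = _ + X]eq_bigr do rewrite mulrC.
under [X in _ -> _ + X = _]eq_bigr do rewrite mulrNN.
under [X in _ -> _ = _ + X]eq_bigr do rewrite mulrNN.
move: (\sum_l _) (\sum_l _) => p q; lra.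
Qed.

Lemma four_le (p q r s K : R) : 0 <= p -> 0 <= q -> 0 <= r -> 0 <= s ->
  p + q + r + s <= K - 1 -> [/\ p + 1 <= K, q + 1 <= K, r + 1 <= K & s + 1 <= K].
Proof. by move=> ? ? ? ? ?; split; lra. Qed.

Lemma double_sum_ge (J : finType) (F : J -> J -> R) k j : (forall k j, 0 <= F k j) ->
  F k j <= \sum_k \sum_j F k j.
Proof.
move=> F0; rewrite (bigD1 k) //= (bigD1 j) //=.
apply: ler_wpDr; first by apply: sumr_ge0 => k' _; apply: sumr_ge0.
by apply: ler_wpDr => //; apply: sumr_ge0.
Qed.

(** The radius [e] is chosen before the initial value [v0]: a whole basis of solutions is needed on
    one box. *)
Lemma planar_frobenius (J : finType) D (B : C -> J -> J -> C -> R) z0 : open D ->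
  (forall k v i j, dir v -> class_C k D (B v i j)) ->
  (forall k j z, D z -> pd 'i (B 1 k j) z + \sum_l B 'i k l z * B 1 l j z =
                        pd 1 (B 'i k j) z + \sum_l B 1 k l z * B 'i l j z) ->
  D z0 -> exists2 e : R, 0 < e /\ box z0 e `<=` D & forall v0 : J -> R, exists y : J -> C -> R,
    [/\ forall j, y j z0 = v0 j,
        forall j z, box z0 e z -> {for z, continuous (y j)} &
        forall v j z, dir v -> box z0 e z -> is_pd v (y j) z (\sum_i y i z * B v i j z)].
Proof.
move=> oD sB flat Dz0; have d1 : dir (1 : C) by left.
have di : dir ('i : C) by right.
pose bx k j := pd 1 (B 'i k j); pose ay k j := pd 'i (B 1 k j).
have sbx n k j : class_C n D (bx k j) by apply: class_CS_pd => //; exact: sB.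
pose bxx k j := pd 1 (bx k j).
have sbxx n k j : class_C n D (bxx k j) by apply: class_CS_pd => //; exact: sbx.
have cont n u : class_C n D u -> \forall w \near z0, `|u w| <= `|u z0| + 1.
  by move=> hu; apply: continuous_bounded; exact: (class_C_continuous oD hu Dz0).
(* One constant bounds the coefficients, [bx] and also its [x]-derivative [bxx], from which the
   Lipschitz condition on [bx] follows. *)
pose S := \sum_k \sum_j (`|B 1 k j z0| + `|B 'i k j z0| + `|bx k j z0| + `|bxx k j z0|).
pose K := 1 + S.
have K0 : 0 < K.
  apply: ltr_pwDl => //; apply: sumr_ge0 => k _; apply: sumr_ge0 => j _.
  by rewrite !addr_ge0.
have KB k j : `|B 1 k j z0| + `|B 'i k j z0| + `|bx k j z0| + `|bxx k j z0| <= K - 1.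
  rewrite [K - 1](_ : _ = S); last by rewrite /K addrAC subrr add0r.
  apply: (double_sum_ge (F := fun k j => `|B 1 k j z0| + `|B 'i k j z0| + `|bx k j z0| + `|bxx k j z0|)).
  by move=> k' j'; rewrite !addr_ge0.
clearbody K; clear S.
pose P (kj : J * J) z := [/\ `|B 1 kj.1 kj.2 z| <= K, `|B 'i kj.1 kj.2 z| <= K,
  `|bx kj.1 kj.2 z| <= K & `|bxx kj.1 kj.2 z| <= K].
have near0 : \forall z \near z0, D z /\ forall kj, P kj z.
  have hD : \forall z \near z0, D z by exact: open_near oD Dz0 _.
  have hK kj : \forall z \near z0, P kj z.
    case: kj => k j.
    have [b1 b2 b3 b4] := four_le (normr_ge0 _) (normr_ge0 _) (normr_ge0 _) (normr_ge0 _) (KB k j).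
    have h1 := cont 0%N _ (sB 0%N 1 k j d1); have h2 := cont 0%N _ (sB 0%N 'i k j di).
    have h3 := cont 0%N _ (sbx 0%N k j); have h4 := cont 0%N _ (sbxx 0%N k j).
    near=> w; split => /=.
    - by apply: le_trans b1; near: w; exact: h1.
    - by apply: le_trans b2; near: w; exact: h2.
    - by apply: le_trans b3; near: w; exact: h3.
    - by apply: le_trans b4; near: w; exact: h4.
  have hK' : \forall z \near z0, forall kj, P kj z by exact: (@filter_forall _ _ P (nbhs z0) _ hK).
  by apply: filterS2 hD hK'.
have [e1 e10 he1] := nbhs_boxP near0.
(* The first term puts the closed box of radius [e] inside the open box of radius [e1]; the second
   gives the smallness condition of the Picard iteration. *)
pose e := Num.min (e1 / 2) (1 / (2 * (#|J|%:R * K + 1))).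
have JK0 : 0 <= #|J|%:R * K by rewrite mulr_ge0 // ltW.
have e0 : 0 < e by rewrite lt_min !divr_gt0 // mulr_gt0 // ltr_wpDl.
have ee1 : e < e1 by apply: (@le_lt_trans _ _ (e1 / 2)); [rewrite /e ge_min lexx|lra].
have small : #|J|%:R * K * e <= 1 / 2.
  apply: (@le_trans _ _ (#|J|%:R * K * (1 / (2 * (#|J|%:R * K + 1))))).
    by rewrite ler_wpM2l // /e ge_min lexx orbT.
  rewrite mulrA mulr1 ler_pdivrMr ?mulr_gt0 ?ltr_wpDl //; lra.
have inb x y : `|x - Re z0| <= e /\ `|y - Im z0| <= e -> box z0 e1 (x +i* y).
  by move=> [hx hy]; split=> /=; exact: le_lt_trans ee1.
exists e; first by split=> // z /(box_sub (ltW ee1)) /he1 [].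
move=> v0.
have [|||||||||v [v_z0 [M vM] vx vy]] := @local_frobenius_real R J
  (fun k j x y => B 1 k j (x +i* y)) (fun k j x y => B 'i k j (x +i* y))
  (fun k j x y => ay k j (x +i* y)) (fun k j x y => bx k j (x +i* y))
  (Re z0) (Im z0) e K e0 small _ _ _ _ _ _ _ _ _ v0.
- by move=> k j x y /inb /he1 [_ /(_ (k, j)) []].
- by move=> k j x y /inb /he1 [_ /(_ (k, j)) []].
- by move=> k j x y /inb /he1 [_ /(_ (k, j)) []].
- move=> k j x x' y hx hx'.
  apply: (@mean_value_le _ (fun s => bx k j (s +i* y)) (fun s => bxx k j (s +i* y)) (Re z0) e1).
  + move=> s hs; have : box z0 e1 (s +i* y) by split=> //=; exact: le_lt_trans hx.2 ee1.
    by move=> /he1 [Ds _]; have /is_pd1P := class_CS_is_pd d1 (sbx 1%N k j) Ds.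
  + move=> s hs; have : box z0 e1 (s +i* y) by split=> //=; exact: le_lt_trans hx.2 ee1.
    by move=> /he1 [_ /(_ (k, j)) []].
  + exact: le_lt_trans hx'.1 ee1.
  + exact: le_lt_trans hx.1 ee1.
- move=> k j x y /inb /he1 [Dx _].
  by have /is_pd1P /is_derive_continuous := class_CS_is_pd d1 (sB 1%N 1 k j d1) Dx.
- move=> k j x y /inb /he1 [Dx _].
  by have /is_pdiP /is_derive_continuous := class_CS_is_pd di (sB 1%N 'i k j di) Dx.
- move=> k j x y /inb /he1 [Dx _].
  by have /is_pdiP := class_CS_is_pd di (sB 1%N 1 k j d1) Dx.
- move=> k j x y /inb /he1 [Dx _].
  by have /is_pd1P := class_CS_is_pd d1 (sB 1%N 'i k j di) Dx.
- by move=> k j x y /inb /he1 [Dx _]; exact: flat.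
pose y j z := v j (Re z) (Im z).
have pdy w j z : dir w -> box z0 e z -> is_pd w (y j) z (\sum_i y i z * B w i j z).
  have zE : z = Re z +i* Im z by case: (z).
  case=> -> [hx hy]; [apply/is_pd1P|apply/is_pdiP].
    by have := vx j _ _ hx hy; rewrite -zE.
  by have := vy j _ _ hx hy; rewrite -zE.
exists y; split=> //.
move=> j; pose L := #|J|%:R * (M * K).
have bound w z : dir w -> box z0 e z -> `|\sum_i y i z * B w i j z| <= L.
  move=> hw /(box_sub (ltW ee1)) /he1 [_ hz]; apply: sum_le_card => i.
  rewrite normrM ler_pM // ?vM //.
  by case: hw (hz (i, j)) => -> [].
apply: (@box_continuous _ (fun z => \sum_i y i z * B 1 i j z)
  (fun z => \sum_i y i z * B 'i i j z) z0 e L).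
- by move=> z; apply: pdy.
- by move=> z; apply: pdy.
- by move=> z; apply: bound.
- by move=> z; apply: bound.
Unshelve. all: by end_near. Qed.

End Planar.

Lemma preimage_within_open (X Y : topologicalType) (D : set X) (g : X -> Y) (W : set Y) :
  open D -> {within D, continuous g} -> open W -> open (D `&` g @^-1` W).
Proof.
move=> oD; rewrite continuous_open_subspace // => cg oW; rewrite openE => x [Dx Wx].
have nW : \forall y \near x, W (g y) by apply: (cg x); [rewrite inE|exact: open_nbhs_nbhs].
by apply: filterS2 (open_near oD Dx (fun y Dy => Dy)) nW => y; split.
Qed.

(** * Change of charts and uniqueness on the surface *)

Section Charts.
Variables (R : realType) (M : riemannSurface R).
Local Notation C := (R[i]^o).
Local Notation Re := (@complex.Re R).
Local Notation Im := (@complex.Im R).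
Implicit Types (c : chart R M) (u : M -> R) (W : set M) (z v : C).

Lemma chart_preimage_open c W : open W -> open (chart_img c `&` chart_inv c @^-1` W).
Proof.
apply: preimage_within_open; [exact: chart_img_open|exact: chart_inv_continuous].
Qed.

Lemma chart_image_open c (B : set C) : open B -> open (chart_dom c `&` c @^-1` B).
Proof.
apply: preimage_within_open; [exact: chart_dom_open|exact: chart_map_continuous].
Qed.

Lemma chart_map_continuous_at c p : chart_dom c p -> {for p, continuous c}.
Proof.
move=> cp; have := @chart_map_continuous _ _ c.
by rewrite continuous_open_subspace; [apply; rewrite inE|exact: chart_dom_open].
Qed.

Lemma chart_inv_continuous_at c z : chart_img c z -> {for z, continuous (chart_inv c)}.
Proof.
move=> cz; have := @chart_inv_continuous _ _ c.
by rewrite continuous_open_subspace; [apply; rewrite inE|exact: chart_img_open].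
Qed.

Lemma near_chart c p (P : M -> Prop) : chart_dom c p ->
  (\forall z \near c p, P (chart_inv c z)) -> \forall q \near p, P q.
Proof.
move=> cp nP; have := chart_map_continuous_at cp nP.
have hD : \forall q \near p, chart_dom c q by exact: open_near (@chart_dom_open _ _ c) cp _.
by apply: filterS2 hD => q cq /=; rewrite chart_mapK.
Qed.

(** Near [z] the function read in [c] is the function read in [c'] after the holomorphic map [tau];
    the direction [v] becomes [tau' v], whose real and imaginary parts are the two coefficients. *)
Lemma pd_transition c c' u W z v : rs_atlas c -> rs_atlas c' -> open W ->
  class_C 1 (chart_img c' `&` chart_inv c' @^-1` W) (u \o chart_inv c') ->
  chart_img c z -> W (chart_inv c z) -> chart_dom c' (chart_inv c z) -> dir v ->
  let tau := transition c c' in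
  is_pd v (u \o chart_inv c) z
    (Re (derive1 tau z * v) * pd 1 (u \o chart_inv c') (tau z) +
     Im (derive1 tau z * v) * pd 'i (u \o chart_inv c') (tau z)).
Proof.
move=> ac ac' oW cu cz Wz dz hv tau.
have oz : overlap c c' z by split.
have tauK x : overlap c c' x -> chart_inv c' (tau x) = chart_inv c x.
  by move=> [_ ?]; rewrite /tau /transition /= chart_mapK.
apply: (@is_pd_near _ _ ((u \o chart_inv c') \o tau)).
  have oO : open (overlap c c') by apply: chart_preimage_open; exact: chart_dom_open.
  by apply: open_near oO oz _ => x ox /=; rewrite tauK.
apply: chain_rule cu _ _ hv; first exact: chart_preimage_open.
  by split; [exact: chart_map_img|rewrite /= tauK].
exact: rs_holomorphic ac ac' _ oz.
Qed.

Lemma zero_pd_locally_constant u W p : open W -> W p ->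
  (forall c z v, rs_atlas c -> chart_img c z -> W (chart_inv c z) -> dir v ->
    is_pd v (u \o chart_inv c) z 0) ->
  \forall q \near p, u q = u p.
Proof.
move=> oW Wp du; have [c ac cp] := rs_cover p.
have cz : chart_img c (c p) by exact: chart_map_img.
have oD := @chart_preimage_open c W oW.
have Dz : (chart_img c `&` chart_inv c @^-1` W) (c p) by split=> //=; rewrite chart_mapK.
have [e e0 he] := nbhs_boxP (open_near oD Dz (fun x Dx => Dx)).
apply: (near_chart cp).
apply: open_near (@box_open _ (c p) e) (box_center _ e0) _ => z Bz.
have h : `|(u \o chart_inv c) z - (u \o chart_inv c) (c p)| <=
    0 * (`|Re z - Re (c p)| + `|Im z - Im (c p)|).
  apply: (@box_mean_value _ _ (fun=> 0) (fun=> 0) (c p) e) => // [x Bx|x Bx|x Bx|x Bx|].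
  - by have [? ?] := he x Bx; apply: du => //; left.
  - by have [? ?] := he x Bx; apply: du => //; right.
  - by rewrite normr0.
  - by rewrite normr0.
  - exact: box_center.
by move: h; rewrite mul0r normr_le0 subr_eq0 /= chart_mapK // => /eqP.
Qed.

(* On a box of size e around a zero of y, a bound B on |y| improves to 4 e K B. *)
Lemma surface_unique (J : finType) (y : J -> M -> R) (p0 : M) :
  (forall j, smooth_on setT (y j)) ->
  (forall c z0, rs_atlas c -> chart_img c z0 -> exists K : R, \forall z \near z0,
    forall v j, dir v -> `|pd v (y j \o chart_inv c) z| <= K * \sum_k `|y k (chart_inv c z)|) ->
  (forall j, y j p0 = 0) -> forall p j, y j p = 0.
Proof.
move=> sy dy y0 p j.
suff E : (forall j, y j p = 0) = (forall j, y j p0 = 0) by move: j; rewrite E.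
apply: (locally_constant (f := fun p => forall j, y j p = 0) openT (@rs_connected _ M)) => // x _.
have [c ac cx] := rs_cover x.
have cz : chart_img c (c x) by exact: chart_map_img.
have oD := @chart_img_open _ _ c.
have sc k i : class_C k (chart_img c) (y i \o chart_inv c).
  by have := sy i c ac k; rewrite preimage_setT setIT.
have [K hK] := dy c (c x) ac cz.
have hb : \forall z \near c x, forall k, `|(y k \o chart_inv c) z| <= `|(y k \o chart_inv c) (c x)| + 1.
  apply: (@filter_forall _ _ (fun k z => `|(y k \o chart_inv c) z| <= `|(y k \o chart_inv c) (c x)| + 1) (nbhs (c x))).
  by move=> k; apply: continuous_bounded; exact: class_C_continuous oD (sc 0%N k) _ cz.
have hD : \forall z \near c x, chart_img c z by exact: open_near oD cz _.
have [e e0 he] := nbhs_boxP (filterI hD (filterI hb hK)).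
pose B := \sum_k (`|(y k \o chart_inv c) (c x)| + 1).
have B0 : 0 <= B by apply: sumr_ge0 => k _; rewrite addr_ge0.
have yB k z : box (c x) e z -> `|(y k \o chart_inv c) z| <= B.
  move=> /he [_ [/(_ k) + _]] => /le_trans; apply; rewrite /B (bigD1 k) //= lerDl.
  by apply: sumr_ge0 => i _; rewrite addr_ge0.
pose L := #|J|%:R * `|K|.
have L0 : 0 <= L by rewrite mulr_ge0.
pose d := Num.min e (1 / (8 * (L + 1))).
have L1 : 0 < L + 1 by rewrite ltr_wpDl.
have d0 : 0 < d by rewrite lt_min e0 divr_gt0 // mulr_gt0.
have dL : L * (d * 4) <= 1 / 2.
  have -> : (1 : R) / 2 = (L + 1) * (1 / (8 * (L + 1)) * 4) by field; rewrite gt_eqF.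
  apply: ler_pM => //; [by rewrite mulr_ge0 // ltW|by rewrite lerDl|].
  by rewrite ler_pM2r // /d ge_min lexx orbT.
have sub z : box (c x) d z -> box (c x) e z by apply: box_sub; rewrite /d ge_min lexx.
have zero z1 : box (c x) d z1 -> (forall k, (y k \o chart_inv c) z1 = 0) ->
    forall z k, box (c x) d z -> (y k \o chart_inv c) z = 0.
  move=> Bz1 yz1 z k Bz; apply: (@dyadic_eq0 _ _ B) => n.
  elim: n k z Bz => [|n IH] k z Bz; first by rewrite expr0 divr1; apply/yB/sub.
  have Bn0 : 0 <= B / 2 ^+ n by rewrite divr_ge0 // exprn_ge0.
  have bound w v : dir v -> box (c x) d w ->
      `|pd v (y k \o chart_inv c) w| <= L * (B / 2 ^+ n).
    move=> hv Bw; have [_ [_ /(_ v k hv) h]] := he w (sub w Bw).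
    apply: le_trans h _; apply: (@le_trans _ _ (`|K| * (#|J|%:R * (B / 2 ^+ n)))).
      have hs : `|\sum_i `|y i (chart_inv c w)| | <= #|J|%:R * (B / 2 ^+ n).
        by apply: sum_le_card => i; rewrite normr_id; exact: IH.
      rewrite ger0_norm ?sumr_ge0 // in hs.
      apply: (@le_trans _ _ (`|K| * \sum_i `|y i (chart_inv c w)|)); last exact: ler_wpM2l.
      by apply: ler_wpM2r; [exact: sumr_ge0|exact: ler_norm].
    by rewrite mulrA [`|K| * _]mulrC.
  have dk v w : dir v -> box (c x) d w ->
      is_pd v (y k \o chart_inv c) w (pd v (y k \o chart_inv c) w).
    by move=> hv Bw; apply: class_CS_is_pd hv (sc 1%N k) _; have [] := he w (sub w Bw).
  have := @box_mean_value _ (y k \o chart_inv c) (pd 1 (y k \o chart_inv c))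
    (pd 'i (y k \o chart_inv c)) (c x) d (L * (B / 2 ^+ n)) (fun w => @dk 1 w (or_introl erefl))
    (fun w => @dk 'i w (or_intror erefl)) (fun w => @bound w 1 (or_introl erefl))
    (fun w => @bound w 'i (or_intror erefl)) z1 z Bz1 Bz.
  rewrite yz1 subr0 => /le_trans; apply.
  apply: (@le_trans _ _ (L * (B / 2 ^+ n) * (d * 4))).
    apply: ler_wpM2l; first by rewrite mulr_ge0.
    have far (s t r : R) : `|s - r| < d -> `|t - r| < d -> `|s - t| <= 2 * d.
      move=> h1 h2; have -> : s - t = (s - r) - (t - r) by ring.
      by apply: le_trans (ler_normB _ _) _; rewrite mulr_natl mulr2n lerD // ltW.
    have -> : d * 4 = 2 * d + 2 * d by ring.
    by case: Bz Bz1 => ? ? [? ?]; apply: lerD; [apply: (far _ _ (Re (c x)))|apply: (far _ _ (Im (c x)))].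
  have -> : L * (B / 2 ^+ n) * (d * 4) = L * (d * 4) * (B / 2 ^+ n) by ring.
  apply: (@le_trans _ _ (1 / 2 * (B / 2 ^+ n))); first exact: ler_wpM2r.
  by rewrite exprS invfM mul1r mulrCA.
apply: (near_chart cx); apply: open_near (@box_open _ (c x) d) (box_center _ d0) _ => z Bz.
apply/propext; split=> h k.
  have := zero z Bz h (c x) k (box_center _ d0); by rewrite /= chart_mapK.
by apply: (zero (c x) (box_center _ d0)) => // i /=; rewrite chart_mapK.
Qed.

End Charts.

Lemma is_pd_eq (R : realType) (v : R[i]^o) u z (d d' : R) : is_pd v u z d -> d = d' -> is_pd v u z d'.
Proof. by move=> h <-. Qed.

(** * Global solutions of flat linear systems on the surface *)

Section Systems.
Variables (R : realType) (M : riemannSurface R) (N : nat).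
Local Notation C := (R[i]^o).
Local Notation Re := (@complex.Re R).
Local Notation Im := (@complex.Im R).
Implicit Types (c : chart R M) (W : set M) (z v : C).

(* A matrix-valued 1-form; A c v i j is the (i, j) entry of its value on the coordinate
   field v of the chart c. *)
Definition mx_form := chart R M -> C -> 'I_N -> 'I_N -> C -> R.
Implicit Types (A : mx_form) (y w : 'I_N -> M -> R).

Definition form_smooth A := forall c, rs_atlas c -> forall k v i j, dir v ->
  class_C k (chart_img c) (A c v i j).

Definition form_transition A := forall c c' z v i j, rs_atlas c -> rs_atlas c' ->
  overlap c c' z -> dir v -> let tau := transition c c' in
  A c v i j z = Re (derive1 tau z * v) * A c' 1 i j (tau z) +
                Im (derive1 tau z * v) * A c' 'i i j (tau z).

Definition form_flat A := forall c z k j, rs_atlas c -> chart_img c z ->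
  pd 'i (A c 1 k j) z + \sum_l A c 'i k l z * A c 1 l j z =
  pd 1 (A c 'i k j) z + \sum_l A c 1 k l z * A c 'i l j z.

(** Minus the transpose: the system of the inverse of a fundamental matrix. Solutions of the two
    systems have constant pairing. *)
Definition dual_form A : mx_form := fun c v i j z => - A c v j i z.

Definition is_sol A W y := forall c z, rs_atlas c -> chart_img c z -> W (chart_inv c z) ->
  forall v j, dir v ->
  is_pd v (y j \o chart_inv c) z (\sum_i y i (chart_inv c z) * A c v i j z).

Lemma dual_smooth A : form_smooth A -> form_smooth (dual_form A).
Proof.
move=> sA c ac k v i j hv; have := class_C_scale (-1) (@chart_img_open _ _ c) (sA c ac k v j i hv).
by apply: class_C_ext; [exact: chart_img_open|move=> z _; rewrite mulN1r].
Qed.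

Lemma dual_transition A : form_transition A -> form_transition (dual_form A).
Proof. by move=> tA c c' z v i j ac ac' oz hv tau; rewrite /dual_form (tA c c' z v j i) // opprD !mulrN. Qed.

Lemma dual_flat A : form_smooth A -> form_flat A -> form_flat (dual_form A).
Proof.
move=> sA fA c z k j ac cz.
have pdN v (w : C) i l : dir v -> dir w -> pd v (dual_form A c w i l) z = - pd v (A c w l i) z.
  move=> hv hw; apply: is_pd_val.
  have := is_pd_scale (-1) (class_CS_is_pd hv (sA c ac 1%N w l i hw) cz).
  rewrite mulN1r; apply: is_pd_near.
  by apply: filterE => x; rewrite mulN1r.
rewrite !pdN; try by [left|right].
exact: (flat_transpose (da := fun k j => pd 'i (A c 1 k j) z) (db := fun k j => pd 1 (A c 'i k j) z)
  (fun k j => fA c z k j ac cz)).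
Qed.

(** Continuous solutions in one chart are smooth by the bootstrap, so the chain rule applies, and
    the transformation rule of the form carries the equation to every other chart. *)
Lemma sol_extend A W y c' : form_smooth A -> form_transition A -> rs_atlas c' -> open W ->
  W `<=` chart_dom c' ->
  (forall j p, W p -> {for p, continuous (y j)}) ->
  (forall z, chart_img c' z -> W (chart_inv c' z) -> forall v j, dir v ->
    is_pd v (y j \o chart_inv c') z (\sum_i y i (chart_inv c' z) * A c' v i j z)) ->
  is_sol A W y.
Proof.
move=> sA tA ac' oW Wc' cy dy c z ac cz Wz v j hv.
have oD := @chart_preimage_open _ _ c' W oW.
have sy : class_C 1 (chart_img c' `&` chart_inv c' @^-1` W) (y j \o chart_inv c').
  apply: (linear_system_smooth (y := fun j => y j \o chart_inv c')
    (A := fun v i j z => A c' v i j z)) oD _ _ _ _ _.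
  - move=> k x i l hx; apply: class_C_sub (sA c' ac' k x i l hx); exact: subIsetl.
  - move=> l x [cx Wx]; apply: continuous_comp; first exact: chart_inv_continuous_at.
    exact: cy.
  - by move=> w l x hw [cx Wx]; exact: dy.
have dz := Wc' _ Wz.
have := pd_transition ac ac' oW sy cz Wz dz hv; cbv zeta.
set tau := transition c c'.
have tz : chart_inv c' (tau z) = chart_inv c z by rewrite /tau /transition /= chart_mapK.
have itz : chart_img c' (tau z) by exact: chart_map_img.
have Wtz : W (chart_inv c' (tau z)) by rewrite tz.
have e (w : C) : dir w -> pd w (y j \o chart_inv c') (tau z) =
    \sum_i y i (chart_inv c z) * A c' w i j (tau z).
  by move=> hw; rewrite (is_pd_val (dy _ itz Wtz w j hw)) tz.
rewrite !e; try by [left|right].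
have oz : overlap c c' z by split.
move/is_pd_eq; apply; rewrite !mulr_sumr -big_split /=; apply: eq_bigr => i _.
rewrite (tA c c' z v i j) // -/tau; ring.
Qed.

Lemma local_sol A p c : form_smooth A -> form_transition A -> form_flat A ->
  rs_atlas c -> chart_dom c p ->
  exists2 e : R, 0 < e /\ box (c p) e `<=` chart_img c &
    forall e' : R, e' <= e -> forall v0 : 'I_N -> R, exists y : 'I_N -> M -> R,
    let W := chart_dom c `&` c @^-1` box (c p) e' in
    [/\ forall j, y j p = v0 j, forall j q, W q -> {for q, continuous (y j)} & is_sol A W y].
Proof.
move=> sA tA fA ac cp.
have cz : chart_img c (c p) by exact: chart_map_img.
have [e [e0 he] hsol] := @planar_frobenius R 'I_N (chart_img c) (A c) (c p)
  (@chart_img_open _ _ c) (fun k v i j hv => sA c ac k v i j hv)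
  (fun k j z hz => fA c z k j ac hz) cz.
exists e => // e' ee' v0; have [y [y0 cy dy]] := hsol v0.
have sub := box_sub ee' (z := c p).
exists (fun j q => y j (c q)) => W.
have cW j q : W q -> {for q, continuous (fun q => y j (c q))}.
  move=> [cq Bq]; apply: (@continuous_comp _ _ _ c (y j)); first exact: chart_map_continuous_at.
  by apply: cy; exact: sub.
split=> //; apply: (@sol_extend A W _ c) => //.
- exact: chart_image_open (@box_open _ _ _).
- by move=> q [].
- move=> z iz [_]; rewrite /= chart_invK // => Bz v j hv.
  have := dy v j z hv (sub _ Bz).
  have -> : \sum_i y i z * A c v i j z = \sum_i y i (c (chart_inv c z)) * A c v i j z.
    by rewrite chart_invK.
  apply: is_pd_near; apply: open_near (@chart_img_open _ _ c) iz _ => x ix.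
  by rewrite /= chart_invK.
Qed.

Lemma pairing_pd A W y w c z v : is_sol A W y -> is_sol (dual_form A) W w -> rs_atlas c ->
  chart_img c z -> W (chart_inv c z) -> dir v ->
  is_pd v ((fun q => \sum_l y l q * w l q) \o chart_inv c) z 0.
Proof.
move=> sy sw ac cz Wz hv.
have := is_pd_sum (fun l => is_pd_mul (sy c z ac cz Wz v l hv) (sw c z ac cz Wz v l hv)).
move/is_pd_eq; apply; rewrite big_split /=.
under eq_bigr do rewrite mulr_suml.
under [X in _ + X]eq_bigr do rewrite mulr_sumr.
rewrite exchange_big /= -big_split /= big1 // => i _.
rewrite -big_split /= big1 // => l _; rewrite /dual_form; ring.
Qed.

Lemma sol_sub A W W' y : W' `<=` W -> is_sol A W y -> is_sol A W' y.
Proof. by move=> WW' sy c z ac cz /WW' Wz; exact: sy. Qed.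

Lemma sol_comb A W (K : finType) (k : K -> R) (y : K -> 'I_N -> M -> R) :
  (forall a, is_sol A W (y a)) -> is_sol A W (fun j q => \sum_a k a * y a j q).
Proof.
move=> sy c z ac cz Wz v j hv.
have := is_pd_sum (fun a => is_pd_scale (k a) (sy a c z ac cz Wz v j hv)).
move/is_pd_eq; apply; under eq_bigr do rewrite mulr_sumr.
rewrite exchange_big /=; apply: eq_bigr => i _; rewrite mulr_suml.
by apply: eq_bigr => a _; rewrite mulrA.
Qed.

Definition patch c p (e : R) : set M := chart_dom c `&` c @^-1` box (c p) e.

Lemma patch_open c p e : open (patch c p e).
Proof. exact: chart_image_open (@box_open _ _ _). Qed.

(** The inverse of the fundamental matrix [Phi] is obtained as a fundamental matrix [Theta] of the
    dual system: the product of the two is constant on the patch and is the identity at [p]. Both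
    live on one patch because [local_sol] allows any smaller radius. *)
Lemma local_fundamental A p : form_smooth A -> form_transition A -> form_flat A ->
  exists t : chart R M * R * (M -> 'M[R]_N) * (M -> 'M[R]_N),
  let: (c, e, Phi, Theta) := t in
  [/\ [/\ rs_atlas c, 0 < e, chart_dom c p & box (c p) e `<=` chart_img c],
      forall i j q, patch c p e q -> {for q, continuous (fun x => Phi x i j)},
      forall i, is_sol A (patch c p e) (fun j q => Phi q i j),
      forall j, is_sol (dual_form A) (patch c p e) (fun i q => Theta q i j) &
      forall q, patch c p e q -> Phi q *m Theta q = 1%:M].
Proof.
move=> sA tA fA; have [c ac cp] := rs_cover p.
have [e1 [e10 he1] sol1] := local_sol sA tA fA ac cp.
have [e2 [e20 he2] sol2] := local_sol (dual_smooth sA) (dual_transition tA) (dual_flat sA fA) ac cp.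
pose e := Num.min e1 e2.
have e0 : 0 < e by rewrite lt_min e10.
have le1 : e <= e1 by rewrite /e ge_min lexx.
have le2 : e <= e2 by rewrite /e ge_min lexx orbT.
have [Y hY] := choice (fun i : 'I_N => sol1 e le1 (fun j => (i == j)%:R)).
have [Z hZ] := choice (fun j : 'I_N => sol2 e le2 (fun i => (i == j)%:R)).
exists (c, e, fun q => \matrix_(i, j) Y i j q, fun q => \matrix_(i, j) Z j i q); split.
- by split=> //; move=> z /(box_sub le1) /he1.
- move=> i j q Wq; have [_ /(_ j q Wq) h _] := hY i.
  have E : (fun x => (\matrix_(i, j) Y i j x) i j) = Y i j by apply/funext => x; rewrite mxE.
  by rewrite /prop_for /continuous_at E mxE.
- move=> i; have [_ _] := hY i; congr is_sol.
  by apply/funext => j; apply/funext => x; rewrite mxE.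
- move=> j; have [_ _] := hZ j; congr is_sol.
  by apply/funext => i; apply/funext => x; rewrite mxE.
move=> q [cq Bq]; apply/matrixP => i j; rewrite !mxE.
pose u q := \sum_l Y i l q * Z j l q.
have uq : u q = u p.
  have du v z : dir v -> box (c p) e z -> is_pd v (u \o chart_inv c) z 0.
    move=> hv Bz; have iz : chart_img c z by apply/he1/(box_sub le1).
    have [_ _ sY] := hY i; have [_ _ sZ] := hZ j.
    by apply: (pairing_pd sY sZ) => //; split; [exact: chart_inv_dom|rewrite /= chart_invK].
  have h : `|(u \o chart_inv c) (c q) - (u \o chart_inv c) (c p)| <=
      0 * (`|Re (c q) - Re (c p)| + `|Im (c q) - Im (c p)|).
    apply: (@box_mean_value _ _ (fun=> 0) (fun=> 0) (c p) e) => // [x Bx|x Bx|x Bx|x Bx|].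
    - by apply: du => //; left.
    - by apply: du => //; right.
    - by rewrite normr0.
    - by rewrite normr0.
    - exact: box_center.
  by move: h; rewrite mul0r normr_le0 subr_eq0 /= !chart_mapK // => /eqP.
transitivity (u q); first by apply: eq_bigr => l _; rewrite !mxE.
rewrite uq /u; have [Y0 _ _] := hY i; have [Z0 _ _] := hZ j.
under eq_bigr do rewrite Y0 Z0.
rewrite (bigD1 i) //= eqxx mul1r big1 ?addr0 // => l /negPf li.
by rewrite eq_sym li mul0r.
Qed.

(** Relative to a local fundamental matrix, solutions have constant coordinates. The local maps
    [v => v Phi] and [v => v Theta] thus trivialise a covering with discrete fibre, its transition
    maps [v => v Phi_p Theta_q] being locally constant, and a global section of this covering is a
    solution. *)
Theorem surface_frobenius A (p0 : M) (v0 : 'I_N -> R) :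
  form_smooth A -> form_transition A -> form_flat A -> simply_connected R M ->
  exists y : 'I_N -> M -> R,
    [/\ forall j, y j p0 = v0 j, forall j, smooth_on setT (y j) & is_sol A setT y].
Proof.
move=> sA tA fA [pc lc].
have [t ht] := choice (fun p => local_fundamental p sA tA fA).
pose c p := (t p).1.1.1; pose e p := (t p).1.1.2.
pose Phi p := (t p).1.2; pose Theta p := (t p).2.
pose W p := patch (c p) p (e p).
have {ht} H p : [/\ [/\ rs_atlas (c p), 0 < e p, chart_dom (c p) p & box (c p p) (e p) `<=` chart_img (c p)],
      forall i j q, W p q -> {for q, continuous (fun x => Phi p x i j)},
      forall i, is_sol A (W p) (fun j q => Phi p q i j),
      forall j, is_sol (dual_form A) (W p) (fun i q => Theta p q i j) &
      forall q, W p q -> Phi p q *m Theta p q = 1%:M].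
  by have := ht p; rewrite /W /c /e /Phi /Theta; case: (t p) => [[[? ?] ?] ?].
have Wopen p : open (W p) by exact: patch_open.
have Wp p : W p p by have [[_ e0 cp _] _ _ _ _] := H p; split=> //=; exact: box_center.
have loc (v : 'rV[R]_N) (p q x : M) : W p x -> W q x ->
    \forall x' \near x, v *m Phi p x' *m Theta q x' = v *m Phi p x *m Theta q x.
  move=> px qx; pose u j x := \sum_l (\sum_a v 0 a * Phi p x a l) * Theta q x l j.
  have uE x' : v *m Phi p x' *m Theta q x' = \row_j u j x'.
    apply/rowP => j; rewrite !mxE; apply: eq_bigr => l _; congr (_ * _).
    by rewrite mxE.
  have [_ _ sP _ _] := H p; have [_ _ _ sT _] := H q.
  have ou j : \forall x' \near x, u j x' = u j x.
    have oW : open (W p `&` W q) by exact: openI.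
    apply: (zero_pd_locally_constant oW) => // d z w ad iz Wz hw.
    have s1 := sol_sub (@subIsetl _ (W p) (W q)) (sol_comb (v 0) sP).
    have s2 := sol_sub (@subIsetr _ (W p) (W q)) (sT j).
    exact: (pairing_pd s1 s2).
  have : \forall x' \near x, forall j, u j x' = u j x by exact: filter_forall.
  by apply: filterS => x' h; rewrite !uE; apply/rowP => j; rewrite !mxE h.
have PT p q : W p q -> Phi p q *m Theta p q = 1%:M by have [_ _ _ _] := H p; apply.
(* Boxes are convex: a straight segment in the chart, made stationary outside [[0, 1]], joins two
   points of a patch within it. *)
have paths p q : W p q -> \forall x \near q, exists g : R -> M,
    [/\ continuous g, g 0 = q, g 1 = x & forall s, W p (g s)].
  move=> pq; apply: (open_near (Wopen p) pq) => x px.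
  have [[ac e0 cp sub] _ _ _ _] := H p.
  pose h (s : R) : C := line (c p x - c p q) (c p q) (clamp01 s).
  have hB s : box (c p p) (e p) (h s).
    have := clamp01_itv s; rewrite in_itv /= => /andP[s0 s1].
    have conv (a b r d : R) : `|a - r| < d -> `|b - r| < d ->
        `|a + clamp01 s * (b - a) - r| < d.
      move=> h1 h2; have -> : a + clamp01 s * (b - a) - r =
        (1 - clamp01 s) * (a - r) + clamp01 s * (b - r) by ring.
      apply: le_lt_trans (ler_normD _ _) _; rewrite !normrM (ger0_norm s0) ger0_norm ?subr_ge0 //.
      have [->|sN0] := eqVneq (clamp01 s) 0; first by rewrite subr0 mul0r mul1r addr0.
      have sp : 0 < clamp01 s by rewrite lt_neqAle eq_sym sN0.
      have -> : d = (1 - clamp01 s) * d + clamp01 s * d by ring.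
      by apply: ler_ltD; [apply: ler_wpM2l; [rewrite subr_ge0|exact: ltW]|rewrite ltr_pM2l].
    move: pq px => [_ [q1 q2]] [_ [x1 x2]]; split.
      by rewrite /h /line ReD ReZ ReB; exact: conv.
    by rewrite /h /line ImD ImZ ImB; exact: conv.
  exists (fun s => chart_inv (c p) (h s)); split.
  - move=> s; apply: (@continuous_comp _ _ _ h (chart_inv (c p))).
      by apply: (@continuous_comp _ _ _ (@clamp01 R)); [exact: clamp01_continuous|exact: line_continuous].
    by apply: chart_inv_continuous_at; exact: sub.
  - by rewrite /h clamp01_0 line0 chart_mapK //; case: pq.
  - by rewrite /h clamp01_1 /line mul1r addrC subrK chart_mapK //; case: px.
  - move=> s; split; first by apply: chart_inv_dom; exact: sub.
    by rewrite /= chart_invK //; exact: sub.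
have [y [y0 hy]] := @global_section R M 'rV[R]_N M W
  (fun p q (v : 'rV[R]_N) => v *m Phi p q) (fun p q (v : 'rV[R]_N) => v *m Theta p q) Wopen (fun p => ex_intro (fun i => W i p) p (Wp p))
  (fun p q (v : 'rV[R]_N) pq => etrans (esym (mulmxA _ _ _)) (etrans (congr1 (mulmx v) (PT p q pq)) (mulmx1 v)))
  (fun p q (v : 'rV[R]_N) pq => etrans (esym (mulmxA _ _ _))
     (etrans (congr1 (mulmx v) (mulmx1C (PT p q pq))) (mulmx1 v)))
  (fun p q x (v : 'rV[R]_N) px qx => loc v p q x px qx) pc lc paths p0 (\row_j v0 j).
(* The coordinates of the section at [p] in the trivialisation around [p]; their local constancy
   exhibits [y] near [p] as a fixed combination of the local solutions. *)
pose k p := y p *m Theta p p.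
have yE p : \forall q \near p, y q = k p *m Phi p q.
  have nW : \forall q \near p, W p q by exact: open_near (Wopen p) (Wp p) _.
  apply: filterS2 nW (hy p p (Wp p)) => q pq e'; rewrite /k -e'.
  by rewrite -mulmxA (mulmx1C (PT p q pq)) mulmx1.
pose Y j q := y q 0 j.
have YE p j : \forall q \near p, Y j q = \sum_a k p 0 a * Phi p q a j.
  by apply: filterS (yE p) => q; rewrite /Y => ->; rewrite mxE.
have cY j p : {for p, continuous (Y j)}.
  have cP : {for p, continuous (fun q => \sum_a k p 0 a * Phi p q a j : R^o)}.
    apply: continuous_sum => a; apply: cvgM; first exact: cvg_cst.
    by have [_ cP _ _ _] := H p; exact: cP.
  move=> P; rewrite (nbhs_singleton (YE p j)) => /cP; apply: filterS2 (YE p j).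
  by move=> q /= ->.
have sY : is_sol A setT Y.
  move=> d z ad iz _ v j hv; pose p := chart_inv d z.
  have [_ _ sP _ _] := H p.
  have := sol_comb (fun a => k p 0 a) sP ad iz (Wp p) j hv.
  have -> : \sum_i (\sum_a k p 0 a * Phi p (chart_inv d z) a i) * A d v i j z =
      \sum_i Y i (chart_inv d z) * A d v i j z.
    by apply: eq_bigr => i _; rewrite -(nbhs_singleton (YE p i)).
  have nx : \forall x \near z, Y j (chart_inv d x) = \sum_a k p 0 a * Phi p (chart_inv d x) a j.
    exact: (chart_inv_continuous_at iz (YE p j)).
  by apply: is_pd_near; apply: filterS nx => x /= ->.
exists Y; split=> // [j|j d ad n]; first by rewrite /Y y0 mxE.
rewrite preimage_setT setIT.
apply: (linear_system_smooth (y := fun j => Y j \o chart_inv d)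
    (A := fun v i j z => A d v i j z)) (@chart_img_open _ _ d) _ _ _ _ _.
- by move=> m v i l hv; exact: sA.
- move=> l x ix; apply: continuous_comp; [exact: chart_inv_continuous_at|exact: cY].
- by move=> v l x hv ix; exact: sY.
Qed.

End Systems.

(** * The Clifford group *)

(** Right multiplication by [a] is injective because [a b = 1]; in finite dimension it is then
    surjective, which gives a left inverse of [a], necessarily [b]. *)
Lemma falg_mulVr (K : fieldType) (L : falgType K) (a b : L) : a * b = 1 -> b * a = 1.
Proof.
move=> ab; have ker0 : lker (amulr a) == 0%VS.
  by apply/lker0P => x y /(congr1 (fun z => z * b)); rewrite !lfunE /= -!mulrA ab !mulr1.
pose z := (amulr a)^-1%VF 1.
have za : z * a = 1 by have := lker0_lfunVK ker0 1; rewrite lfunE.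
by have <- : z = b by rewrite -[z]mulr1 -ab mulrA za mul1r.
Qed.

Section CliffordGroup.
Variables (R : realType) (n : nat).
Local Notation Cl := (clifford R n).
Implicit Types (a b : Cl) (v w : 'rV[R]_n) (k : R) (S T U : {set 'I_n}).

Lemma cl_coef0 S : cl_coef (0 : Cl) S = 0. Proof. by rewrite /cl_coef ffunE. Qed.
Lemma cl_coefN a S : cl_coef (- a) S = - cl_coef a S.
Proof. by rewrite -scaleN1r cl_coefZ mulN1r. Qed.
Lemma cl_coefB a b S : cl_coef (a - b) S = cl_coef a S - cl_coef b S.
Proof. by rewrite cl_coefD cl_coefN. Qed.
Lemma cl_coef1 S : cl_coef (1 : Cl) S = (S == finset.set0)%:R.
Proof. exact: cl_makeE. Qed.
Lemma cl_coef_sum (I : finType) (F : I -> Cl) S : cl_coef (\sum_i F i) S = \sum_i cl_coef (F i) S.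
Proof. by elim/big_rec2: _ => [|i x y _ <-]; rewrite ?cl_coef0 ?cl_coefD. Qed.

Lemma cl_coef_tr a S : cl_coef (cl_tr a) S = (-1) ^+ 'C(#|S|, 2) * cl_coef a S.
Proof. exact: cl_makeE. Qed.

Lemma cl_trD a b : cl_tr (a + b) = cl_tr a + cl_tr b.
Proof. by apply/clP => S; rewrite cl_coefD !cl_coef_tr cl_coefD mulrDr. Qed.
Lemma cl_trZ k a : cl_tr (k *: a) = k *: cl_tr a.
Proof. by apply/clP => S; rewrite cl_coefZ !cl_coef_tr cl_coefZ mulrCA. Qed.
Lemma cl_trN a : cl_tr (- a) = - cl_tr a.
Proof. by rewrite -scaleN1r cl_trZ scaleN1r. Qed.
Lemma cl_tr1 : cl_tr (1 : Cl) = 1.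
Proof. by rewrite -cl_base0 cl_tr_base cards0 expr0 scale1r. Qed.
Lemma cl_tr0 : cl_tr (0 : Cl) = 0.
Proof. by rewrite -(scale0r (0 : Cl)) cl_trZ !scale0r. Qed.

Lemma cl_vecD v w : cl_vec (v + w) = cl_vec v + cl_vec w.
Proof. by rewrite /cl_vec -big_split; apply: eq_bigr => i _; rewrite mxE scalerDl. Qed.
Lemma cl_vecZ k v : cl_vec (k *: v) = k *: cl_vec v.
Proof. by rewrite /cl_vec scaler_sumr; apply: eq_bigr => i _; rewrite mxE scalerA. Qed.
Lemma cl_vecN v : cl_vec (- v) = - cl_vec v.
Proof. by rewrite -scaleN1r cl_vecZ scaleN1r. Qed.
Lemma cl_vecB v w : cl_vec (v - w) = cl_vec v - cl_vec w.
Proof. by rewrite cl_vecD cl_vecN. Qed.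
Lemma cl_vec0 : cl_vec (0 : 'rV[R]_n) = 0.
Proof. by rewrite -(scale0r (0 : 'rV[R]_n)) cl_vecZ scale0r. Qed.
Lemma cl_vec_inj : injective (@cl_vec R n).
Proof. exact: can_inj (@cl_vecK R n). Qed.

Lemma cl_vec_delta (i : 'I_n) : cl_vec (delta_mx 0 i) = cl_base R [set i]%SET.
Proof.
rewrite /cl_vec (bigD1 i) //= mxE !eqxx scale1r big1 ?addr0 // => j /negPf ji.
by rewrite mxE ji andbF scale0r.
Qed.

Lemma cl_coef_base S T : cl_coef (cl_base R S : Cl) T = (T == S)%:R.
Proof. exact: cl_makeE. Qed.

Lemma cl_coef_vecN1 v S : #|S| != 1%N -> cl_coef (cl_vec v) S = 0.
Proof.
move=> S1; rewrite /cl_vec cl_coef_sum big1 // => i _; rewrite cl_coefZ cl_coef_base.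
by case: eqP => [Si|]; rewrite ?mulr0 //; move: S1; rewrite Si cards1.
Qed.

(** As the vanishing of certain coordinates, the condition is linear and can be propagated along a
    linear system; [is_realP] serves the same purpose. *)
Lemma is_vectorP a : is_vector a <-> forall S, #|S| != 1%N -> cl_coef a S = 0.
Proof.
split=> [[v ->] S|h]; first exact: cl_coef_vecN1.
exists (cl_unvec a); apply/clP => S.
have [/cards1P[i ->]|S1] := boolP (#|S| == 1%N); first by rewrite cl_coef_vec mxE.
by rewrite h // cl_coef_vecN1.
Qed.

Definition is_real a := exists k, a = k%:A.

Lemma is_realP a : is_real a <-> forall S, S != finset.set0 -> cl_coef a S = 0.
Proof.
split=> [[k ->] S S0|h]; first by rewrite cl_coefZ cl_coef1 (negPf S0) mulr0.
exists (cl_coef a finset.set0); apply/clP => S; rewrite cl_coefZ cl_coef1.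
by case: eqP => [->|/eqP S0]; rewrite ?mulr1 // mulr0 h.
Qed.

Lemma is_vectorD a b : is_vector a -> is_vector b -> is_vector (a + b).
Proof. by move=> [v ->] [w ->]; exists (v + w); rewrite cl_vecD. Qed.
Lemma is_vectorZ k a : is_vector a -> is_vector (k *: a).
Proof. by move=> [v ->]; exists (k *: v); rewrite cl_vecZ. Qed.
Lemma is_vectorN a : is_vector a -> is_vector (- a).
Proof. by move=> [v ->]; exists (- v); rewrite cl_vecN. Qed.
Lemma is_vector0 : is_vector (0 : Cl).
Proof. by exists 0; rewrite cl_vec0. Qed.
Lemma is_vector_tr a : is_vector a -> is_vector (cl_tr a).
Proof. by move=> [v ->]; exists v; rewrite cl_tr_vec. Qed.
Lemma is_realN a : is_real a -> is_real (- a).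
Proof. by move=> [k ->]; exists (- k); rewrite scaleNr. Qed.

Lemma dotE v w : \sum_i v 0 i * w 0 i = dot v w. Proof. by []. Qed.

Lemma dotC v w : dot v w = dot w v.
Proof. by apply: eq_bigr => i _; rewrite mulrC. Qed.
Lemma dotDl v v' w : dot (v + v') w = dot v w + dot v' w.
Proof. by rewrite /dot -big_split; apply: eq_bigr => i _; rewrite mxE mulrDl. Qed.
Lemma dotZl k v w : dot (k *: v) w = k * dot v w.
Proof. by rewrite /dot mulr_sumr; apply: eq_bigr => i _; rewrite mxE mulrA. Qed.
Lemma dotNl v w : dot (- v) w = - dot v w.
Proof. by rewrite -scaleN1r dotZl mulN1r. Qed.
Lemma dotDr v w w' : dot v (w + w') = dot v w + dot v w'.
Proof. by rewrite dotC dotDl !(dotC v). Qed.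
Lemma dot_delta v (i : 'I_n) : dot v (delta_mx 0 i) = v 0 i.
Proof.
rewrite /dot (bigD1 i) //= mxE !eqxx mulr1 big1 ?addr0 // => j /negPf ji.
by rewrite mxE ji andbF mulr0.
Qed.
Lemma dot_gt0 v : v != 0 -> 0 < dot v v.
Proof.
move=> v0; have d0 : 0 <= dot v v by apply: sumr_ge0 => i _; rewrite -expr2 sqr_ge0.
rewrite lt_neqAle d0 andbT; apply: contraNneq v0 => /esym/eqP.
rewrite psumr_eq0 => [|i _]; last by rewrite -expr2 sqr_ge0.
move=> /allP h; apply/eqP/rowP => i; rewrite mxE.
by have := h i; rewrite mem_index_enum => /(_ isT) /=; rewrite mulf_eq0 orbb => /eqP.
Qed.

Lemma cl_vec_anticomm v w : cl_vec v * cl_vec w = (- 2 * dot v w)%:A - cl_vec w * cl_vec v.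
Proof. by rewrite /dot -cl_clifford addrK. Qed.

Lemma cl_vec_sqr v : cl_vec v * cl_vec v = - (dot v v)%:A.
Proof.
have := cl_clifford v v; rewrite dotE -mulr2n -scaler_nat => /(congr1 (fun x => (2^-1 : R) *: x)).
rewrite !scalerA mulVf ?pnatr_eq0 // scale1r => ->; rewrite -scaleNr; congr (_ *: _).
by rewrite mulNr mulrN mulrA mulVf ?pnatr_eq0 // mul1r.
Qed.

Lemma mulAl k a : k%:A * a = k *: a. Proof. by rewrite -scalerAl mul1r. Qed.
Lemma mulAr k a : a * k%:A = k *: a. Proof. by rewrite -scalerAr mulr1. Qed.

Lemma unit_of_mul a b : a * b = 1 -> a \is a GRing.unit.
Proof. by move=> ab; apply/unitrP; exists b; rewrite ab (falg_mulVr ab). Qed.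

Lemma inv_of_mul a b : a * b = 1 -> a^-1 = b.
Proof.
move=> ab; have ua := unit_of_mul ab.
by rewrite -[LHS]mulr1 -ab mulKr.
Qed.

Lemma unit_of_scalar_mul a b k : k != 0 -> a * b = k%:A -> a \is a GRing.unit.
Proof.
move=> k0 ab; apply: (@unit_of_mul _ (k^-1 *: b)).
by rewrite -scalerAr ab scalerA mulVf // scale1r.
Qed.

Lemma cl_vec_unit v : v != 0 -> cl_vec v \is a GRing.unit.
Proof.
move=> v0; apply: (@unit_of_scalar_mul _ (cl_vec v) (- dot v v)).
  by rewrite oppr_eq0 gt_eqF ?dot_gt0.
by rewrite cl_vec_sqr scaleNr.
Qed.

Lemma clifford_group_unit a : clifford_group a -> a \is a GRing.unit.
Proof.
elim=> [v /cl_vec_unit//||x y _ ux _ uy|x _ ux]; first exact: unitr1.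
- by rewrite unitrMl.
- by rewrite unitrV.
Qed.

(** A scalar [k] is the product of the vectors [- k e_i] and [e_i]. This takes a coordinate [i],
    whence the parameter [i0] of the later statements: for [n = 0] there is no nonzero vector and
    the group is trivial. *)
Lemma clifford_group_scale (i : 'I_n) k : k != 0 -> clifford_group (k%:A : Cl).
Proof.
move=> k0; have d0 : delta_mx 0 i != 0 :> 'rV[R]_n.
  by apply/eqP => /rowP/(_ i); rewrite !mxE !eqxx => /eqP; rewrite oner_eq0.
have -> : (k%:A : Cl) = cl_vec ((- k) *: delta_mx 0 i) * cl_vec (delta_mx 0 i).
  by rewrite cl_vecZ -scalerAl cl_vec_sqr dot_delta mxE !eqxx scalerN scaleNr opprK scalerA mulr1.
apply: clifford_groupM; apply: clifford_group_vec => //.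
by rewrite scaler_eq0 oppr_eq0 negb_or k0.
Qed.

(** The main involution: the algebra automorphism that is [-1] on vectors. *)
Definition cl_grade a : Cl := cl_make (fun S => (-1) ^+ #|S| * cl_coef a S).

Lemma cl_coef_grade a S : cl_coef (cl_grade a) S = (-1) ^+ #|S| * cl_coef a S.
Proof. exact: cl_makeE. Qed.

Lemma cl_gradeZ k a : cl_grade (k *: a) = k *: cl_grade a.
Proof. by apply/clP => S; rewrite cl_coefZ !cl_coef_grade cl_coefZ mulrCA. Qed.
Lemma cl_gradeK : involutive cl_grade.
Proof. by move=> a; apply/clP => S; rewrite !cl_coef_grade mulrA -expr2 sqrr_sign mul1r. Qed.
Lemma cl_grade1 : cl_grade 1 = 1.
Proof.
apply/clP => S; rewrite cl_coef_grade cl_coef1; case: eqP => [->|_]; last by rewrite mulr0.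
by rewrite cards0 expr0 mul1r.
Qed.
Lemma cl_grade_vec v : cl_grade (cl_vec v) = - cl_vec v.
Proof.
apply/clP => S; rewrite cl_coef_grade cl_coefN.
have [/eqP->|S1] := boolP (#|S| == 1%N); first by rewrite expr1 mulN1r.
by rewrite cl_coef_vecN1 // mulr0 oppr0.
Qed.

Lemma cl_gradeM a b : cl_grade (a * b) = cl_grade a * cl_grade b.
Proof.
apply/clP => U; rewrite cl_coef_grade !cl_coefM mulr_sumr; apply: eq_bigr => S _.
rewrite !cl_coef_grade.
have -> : (-1) ^+ #|U| = (-1) ^+ #|S| * (-1) ^+ #|symdiff S U| :> R.
  by rewrite -card_symdiff_sgn symdiffK.
ring.
Qed.

Lemma cl_grade_tr a : cl_grade (cl_tr a) = cl_tr (cl_grade a).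
Proof. by apply/clP => S; rewrite !cl_coef_grade !cl_coef_tr cl_coef_grade mulrCA. Qed.

(* The scalar part of a * conj a is the sum of the squares of the coordinates of a. *)
Lemma cl_mul_conj_eq0 a : a * cl_grade (cl_tr a) = 0 -> a = 0.
Proof.
move=> /clP/(_ finset.set0); rewrite cl_coef0 cl_coefM => h.
apply/clP => S; rewrite cl_coef0; apply/eqP; rewrite -[_ == 0]orbb -mulf_eq0 -expr2.
have sq T : (-1) ^+ cl_exp T (symdiff T finset.set0) * cl_coef a T *
    cl_coef (cl_grade (cl_tr a)) (symdiff T finset.set0) = cl_coef a T ^+ 2.
  rewrite symdiffs0 cl_coef_grade cl_coef_tr cl_tr_sgn.
  have e1 : (-1) ^+ cl_exp T T * (-1) ^+ cl_exp T T = 1 :> R by rewrite -expr2 sqrr_sign.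
  have e2 : (-1) ^+ #|T| * (-1) ^+ #|T| = 1 :> R by rewrite -expr2 sqrr_sign.
  transitivity ((-1) ^+ cl_exp T T * (-1) ^+ cl_exp T T * ((-1) ^+ #|T| * (-1) ^+ #|T|) *
    cl_coef a T ^+ 2 : R); first by ring.
  by rewrite e1 e2 !mul1r.
move: h; under eq_bigr do rewrite sq.
move/eqP; rewrite psumr_eq0 => [|T _]; last exact: sqr_ge0.
by move=> /allP/(_ S); rewrite mem_index_enum => /(_ isT).
Qed.

(** An element of [S] other than [i] is counted in exactly one of the two sums, and [i] itself in
    both. *)
Lemma cl_exp1 (i : 'I_n) (S : {set 'I_n}) :
  (cl_exp [set i]%SET S + cl_exp S [set i]%SET = #|S| + (i \in S))%N.
Proof.
rewrite /cl_exp big_set1; under [X in (_ + X)%N]eq_bigr do rewrite big_set1.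
rewrite -big_split /=; have [iS|iS] := boolP (i \in S).
  rewrite (bigD1 i) //= leqnn (cardD1 i) iS -sum1_card.
  rewrite addn1 add1n addSn; congr (_.+1); rewrite add1n; congr (_.+1).
  apply: eq_big => [j|j /andP[jS ji]]; first by rewrite inE andbC.
  by case: ltngtP => // /val_inj e; rewrite e eqxx in ji.
rewrite addn0 -sum1_card; apply: eq_bigr => j jS.
by case: ltngtP => // /val_inj e; rewrite -e jS in iS.
Qed.

Lemma cl_sgn1 (i : 'I_n) (S : {set 'I_n}) :
  (-1) ^+ cl_exp [set i]%SET S = (-1) ^+ #|S| * (-1) ^+ (i \in S) * (-1) ^+ cl_exp S [set i]%SET :> R.
Proof.
have h : (-1) ^+ cl_exp [set i]%SET S * (-1) ^+ cl_exp S [set i]%SET =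
    (-1) ^+ #|S| * (-1) ^+ (i \in S) :> R by rewrite -!exprD cl_exp1.
by rewrite -h -mulrA -expr2 sqrr_sign mulr1.
Qed.

Lemma cl_coef_mul_basel (i : 'I_n) a U :
  cl_coef (cl_base R [set i]%SET * a) U =
  (-1) ^+ cl_exp [set i]%SET (symdiff [set i]%SET U) * cl_coef a (symdiff [set i]%SET U).
Proof.
rewrite cl_coefM (bigD1 [set i]%SET) //= cl_coef_base eqxx mulr1 big1 ?addr0 // => S /negPf Si.
by rewrite cl_coef_base Si mulr0 mul0r.
Qed.

Lemma cl_coef_mul_baser (i : 'I_n) a U :
  cl_coef (a * cl_base R [set i]%SET) U =
  (-1) ^+ cl_exp (symdiff [set i]%SET U) [set i]%SET * cl_coef a (symdiff [set i]%SET U).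
Proof.
rewrite cl_coefM (bigD1 (symdiff [set i]%SET U)) //= cl_coef_base.
have -> : symdiff (symdiff [set i]%SET U) U = [set i]%SET.
  by rewrite -symdiffA symdiffss symdiffs0.
rewrite eqxx mulr1 big1 ?addr0 // => S /negPf SU; rewrite cl_coef_base.
case: eqP => [e|]; last by rewrite mulr0.
by move: SU; rewrite -e -symdiffA symdiffss symdiffs0 eqxx.
Qed.

(** For [i] in [S], moving [e_i] across [e_S] costs the sign [(-1)^(|S| - 1)], whereas the
    hypothesis prescribes [(-1)^|S|]; so the coordinate at [S] vanishes as soon as [S] has an
    element. *)
Lemma twisted_center a : (forall v, cl_vec v * a = cl_grade a * cl_vec v) -> is_real a.
Proof.
move=> h; apply/is_realP => S /finset.set0Pn[i iS].
have := h (delta_mx 0 i); rewrite cl_vec_delta => /clP/(_ (symdiff [set i]%SET S)).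
rewrite cl_coef_mul_basel cl_coef_mul_baser symdiffK cl_coef_grade cl_sgn1 iS expr1.
have p0 := signr_eq0 R #|S|; have q0 := signr_eq0 R (cl_exp S [set i]%SET) => e.
have : 2 * ((-1) ^+ #|S| * (-1) ^+ cl_exp S [set i]%SET * cl_coef a S) = 0.
  suff aux (p q x : R) : p * -1 * q * x = p * x * q \/ p * -1 * q * x = q * (p * x) ->
      2 * (p * q * x) = 0 by apply: aux; right; exact: e.
  move=> h'; have -> : 2 * (p * q * x) = q * (p * x) - p * -1 * q * x by ring.
  by case: h' => ->; ring.
by move/eqP; rewrite !mulf_eq0 pnatr_eq0 p0 q0 /= => /eqP.
Qed.

(** Even coordinates vanish by parity. For [S] odd and [i] in [S], [e_i] commutes with [e_S], so the
    anticommutator of [e_i] and [a] has twice the coordinate at [S], up to sign, at [S] without [i];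
    this set is nonempty unless [S] is a singleton. *)
Lemma odd_vector a : cl_grade a = - a ->
  (forall v, is_real (cl_vec v * a + a * cl_vec v)) -> is_vector a.
Proof.
move=> oa h; apply/is_vectorP => S S1.
have [oS|eS] := boolP (odd #|S|); last first.
  move/clP/(_ S): oa; rewrite cl_coef_grade cl_coefN -signr_odd (negPf eS) expr0 mul1r => e.
  have : 2 * cl_coef a S = 0 by rewrite mulr_natl mulr2n {1}e addNr.
  by move/eqP; rewrite mulf_eq0 pnatr_eq0 /= => /eqP.
have [i iS] : exists i, i \in S by apply/finset.set0Pn; apply: contraTneq oS => ->; rewrite cards0.
have := h (delta_mx 0 i); rewrite cl_vec_delta => /is_realP/(_ (symdiff [set i]%SET S)).
have -> : symdiff [set i]%SET S != finset.set0.
  by apply: contraNneq S1 => e; rewrite -(symdiffK [set i]%SET S) e symdiffs0 cards1.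
move=> /(_ isT); rewrite cl_coefD cl_coef_mul_basel cl_coef_mul_baser symdiffK.
rewrite cl_sgn1 iS expr1 -signr_odd oS expr1 mulN1r opprK mul1r -mulr2n -mulr_natl.
by move/eqP; rewrite !mulf_eq0 pnatr_eq0 signr_eq0 /= => /eqP.
Qed.

End CliffordGroup.

(** * Twisted conjugation and the Cartan-Dieudonne theorem *)

Section CartanDieudonne.
Variables (R : realType) (n : nat).
Local Notation Cl := (clifford R n).
Implicit Types (a b c d : Cl) (v w x : 'rV[R]_n) (k : R).

(** The map [v => a v grade(a)^-1] sends vectors to vectors. With the twist, a vector acts as the
    reflection in its orthogonal hyperplane, without an additional sign. *)
Definition twisted_preserves a :=
  a \is a GRing.unit /\ forall v, exists w, a * cl_vec v = cl_vec w * cl_grade a.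

(** The main involution turns [a v = w grade(a)] into [grade(a) v = w a]; combining the two,
    [a v v = w w a], and the squares are scalars. *)
Lemma twisted_norm a v w : a \is a GRing.unit ->
  a * cl_vec v = cl_vec w * cl_grade a -> dot v v = dot w w.
Proof.
move=> ua e; apply/eqP; rewrite -subr_eq0; apply/negPn/negP => vw.
have ga : cl_grade a * cl_vec v = cl_vec w * a.
  have := congr1 (@cl_grade R n) e; rewrite !cl_gradeM !cl_grade_vec cl_gradeK.
  by rewrite mulrN mulNr => /oppr_inj.
have : (dot v v - dot w w) *: a = 0.
  apply/eqP; rewrite scalerBl subr_eq0; apply/eqP/oppr_inj.
  have := cl_vec_sqr v; rewrite -scaleNr => h1.
  have h2 := cl_vec_sqr w; rewrite -[RHS]scaleNr in h2.
  by rewrite -!scaleNr -[LHS]mulAr -h1 -[RHS]mulAl -h2 mulrA e -!mulrA ga.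
move/eqP; rewrite scaler_eq0 (negPf vw) /= => /eqP a0.
by move: ua; rewrite a0 unitr0.
Qed.

Lemma twisted_dot a v w v' w' : a \is a GRing.unit ->
  a * cl_vec v = cl_vec w * cl_grade a -> a * cl_vec v' = cl_vec w' * cl_grade a ->
  dot v v' = dot w w'.
Proof.
move=> ua e e'; have es : a * cl_vec (v + v') = cl_vec (w + w') * cl_grade a.
  by rewrite !cl_vecD mulrDr mulrDl e e'.
have := twisted_norm ua es; have := twisted_norm ua e; have := twisted_norm ua e'.
rewrite !(dotDl, dotDr) (dotC v' v) (dotC w' w) => -> -> h.
have h2 : dot v v' + dot v v' = dot w w' + dot w w'.
  move: h; move: (dot w w) (dot w' w') (dot v v') (dot w w') => p q s t h; lra.
by move: h2; move: (dot v v') (dot w w') => s t h2; lra.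
Qed.

Lemma twisted_preserves_vecM a x : x != 0 -> twisted_preserves a ->
  twisted_preserves (cl_vec x * a).
Proof.
move=> x0 [ua pa]; split; first by rewrite unitrMl ?cl_vec_unit.
move=> v; have [w e] := pa v.
(* The reflection of [w] in the hyperplane orthogonal to [x]. *)
exists (w - (2 * dot x w / dot x x) *: x).
rewrite cl_gradeM cl_grade_vec -mulrA e !mulrA; congr (_ * _).
rewrite mulrN cl_vecB cl_vecZ mulrBl -scalerAl cl_vec_sqr cl_vec_anticomm opprB.
congr (_ - _); rewrite scalerN scalerA -scaleNr; congr (_ *: _).
by field; rewrite gt_eqF ?dot_gt0.
Qed.

(** The basis vectors are fixed one at a time. If the isometry sends the next one, [e_j], to [w]
    different from it, the reflection in [w - e_j] takes [w] back to [e_j]; it keeps the earlier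
    basis vectors, which are orthogonal to both [w] and [e_j]. *)
Lemma cartan_dieudonne_step a : twisted_preserves a -> forall m, (m <= n)%N ->
  exists2 g, clifford_group g & twisted_preserves (g * a) /\
    forall i : 'I_n, (i < m)%N -> g * a * cl_vec (delta_mx 0 i) =
      cl_vec (delta_mx 0 i) * cl_grade (g * a).
Proof.
move=> pa; elim=> [_|m IH mn].
  by exists 1; [exact: clifford_group1|rewrite mul1r].
have [g Gg [[ub pb] fb]] := IH (ltnW mn); set b := g * a in ub pb fb.
pose j : 'I_n := Ordinal mn; pose e i : 'rV[R]_n := delta_mx 0 i.
have [w ew] := pb (e j); have ndelta i : dot (e i) (e i) = 1 by rewrite dot_delta mxE !eqxx.
have ww : dot w w = 1 by rewrite -(twisted_norm ub ew) ndelta.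
have lt_m (i : 'I_n) : (i < m.+1)%N -> (i < m)%N \/ i = j.
  by rewrite ltnS leq_eqVlt => /predU1P[h|]; [right; apply: val_inj|left].
have [wj|wj] := eqVneq w (e j).
  exists g => //; split; first by split.
  by move=> i /lt_m[/fb//|->]; rewrite -/b ew wj.
have x0 : w - e j != 0 by rewrite subr_eq0.
exists (cl_vec (w - e j) * g).
  by apply: clifford_groupM => //; exact: clifford_group_vec.
rewrite -mulrA -/b; split; first by apply: twisted_preserves_vecM.
move=> i /lt_m[im|->].
  have orth : dot (w - e j) (e i) = 0.
    have ij : (i == j) = false by apply/negbTE; apply: contraTneq im => ->; rewrite ltnn.
    rewrite dotDl dotNl (dotC w) -(twisted_dot ub (fb i im) ew) !dot_delta !mxE ij.
    by rewrite [j == i]eq_sym ij andbF subrr.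
  rewrite -mulrA (fb i im) cl_gradeM cl_grade_vec mulrA mulrA; congr (_ * _).
  by rewrite cl_vec_anticomm orth mulr0 scale0r sub0r mulrN.
rewrite -mulrA ew cl_gradeM cl_grade_vec !mulrA; congr (_ * _).
by rewrite cl_vecB mulrBl mulrN mulrBr !cl_vec_sqr ww ndelta opprB addrC.
Qed.

(** Once all basis vectors are fixed, what remains of [a] acts trivially, hence is a real scalar by
    [twisted_center]. *)
Lemma cartan_dieudonne (i0 : 'I_n) a : twisted_preserves a -> clifford_group a.
Proof.
move=> pa; have [g Gg [[uh _] fh]] := cartan_dieudonne_step pa (leqnn n).
set h := g * a in uh fh.
have cent v : h * cl_vec v = cl_vec v * cl_grade h.
  rewrite /cl_vec mulr_sumr mulr_suml; apply: eq_bigr => i _.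
  by rewrite -cl_vec_delta -scalerAr -scalerAl fh.
have [k hk] : is_real (cl_grade h).
  by apply: twisted_center => v; rewrite cl_gradeK cent.
have {}hk : h = k%:A by rewrite -[h]cl_gradeK hk cl_gradeZ cl_grade1.
have k0 : k != 0 by apply: contraTneq uh => k0; rewrite hk k0 scale0r unitr0.
have -> : a = g^-1 * h by rewrite /h mulKr // clifford_group_unit.
by rewrite hk; apply: clifford_groupM; [exact: clifford_groupV|exact: clifford_group_scale].
Qed.

End CartanDieudonne.

(** * Vahlen's conditions on the entries of a frame *)

Section Vahlen.
Variables (R : realType) (n : nat).
Local Notation Cl := (clifford R n).
Implicit Types (a b c d x y : Cl) (v w : 'rV[R]_n) (k e : R).
Local Notation "a ^t" := (cl_tr a) (at level 8, format "a ^t").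

(* Conditions on a matrix F = ((a, b), (c, d)) of homogeneous entries, in terms of the space V
   of the matrices ((v, s), (t, - v)) with v a vector and s, t real: F preserves V under
   X |-> F X F^-1. *)
Definition vahlen_frame e a b c d :=
  [/\ e * e = 1,
      [/\ cl_grade a = e *: a, cl_grade b = - e *: b, cl_grade c = - e *: c &
          cl_grade d = e *: d],
      [/\ a * d^t - b * c^t = 1, a * b^t = b * a^t & c * d^t = d * c^t],
      [/\ is_real (a * a^t), is_real (b * b^t), is_real (c * c^t) & is_real (d * d^t)] &
      [/\ is_vector (a * c^t), is_vector (b * d^t),
          forall v, is_vector (a * cl_vec v * d^t + b * cl_vec v * c^t),
          forall v, is_real (a * cl_vec v * b^t + b * cl_vec v * a^t) &
          forall v, is_real (c * cl_vec v * d^t + d * cl_vec v * c^t)]].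

(** Multiplication by a quarter turn on the right, and on the left in [vahlen_frame_rowswap], moves
    any entry to the place of [a], so that only that entry has to be studied. *)
Lemma vahlen_frame_colswap e a b c d : vahlen_frame e a b c d -> vahlen_frame (- e) b (- a) d (- c).
Proof.
move=> [ee [ga gb gc gd] [h1 h2 h3] [ra rb rc rd] [vac vbd vv rab rcd]].
have gN x k : cl_grade x = k *: x -> cl_grade (- x) = k *: - x.
  by move=> h; rewrite -scaleN1r cl_gradeZ h !scalerA mulrC.
split.
- by rewrite mulrNN.
- by rewrite opprK; split=> //; exact: gN.
- by rewrite !cl_trN !mulrN !mulNr opprK addrC h1 h2 h3.
- by rewrite !cl_trN !mulrN !mulNr !opprK.
- split; rewrite ?cl_trN ?mulrN ?mulNr ?opprK // => v; rewrite mulrN !mulNr -opprD addrC.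
  + exact: is_vectorN.
  + exact: is_realN.
  + exact: is_realN.
Qed.

Lemma vahlen_frame_rowswap e a b c d : vahlen_frame e a b c d -> vahlen_frame (- e) c d (- a) (- b).
Proof.
move=> [ee [ga gb gc gd] [h1 h2 h3] [ra rb rc rd] [vac vbd vv rab rcd]].
have gN x k : cl_grade x = k *: x -> cl_grade (- x) = k *: - x.
  by move=> h; rewrite -scaleN1r cl_gradeZ h !scalerA mulrC.
have trtr x y : y * x^t = (x * y^t)^t by rewrite cl_trM cl_trK.
split.
- by rewrite mulrNN.
- by rewrite opprK; split=> //; exact: gN.
- rewrite !cl_trN !mulrN !mulNr !opprK h2 h3; split=> //.
  by rewrite addrC (trtr a d) (trtr b c) -cl_trN -cl_trD h1 cl_tr1.
- by rewrite !cl_trN !mulrN !mulNr !opprK.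
- split=> [||v|//|v].
  + by rewrite cl_trN mulrN (trtr a c); apply/is_vectorN/is_vector_tr.
  + by rewrite cl_trN mulrN (trtr b d); apply/is_vectorN/is_vector_tr.
  + rewrite !cl_trN !mulrN -opprD; apply: is_vectorN; rewrite addrC.
    by have := is_vector_tr (vv v); rewrite cl_trD !cl_trM !cl_trK cl_tr_vec !mulrA.
  + by rewrite !cl_trN !mulrN !mulNr !opprK.
Qed.

(** If the real number [a a^t] is zero then so is [a], by positivity of [a] times its conjugate.
    Otherwise [a] is invertible, [u = a^-1 b] is odd with real anticommutators, hence a vector, and
    [w = c a^-1] is a vector. They absorb [b] and [c] in the condition on [a v d^t + b v c^t] and
    leave that [a v a^-1] is a vector, to which the Cartan-Dieudonne theorem applies. *)
Lemma vahlen_frame_entry (i0 : 'I_n) e a b c d : vahlen_frame e a b c d ->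
  (a = 0 \/ clifford_group a) /\ is_vector (a^t * b).
Proof.
move=> [ee [ga gb gc gd] [h1 h2 h3] [[la ra] rb rc rd] [vac vbd vv rab rcd]].
have [->|a0] := eqVneq a 0; first by split; [left|rewrite cl_tr0 mul0r; exact: is_vector0].
have la0 : la != 0.
  apply: contra_neq a0 => la0; apply: cl_mul_conj_eq0.
  by rewrite cl_grade_tr ga cl_trZ -scalerAr ra la0 scale0r scaler0.
pose ai := la^-1 *: a^t.
have aai : a * ai = 1 by rewrite /ai -scalerAr ra scalerA mulVf // scale1r.
have aia : ai * a = 1 by exact: falg_mulVr.
have ta : a^t * a = la%:A.
  by rewrite -[a^t](scale1r) -(mulfV la0) -scalerA -/ai -scalerAl aia.
have tai : a^t = la *: ai by rewrite /ai scalerA mulfV // scale1r.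
have ua := unit_of_mul aai.
pose u := ai * b; have bE : b = a * u by rewrite /u mulrA aai mul1r.
have tu : u^t = u.
  apply: (mulrI ua); apply/eqP; rewrite -subr_eq0; apply/eqP.
  suff : (a * u^t - a * u) * a^t = 0.
    move=> h; have := congr1 (fun z => z * a) h; rewrite mul0r -mulrA ta mulAr => /eqP.
    by rewrite scaler_eq0 (negPf la0) => /eqP.
  by rewrite mulrBl -bE -h2 bE cl_trM mulrA subrr.
have gu : cl_grade u = - u.
  rewrite /u /ai cl_gradeM gb cl_gradeZ cl_grade_tr ga cl_trZ.
  rewrite -scalerAr -!scalerAl !scalerA -scaleNr; congr (_ *: _).
  have /(congr1 (fun z => - z * la^-1)) := ee; rewrite mulN1r => <-; ring.
have cu v : exists k, u * cl_vec v + cl_vec v * u = k%:A.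
  have [k hk] := rab v; exists (k / la).
  have e1 : a * (u * cl_vec v + cl_vec v * u) * a^t = k%:A.
    by rewrite -hk bE cl_trM tu mulrDr mulrDl !mulrA addrC.
  have e2 := congr1 (fun z => ai * z * a) e1.
  have e3 : ai * (a * (u * cl_vec v + cl_vec v * u) * a^t) * a =
     la *: (u * cl_vec v + cl_vec v * u).
    by rewrite -(mulrA a) (mulrA ai) aia mul1r -mulrA ta mulAr.
  have e4 : ai * k%:A * a = k%:A by rewrite mulAr -scalerAl aia.
  rewrite e3 e4 in e2.
  by apply: (scalerI la0); rewrite e2 scalerA mulrCA mulfV // mulr1.
have [u' uE] : is_vector u.
  by apply: odd_vector => // v; rewrite addrC; exact: cu.
split; last first.
  by exists (la *: u'); rewrite cl_vecZ -uE bE mulrA ta mulAl.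
right; apply: (cartan_dieudonne i0); split=> // v.
pose w := la^-1 *: (c * a^t).
have wa : w * a = c by rewrite /w -scalerAl -mulrA ta mulAr scalerA mulVf // scale1r.
have [w' wE] : is_vector w.
  by apply: is_vectorZ; have := is_vector_tr vac; rewrite cl_trM cl_trK.
have tw : w^t = w by rewrite wE cl_tr_vec.
have tc : c^t = a^t * w by rewrite -wa cl_trM tw.
have td : d^t = ai * (1 + a * u * c^t).
  by rewrite -bE -h1 subrK mulrA aia mul1r.
have [k hk] := cu v.
have [x xE] : is_vector (a * cl_vec v * ai).
  (* Insert [d^t = a^-1 (1 + b c^t)], [b = a u] and [c^t = a^t w]: the surplus is
     [a (v u + u v) a^t w], a real multiple of [w] since the anticommutator is the scalar [k]. *)
  have -> : a * cl_vec v * ai = (a * cl_vec v * d^t + b * cl_vec v * c^t) - (k * la) *: w.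
    rewrite td bE tc; apply/esym/eqP; rewrite subr_eq; apply/eqP.
    rewrite mulrDr mulr1 mulrDr -addrA; congr (_ + _).
    have -> : a * cl_vec v * (ai * (a * u * (a^t * w))) = a * (cl_vec v * u) * a^t * w.
      by rewrite !mulrA -[a * _ * ai * a]mulrA aia mulr1.
    have -> : a * u * cl_vec v * (a^t * w) = a * (u * cl_vec v) * a^t * w by rewrite !mulrA.
    rewrite -!mulrDl -mulrDr [cl_vec v * u + _]addrC hk mulAr -!scalerAl.
    by rewrite ra mulAl scalerA.
  by apply: is_vectorD => //; rewrite -scaleNr; apply: is_vectorZ; exists w'.
exists (e *: x); rewrite ga cl_vecZ -scalerAl -scalerAr scalerA ee scale1r -xE.
by rewrite -(mulrA (a * cl_vec v)) aia mulr1.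
Qed.

Lemma vahlen_frame_SL (i0 : 'I_n) e a b c d : vahlen_frame e a b c d -> SL_Gamma (mx2 a b c d).
Proof.
move=> h; have [ha vab] := vahlen_frame_entry i0 h.
have [hb _] := vahlen_frame_entry i0 (vahlen_frame_colswap h).
have hr := vahlen_frame_rowswap h.
have [hc vcd] := vahlen_frame_entry i0 hr.
have [hd _] := vahlen_frame_entry i0 (vahlen_frame_colswap hr).
have [_ _ [h1 _ _] _ [vac vbd _ _ _]] := h.
split=> /=; rewrite ?mxE //=.
by move=> i j; rewrite mxE; case: (i == 0); case: (j == 0).
Qed.

End Vahlen.

(** * Clifford-valued frames *)

Section CliffordCalculus.
Variables (R : realType) (n : nat).
Local Notation C := (R[i]^o).
Local Notation Cl := (clifford R n).
Implicit Types (a b : C -> Cl) (z v : C) (D : set C) (S T : {set 'I_n}).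

Definition is_pdcl v a z (d : Cl) := forall S, is_pd v (fun x => cl_coef (a x) S) z (cl_coef d S).

Lemma is_pdcl_val v a z d : is_pdcl v a z d -> pd_cl v a z = d.
Proof. by move=> h; apply/clP => S; rewrite cl_makeE; exact: is_pd_val. Qed.

Lemma is_pdcl_eq v a z d d' : is_pdcl v a z d -> d = d' -> is_pdcl v a z d'.
Proof. by move=> h <-. Qed.

Lemma is_pdcl_cst v (d : Cl) z : is_pdcl v (fun=> d) z 0.
Proof. by move=> S; rewrite cl_coef0; exact: is_pd_cst. Qed.

Lemma is_pdcl_add v a b z d e : is_pdcl v a z d -> is_pdcl v b z e ->
  is_pdcl v (fun x => a x + b x) z (d + e).
Proof.
move=> ha hb S; rewrite cl_coefD; under [X in is_pd _ X]funext do rewrite cl_coefD.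
exact: is_pd_add.
Qed.

Lemma is_pdcl_scale v (k : R) a z d : is_pdcl v a z d ->
  is_pdcl v (fun x => k *: a x) z (k *: d).
Proof.
move=> ha S; rewrite cl_coefZ; under [X in is_pd _ X]funext do rewrite cl_coefZ.
exact: is_pd_scale.
Qed.

Lemma is_pdcl_sub v a b z d e : is_pdcl v a z d -> is_pdcl v b z e ->
  is_pdcl v (fun x => a x - b x) z (d - e).
Proof.
move=> ha hb S; rewrite cl_coefB; under [X in is_pd _ X]funext do rewrite cl_coefB.
exact: is_pd_sub.
Qed.

Lemma is_pdcl_mul v a b z d e : is_pdcl v a z d -> is_pdcl v b z e ->
  is_pdcl v (fun x => a x * b x) z (d * b z + a z * e).
Proof.
move=> ha hb S; under [X in is_pd _ X]funext do rewrite cl_coefM.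
rewrite cl_coefD !cl_coefM -big_split /=.
apply: is_pd_sum => T; under [X in is_pd _ X]funext do rewrite -mulrA.
have := is_pd_scale ((-1) ^+ cl_exp T (symdiff T S)) (is_pd_mul (ha T) (hb (symdiff T S))).
by move/is_pd_eq; apply; ring.
Qed.

Lemma is_pdcl_tr v a z d : is_pdcl v a z d -> is_pdcl v (fun x => cl_tr (a x)) z (cl_tr d).
Proof.
move=> ha S; rewrite cl_coef_tr; under [X in is_pd _ X]funext do rewrite cl_coef_tr.
exact: is_pd_scale.
Qed.

Lemma is_pdcl_grade v a z d : is_pdcl v a z d ->
  is_pdcl v (fun x => cl_grade (a x)) z (cl_grade d).
Proof.
move=> ha S; rewrite cl_coef_grade; under [X in is_pd _ X]funext do rewrite cl_coef_grade.
exact: is_pd_scale.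
Qed.

Lemma cl_coef_vecE (w : 'rV[R]_n) S :
  cl_coef (cl_vec w) S = \sum_j w 0 j * (S == [set j]%SET)%:R.
Proof. by rewrite /cl_vec cl_coef_sum; apply: eq_bigr => j _; rewrite cl_coefZ cl_coef_base. Qed.

Lemma is_pdcl_vec v (f : C -> 'rV[R]_n) z (d : 'rV[R]_n) :
  (forall j, is_pd v (fun x => f x 0 j) z (d 0 j)) ->
  is_pdcl v (fun x => cl_vec (f x)) z (cl_vec d).
Proof.
move=> hf S; under [X in is_pd _ X]funext do rewrite cl_coef_vecE.
rewrite cl_coef_vecE; apply: is_pd_sum => j.
under [X in is_pd _ X]funext do rewrite mulrC.
by rewrite mulrC; exact: is_pd_scale.
Qed.

Lemma is_pdcl_near v a b z d : (\forall x \near z, a x = b x) -> is_pdcl v a z d -> is_pdcl v b z d.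
Proof.
by move=> ab ha S; apply: is_pd_near (ha S); apply: filterS ab => x ->.
Qed.

Definition class_cl k D a := forall S, class_C k D (fun x => cl_coef (a x) S).

Lemma class_cl_mul k D a b : open D -> class_cl k D a -> class_cl k D b ->
  class_cl k D (fun x => a x * b x).
Proof.
move=> oD ha hb S; under [X in class_C _ _ X]funext do rewrite cl_coefM.
apply: class_C_sum => // T; under [X in class_C _ _ X]funext do rewrite -mulrA.
by apply: class_C_scale => //; apply: class_C_mul.
Qed.

Lemma class_cl_scale k D (r : R) a : open D -> class_cl k D a -> class_cl k D (fun x => r *: a x).
Proof.
move=> oD ha S; under [X in class_C _ _ X]funext do rewrite cl_coefZ.
exact: class_C_scale.
Qed.

Lemma class_cl_add k D a b : open D -> class_cl k D a -> class_cl k D b ->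
  class_cl k D (fun x => a x + b x).
Proof.
move=> oD ha hb S; under [X in class_C _ _ X]funext do rewrite cl_coefD.
exact: class_C_add.
Qed.

Lemma class_cl_tr k D a : open D -> class_cl k D a -> class_cl k D (fun x => cl_tr (a x)).
Proof.
move=> oD ha S; under [X in class_C _ _ X]funext do rewrite cl_coef_tr.
exact: class_C_scale.
Qed.

Lemma class_cl_grade k D a : open D -> class_cl k D a -> class_cl k D (fun x => cl_grade (a x)).
Proof.
move=> oD ha S; under [X in class_C _ _ X]funext do rewrite cl_coef_grade.
exact: class_C_scale.
Qed.

Lemma class_cl_cst k D (d : Cl) : class_cl k D (fun=> d).
Proof. by move=> S; exact: class_C_cst. Qed.

Lemma class_cl_vec k D (f : C -> 'rV[R]_n) : open D ->
  (forall j, class_C k D (fun x => f x 0 j)) -> class_cl k D (fun x => cl_vec (f x)).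
Proof.
move=> oD hf S; under [X in class_C _ _ X]funext do rewrite cl_coef_vecE.
apply: class_C_sum => // j; under [X in class_C _ _ X]funext do rewrite mulrC.
exact: class_C_scale.
Qed.

Lemma cl_coef_mul_base (x y : Cl) S :
  cl_coef (x * y) S = \sum_T cl_coef x T * cl_coef (cl_base R T * y) S.
Proof.
have {1}-> : x = \sum_T cl_coef x T *: cl_base R T.
  apply/clP => T; rewrite cl_coef_sum (bigD1 T) //= cl_coefZ cl_coef_base eqxx mulr1.
  rewrite big1 ?addr0 // => U /negPf UT.
  by rewrite cl_coefZ cl_coef_base eq_sym UT mulr0.
rewrite mulr_suml cl_coef_sum; apply: eq_bigr => T _.
by rewrite -scalerAl cl_coefZ.
Qed.

End CliffordCalculus.

(** * Uniqueness for linear systems on the surface *)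

Section LinearUniqueness.
Variables (R : realType) (M : riemannSurface R).
Local Notation C := (R[i]^o).

Lemma linear_system_unique (J : finType) (B : chart R M -> C -> J -> J -> C -> R)
    (y : J -> M -> R) (p0 : M) :
  (forall c v i j z, rs_atlas c -> dir v -> chart_img c z -> {for z, continuous (B c v i j)}) ->
  (forall j, smooth_on setT (y j)) ->
  (forall c z v j, rs_atlas c -> chart_img c z -> dir v ->
     is_pd v (y j \o chart_inv c) z (\sum_i y i (chart_inv c z) * B c v i j z)) ->
  (forall j, y j p0 = 0) -> forall p j, y j p = 0.
Proof.
move=> cB sy dy; apply: surface_unique => // c z0 ac cz0.
pose S := \sum_i \sum_j (`|B c 1 i j z0| + `|B c 'i i j z0|).
have hS i j : `|B c 1 i j z0| + `|B c 'i i j z0| <= S.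
  by apply: (double_sum_ge (F := fun i j => `|B c 1 i j z0| + `|B c 'i i j z0|)) => ? ?; rewrite addr_ge0.
have bound v : dir v -> \forall z \near z0, forall ij : J * J, `|B c v ij.1 ij.2 z| <= S + 1.
  move=> hv; apply: (@filter_forall _ _ (fun (ij : J * J) z => `|B c v ij.1 ij.2 z| <= S + 1) (nbhs z0)).
  move=> [i j] /=; apply: filterS (continuous_bounded (cB c v i j z0 ac hv cz0)) => z h.
  apply: le_trans h _; rewrite lerD2r; apply: le_trans (hS i j).
  by case: hv => ->; rewrite ?lerDl ?lerDr.
clearbody S.
exists (S + 1).
have d1 : dir (1 : C) by left.
have di : dir ('i : C) by right.
have hD : \forall z \near z0, chart_img c z by exact: open_near (@chart_img_open _ _ c) cz0 _.
near=> z; move=> v j hv.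
have b1 : forall ij : J * J, `|B c 1 ij.1 ij.2 z| <= S + 1 by near: z; exact: bound.
have b2 : forall ij : J * J, `|B c 'i ij.1 ij.2 z| <= S + 1 by near: z; exact: bound.
have iz : chart_img c z by near: z; exact: hD.
rewrite (is_pd_val (dy c z v j ac iz hv)); apply: le_trans (ler_norm_sum _ _ _) _.
rewrite mulr_sumr; apply: ler_sum => i _; rewrite normrM mulrC ler_wpM2r //.
by case: hv => ->; [exact: (b1 (i, j))|exact: (b2 (i, j))].
Unshelve. all: by end_near. Qed.

Lemma zero_pd_constant (u : M -> R) (p0 : M) :
  (forall c z v, rs_atlas c -> chart_img c z -> dir v -> is_pd v (u \o chart_inv c) z 0) ->
  forall p, u p = u p0.
Proof.
move=> du p; apply: (locally_constant openT (@rs_connected _ M)) => // x _.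
by apply: (@zero_pd_locally_constant _ _ u setT x openT) => // c z v ac iz _ hv; exact: du.
Qed.

End LinearUniqueness.

Lemma sum_enum_val (R : realType) (J : finType) (F : J -> R) :
  \sum_(i < #|J|) F (enum_val i) = \sum_j F j.
Proof. by rewrite [RHS](reindex (@enum_val J predT)) //=; exact/onW_bij/enum_val_bij. Qed.

Lemma sum_option (R : realType) (I : finType) (F : option I -> R) :
  \sum_k F k = F None + \sum_i F (Some i).
Proof.
rewrite (bigD1 None) //=; congr (_ + _).
rewrite (reindex_omap Some id) => [|[i|]//]; apply: eq_bigl => i.
by rewrite eqxx.
Qed.

(** * The linear system satisfied by a row of the frame *)

Section Rows.
Variables (R : realType) (n : nat) (M : riemannSurface R).
Local Notation C := (R[i]^o).
Local Notation Cl := (clifford R n).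
Local Notation Re := (@complex.Re R).
Local Notation Im := (@complex.Im R).
Implicit Types (c : chart R M) (z v : C) (S T U : {set 'I_n}) (g : M -> 'rV[R]_n).

Definition d_cl (g : M -> 'rV[R]_n) c v z : Cl := cl_vec (pd_vec v (g \o chart_inv c) z).

Lemma d_cl_tr g c v z : cl_tr (d_cl g c v z) = d_cl g c v z.
Proof. exact: cl_tr_vec. Qed.

Lemma d_cl_smooth g c v k : smooth_vec_on setT g -> rs_atlas c -> dir v ->
  class_cl k (chart_img c) (d_cl g c v).
Proof.
move=> sg ac hv; apply: class_cl_vec; first exact: chart_img_open.
move=> j; under [X in class_C _ _ X]funext do rewrite mxE.
by apply: class_CS_pd => //; have := sg j c ac k.+1; rewrite preimage_setT setIT.
Qed.

Lemma pd_vec_transition g c c' z v : smooth_vec_on setT g -> rs_atlas c -> rs_atlas c' ->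
  overlap c c' z -> dir v -> let tau := transition c c' in
  pd_vec v (g \o chart_inv c) z =
    Re (derive1 tau z * v) *: pd_vec 1 (g \o chart_inv c') (tau z) +
    Im (derive1 tau z * v) *: pd_vec 'i (g \o chart_inv c') (tau z).
Proof.
move=> sg ac ac' [iz dz] hv tau; apply/rowP => j; rewrite !mxE.
apply: is_pd_val; apply: (@pd_transition _ _ c c' (fun p => g p 0 j) setT) => //.
- exact: openT.
- exact: sg.
Qed.

Lemma d_cl_closed g c z : smooth_vec_on setT g -> rs_atlas c -> chart_img c z ->
  exists d, is_pdcl 'i (d_cl g c 1) z d /\ is_pdcl 1 (d_cl g c 'i) z d.
Proof.
move=> sg ac iz; have oD := @chart_img_open _ _ c.
have sj j k : class_C k (chart_img c) (fun x => (g \o chart_inv c) x 0 j).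
  by have := sg j c ac k; rewrite preimage_setT setIT.
have d1 : dir (1 : C) by left.
have di : dir ('i : C) by right.
exists (cl_vec (\row_j pd 'i (pd 1 (fun x => (g \o chart_inv c) x 0 j)) z)); split.
  apply: is_pdcl_vec => j; rewrite mxE; under [X in is_pd _ X]funext do rewrite mxE.
  exact: class_CS_is_pd di (class_CS_pd d1 (sj j 2%N)) iz.
apply: is_pdcl_vec => j; rewrite mxE; under [X in is_pd _ X]funext do rewrite mxE.
rewrite (mixed_partials oD (sj j 2%N) iz).
exact: class_CS_is_pd d1 (class_CS_pd di (sj j 2%N)) iz.
Qed.

Variables (f fc : M -> 'rV[R]_n) (r : R).
Hypothesis sf : smooth_vec_on setT f.
Hypothesis sfc : smooth_vec_on setT fc.
Hypothesis wedge : forall c z, rs_atlas c -> chart_img c z ->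
  d_cl f c 1 z * d_cl fc c 'i z = d_cl f c 'i z * d_cl fc c 1 z.

Lemma wedge_tr c z : rs_atlas c -> chart_img c z ->
  d_cl fc c 1 z * d_cl f c 'i z = d_cl fc c 'i z * d_cl f c 1 z.
Proof.
move=> ac iz; have e := congr1 (@cl_tr R n) (wedge ac iz).
by rewrite -[RHS]cl_trK cl_trM !d_cl_tr e cl_trM !d_cl_tr.
Qed.

(** The equation of a frame acts on its rows separately; this is the one of a single row
    [(a, b)]. *)
Definition row_solution (a b : M -> Cl) :=
  [/\ forall S, smooth_on setT (fun p => cl_coef (a p) S),
      forall S, smooth_on setT (fun p => cl_coef (b p) S) &
      forall c z v, rs_atlas c -> chart_img c z -> dir v ->
        is_pdcl v (a \o chart_inv c) z (r *: (b (chart_inv c z) * d_cl fc c v z)) /\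
        is_pdcl v (b \o chart_inv c) z (a (chart_inv c z) * d_cl f c v z)].

(* The index (false, S) stands for the coordinate at e_S of the first entry of a row, the index
   (true, S) for that of the second entry. *)
Local Notation J := (bool * {set 'I_n})%type.

Definition row_factor c v (g : bool) z : Cl := if g then d_cl f c v z else r *: d_cl fc c v z.

(** The real matrix of right multiplication by the off-diagonal connection matrix, which exchanges
    the two entries of a row; hence the zero blocks where the flags agree. *)
Definition row_form c v (k j : J) z : R :=
  if k.1 == j.1 then 0 else cl_coef (cl_base R k.2 * row_factor c v j.1 z) j.2.

Lemma row_factor_smooth c v (h : bool) k : rs_atlas c -> dir v -> class_cl k (chart_img c) (row_factor c v h).
Proof.
move=> ac hv; rewrite /row_factor; case: h; first exact: d_cl_smooth.
by apply: class_cl_scale; [exact: chart_img_open|exact: d_cl_smooth].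
Qed.

Lemma row_form_smooth c v i j k : rs_atlas c -> dir v -> class_C k (chart_img c) (row_form c v i j).
Proof.
move=> ac hv; rewrite /row_form; case: (i.1 == j.1); first exact: class_C_cst.
have := class_cl_mul (@chart_img_open _ _ c) (@class_cl_cst _ _ k (chart_img c) (cl_base R i.2))
  (row_factor_smooth j.1 k ac hv).
exact.
Qed.

Lemma row_sum c v (Y : bool -> Cl) (j : J) z :
  \sum_(i : J) cl_coef (Y i.1) i.2 * row_form c v i j z =
  cl_coef (Y (~~ j.1) * row_factor c v j.1 z) j.2.
Proof.
pose F (g : bool) T := cl_coef (Y g) T * row_form c v (g, T) j z.
transitivity (\sum_(i : J) F i.1 i.2).
  apply: eq_bigr => i _.
  by case: i.
rewrite -(pair_bigA _ F) /=.
rewrite /F {F}.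
rewrite big_bool [RHS]cl_coef_mul_base; case: j => g S; rewrite /row_form /=.
case: g => /=; [rewrite big1 ?add0r // => T _|rewrite [X in _ + X]big1 ?addr0 // => T _];
  by rewrite mulr0.
Qed.

Lemma row_form_sum c v w (k j : J) z : 
  \sum_(l : J) row_form c w k l z * row_form c v l j z =
  if k.1 == j.1 then cl_coef (cl_base R k.2 * row_factor c w (~~ j.1) z * row_factor c v j.1 z) j.2
  else 0.
Proof.
pose Y (g : bool) := if k.1 == g then 0 else cl_base R k.2 * row_factor c w g z.
have YE l : row_form c w k l z = cl_coef (Y l.1) l.2.
  by rewrite /row_form /Y; case: ifP; rewrite ?cl_coef0.
under eq_bigr do rewrite YE.
rewrite row_sum /Y; case: (k) (j) => [[] T] [[] S] //=; by rewrite mul0r cl_coef0.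
Qed.

(** The derivative terms agree because [df] and [df^c] are closed. The quadratic terms are left
    products with [df ^ df^c] in one diagonal block and with its transpose [df^c ^ df] in the other,
    so [wedge] and [wedge_tr] settle them. *)
Lemma row_form_flat c k j z : rs_atlas c -> chart_img c z ->
  pd 'i (row_form c 1 k j) z + \sum_l row_form c 'i k l z * row_form c 1 l j z =
  pd 1 (row_form c 'i k j) z + \sum_l row_form c 1 k l z * row_form c 'i l j z.
Proof.
move=> ac iz; rewrite [X in _ + X = _]row_form_sum [X in _ = _ + X]row_form_sum.
have pdE : pd 'i (row_form c 1 k j) z = pd 1 (row_form c 'i k j) z.
  have [d [h1 h2]] : exists d, is_pdcl 'i (row_factor c 1 j.1) z d /\
      is_pdcl 1 (row_factor c 'i j.1) z d.
    rewrite /row_factor; case: (j.1); first exact: d_cl_closed.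
    have [d [h1 h2]] := d_cl_closed sfc ac iz.
    by exists (r *: d); split; exact: is_pdcl_scale.
  rewrite /row_form; case: (k.1 == j.1).
    exact: etrans (is_pd_val (is_pd_cst _ _ _)) (esym (is_pd_val (is_pd_cst _ _ _))).
  have e1 := is_pdcl_mul (is_pdcl_cst 'i (cl_base R k.2) z) h1 j.2.
  have e2 := is_pdcl_mul (is_pdcl_cst 1 (cl_base R k.2) z) h2 j.2.
  by apply: etrans (is_pd_val e1) (etrans _ (esym (is_pd_val e2))); rewrite !mul0r.
rewrite pdE.
move: (pd 1 _ z) => P.
case: (k.1 == j.1); last by [].
apply: (congr1 (fun a => P + cl_coef a j.2)).
apply: etrans (esym (mulrA _ _ _)) (etrans _ (mulrA _ _ _)).
apply: (congr1 (fun a => cl_base R k.2 * a)); rewrite /row_factor; case: (j.1).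
  apply: etrans (esym (scalerAl _ _ _)) (etrans _ (scalerAl _ _ _)).
  exact: (congr1 (fun a => r *: a) (esym (wedge_tr ac iz))).
apply: etrans (esym (scalerAr _ _ _)) (etrans _ (scalerAr _ _ _)).
exact: (congr1 (fun a => r *: a) (esym (wedge ac iz))).
Qed.

Lemma row_form_transition c c' z v i j : rs_atlas c -> rs_atlas c' ->
  overlap c c' z -> dir v -> let tau := transition c c' in
  row_form c v i j z = Re (derive1 tau z * v) * row_form c' 1 i j (tau z) +
                       Im (derive1 tau z * v) * row_form c' 'i i j (tau z).
Proof.
move=> ac ac' oz hv tau; rewrite /row_form; case: (i.1 == j.1); first by rewrite !mulr0 addr0.
rewrite -!cl_coefZ -cl_coefD !scalerAr -mulrDr /row_factor /d_cl; congr (cl_coef (_ * _) _).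
case: (j.1).
  by rewrite (pd_vec_transition sf ac ac' oz hv) cl_vecD !cl_vecZ.
rewrite (pd_vec_transition sfc ac ac' oz hv) cl_vecD !cl_vecZ scalerDr.
by rewrite !scalerA ![r * _]mulrC.
Qed.

Lemma row_solution_exists (p0 : M) (a0 b0 : Cl) : simply_connected R M ->
  exists a b, [/\ row_solution a b, a p0 = a0 & b p0 = b0].
Proof.
move=> scM; pose A : mx_form M #|{: J}| := fun c v i j => row_form c v (enum_val i) (enum_val j).
have sA : form_smooth A by move=> c ac k v i j hv; exact: row_form_smooth.
have tA : form_transition A.
  by move=> c c' z v i j ac ac' oz hv; exact: row_form_transition.
have fA : form_flat A.
  move=> c z k j ac iz.
  have s v w : \sum_l A c v k l z * A c w l j z =
      \sum_l row_form c v (enum_val k) l z * row_form c w l (enum_val j) z :=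
    sum_enum_val (fun l => row_form c v (enum_val k) l z * row_form c w l (enum_val j) z).
  exact: (etrans (congr2 +%R erefl (s 'i 1)) (etrans (row_form_flat (enum_val k) (enum_val j) ac iz)
    (congr2 +%R erefl (esym (s 1 'i))))).
have [y [y0 sy dy]] := surface_frobenius p0
  (fun i => let j := enum_val i in cl_coef (if j.1 then b0 else a0) j.2) sA tA fA scM.
pose Y (g : bool) p : Cl := cl_make (fun S => y (enum_rank (g, S)) p).
have YE (g : bool) p S : cl_coef (Y g p) S = y (enum_rank (g, S)) p by exact: cl_makeE.
have dY (g : bool) c z v : rs_atlas c -> chart_img c z -> dir v ->
    is_pdcl v (Y g \o chart_inv c) z (Y (~~ g) (chart_inv c z) * row_factor c v g z).
  move=> ac iz hv S.
  have := dy c z ac iz I v (enum_rank (g, S)) hv.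
  have -> : y (enum_rank (g, S)) \o chart_inv c = (fun x => cl_coef ((Y g \o chart_inv c) x) S).
    by apply/funext => x; rewrite YE.
  move/is_pd_eq; apply; rewrite -(row_sum c v (fun h => Y h (chart_inv c z)) (g, S) z).
  rewrite -[RHS]sum_enum_val; apply: eq_bigr => i _; rewrite /A enum_rankK YE.
  by rewrite -surjective_pairing enum_valK.
exists (Y false), (Y true); split.
- split.
  + by move=> S; under [X in smooth_on _ X]funext do rewrite YE; exact: sy.
  + by move=> S; under [X in smooth_on _ X]funext do rewrite YE; exact: sy.
  + move=> c z v ac iz hv; split; last exact: dY.
    by have := dY false c z v ac iz hv; rewrite /row_factor -scalerAr.
- by apply/clP => S; rewrite YE y0 enum_rankK.
- by apply/clP => S; rewrite YE y0 enum_rankK.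
Qed.

Lemma row_solution_unique (p0 : M) a b : row_solution a b -> a p0 = 0 -> b p0 = 0 ->
  forall p, a p = 0 /\ b p = 0.
Proof.
move=> [sa sb dab] a0 b0 p.
pose Y (p : M) (g : bool) := if g then b p else a p.
have H : forall p (j : J), cl_coef (Y p j.1) j.2 = 0.
  apply: (@linear_system_unique _ M _ row_form (fun j p => cl_coef (Y p j.1) j.2) p0).
  - move=> c v i j z ac hv iz.
    exact: class_C_continuous (@chart_img_open _ _ c) (row_form_smooth i j 0%N ac hv) z iz.
  - by move=> [[] S]; [exact: sb|exact: sa].
  - move=> c z v j ac iz hv; have [da db] := dab c z v ac iz hv.
    apply: is_pd_eq (esym (row_sum c v (Y (chart_inv c z)) j z)).
    case: j => [[] S]; first exact: db.
    by have := da S; rewrite scalerAr.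
  - by move=> [[] S] /=; rewrite ?a0 ?b0 cl_coef0.
by split; apply/clP => S; rewrite cl_coef0; [exact: (H p (false, S))|exact: (H p (true, S))].
Qed.

Local Notation "a ^t" := (cl_tr a) (at level 8, format "a ^t").

Lemma pairing_pd_corner (r' : R) (a b c d u : Cl) : u^t = u ->
  (r' *: (b * u)) * c^t + a * (r' *: (d * u))^t = r' *: (a * u * d^t + b * u * c^t).
Proof.
move=> ut; rewrite cl_trZ cl_trM ut -scalerAl -scalerAr -scalerDr addrC.
by rewrite mulrA.
Qed.

(** The Clifford relation makes [u x + x u] a scalar, so the derivative of the pairing at a constant
    vector [x] is a combination of the two corner pairings. This closes the linear system for the
    pairings. *)
Lemma pairing_pd_vec (r' k k' : R) (a b c d u u' x : Cl) : u^t = u -> u'^t = u' ->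
  u * x + x * u = k%:A -> u' * x + x * u' = k'%:A ->
  ((r' *: (b * u')) * x + a * 0) * d^t + a * x * (c * u)^t +
  ((a * u * x + b * 0) * c^t + b * x * (r' *: (d * u'))^t) =
  k *: (a * c^t) + (r' * k') *: (b * d^t).
Proof.
move=> ut ut' ux ux'; rewrite !mulr0 !addr0 cl_trZ !cl_trM ut ut' -!scalerAl -!scalerAr.
have -> : k *: (a * c^t) = a * (u * x + x * u) * c^t by rewrite ux mulAr -scalerAl.
have -> : (r' * k') *: (b * d^t) = r' *: (b * (u' * x + x * u') * d^t).
  by rewrite ux' mulAr -scalerAl scalerA.
rewrite mulrDr mulrDl [b * (_ + _)]mulrDr [(_ + _) * d^t]mulrDl scalerDr !mulrA.
by rewrite [LHS](AC (2*2) ((3*2)*(1*4))).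
Qed.

(* For rows rho = (a, b) and sigma = (c, d), the entries rho X sigma~ of F X F^-1, for X
   ranging over the Lie-algebra module V, solve a linear system, so that every linear condition
   which holds for all of them at one point holds everywhere. *)
Lemma row_pairing_vanish (p0 : M) (a b c d : M -> Cl) S : row_solution a b -> row_solution c d ->
  cl_coef (a p0 * (c p0)^t) S = 0 -> cl_coef (b p0 * (d p0)^t) S = 0 ->
  (forall v : 'rV[R]_n, cl_coef (a p0 * cl_vec v * (d p0)^t + b p0 * cl_vec v * (c p0)^t) S = 0) ->
  forall p, [/\ cl_coef (a p * (c p)^t) S = 0, cl_coef (b p * (d p)^t) S = 0 &
    forall v : 'rV[R]_n, cl_coef (a p * cl_vec v * (d p)^t + b p * cl_vec v * (c p)^t) S = 0].
Proof.
move=> [sa sb dab] [sc sd dcd] ac0 bd0 v0.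
pose T1 p (v : 'rV[R]_n) := a p * cl_vec v * (d p)^t + b p * cl_vec v * (c p)^t.
pose e i : 'rV[R]_n := delta_mx 0 i.
(* Coordinates at [e_S] of the pairings on a basis: [None] and [Some None] index the two corners,
   [Some (Some i)] the vector [e_i]. *)
pose t (k : option (option 'I_n)) p := match k with
  | None => cl_coef (a p * (c p)^t) S | Some None => cl_coef (b p * (d p)^t) S
  | Some (Some i) => cl_coef (T1 p (e i)) S end.
pose F (x : chart R M) (v z : C) : 'rV[R]_n := pd_vec v (f \o chart_inv x) z.
pose Fc (x : chart R M) (v z : C) : 'rV[R]_n := pd_vec v (fc \o chart_inv x) z.
pose B (x : chart R M) (v : C) (l k : option (option 'I_n)) (z : C) : R := match k, l with
  | None, Some (Some i) => r * Fc x v z 0 i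
  | Some None, Some (Some i) => F x v z 0 i
  | Some (Some i), None => - 2 * F x v z 0 i
  | Some (Some i), Some None => - 2 * r * Fc x v z 0 i
  | _, _ => 0 end.
have T1lin p (v : 'rV[R]_n) : cl_coef (T1 p v) S = \sum_i v 0 i * cl_coef (T1 p (e i)) S.
  have -> : T1 p v = \sum_i v 0 i *: T1 p (e i).
    rewrite /T1 {1 2}/cl_vec !mulr_sumr !mulr_suml -big_split /=; apply: eq_bigr => i _.
    by rewrite -cl_vec_delta -!scalerAr -!scalerAl scalerDr.
  by rewrite cl_coef_sum; apply: eq_bigr => i _; rewrite cl_coefZ.
have smooth_cl (g : M -> Cl) : (forall S, smooth_on setT (fun p => cl_coef (g p) S)) <->
    forall x k, rs_atlas x -> class_cl k (chart_img x) (g \o chart_inv x).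
  split=> [h x k ax U|h U x ax k].
    by have := h U x ax k; rewrite preimage_setT setIT.
  by rewrite preimage_setT setIT; exact: h.
have H : forall p k, t k p = 0.
  apply: (@linear_system_unique _ M _ B t p0).
  - move=> x v i j z ax hv iz; have oD := @chart_img_open _ _ x.
    have cF (g : M -> 'rV[R]_n) l : smooth_vec_on setT g ->
        {for z, continuous (fun z => pd_vec v (g \o chart_inv x) z 0 l)}.
      move=> sg; apply: (@class_C_continuous _ 0%N (chart_img x)) => //.
      under [X in class_C _ _ X]funext do rewrite mxE.
      by apply: class_CS_pd => //; have := sg l x ax 1%N; rewrite preimage_setT setIT.
    have cc (k : R) : {for z, continuous (fun=> k : R^o)} by exact: cst_continuous.
    case: j => [[j|]|]; case: i => [[i|]|]; rewrite /B.
    - exact: cc.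
    - exact: (continuousM (cc (- 2 * r)) (cF fc j sfc)).
    - exact: (continuousM (cc (- 2)) (cF f j sf)).
    - exact: (cF f i sf).
    - exact: cc.
    - exact: cc.
    - exact: (continuousM (cc r) (cF fc i sfc)).
    - exact: cc.
    - exact: cc.
  - move=> k; have [Sa Sb] := ((smooth_cl a).1 sa, (smooth_cl b).1 sb).
    have [Sc Sd] := ((smooth_cl c).1 sc, (smooth_cl d).1 sd).
    move=> x ax m; rewrite preimage_setT setIT; have oD := @chart_img_open _ _ x.
    have [pa pb pc pd] := And4 (Sa x m ax) (Sb x m ax) (Sc x m ax) (Sd x m ax).
    case: k => [[i|]|] /=.
    + have q (g h : C -> Cl) : class_cl m (chart_img x) g -> class_cl m (chart_img x) h ->
          class_cl m (chart_img x) (fun z => g z * cl_vec (e i) * (h z)^t).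
        by move=> hg hh; do 2?apply: class_cl_mul => //; [exact: class_cl_cst|exact: class_cl_tr].
      exact: (class_cl_add oD (q _ _ pa pd) (q _ _ pb pc) S).
    + exact: (class_cl_mul oD pb (class_cl_tr oD pd) S).
    + exact: (class_cl_mul oD pa (class_cl_tr oD pc) S).
  - move=> x z v k ax iz hv; set p := chart_inv x z.
    have [da db] := dab x z v ax iz hv; have [dc dd] := dcd x z v ax iz hv.
    rewrite -/p in da db dc dd.
    have sumE (k' : option (option 'I_n)) : \sum_l t l p * B x v l k' z =
        t None p * B x v None k' z + (t (Some None) p * B x v (Some None) k' z +
        \sum_i t (Some (Some i)) p * B x v (Some (Some i)) k' z).
      by rewrite !sum_option.
    have vecT (w : 'rV[R]_n) : (cl_vec w)^t = cl_vec w := cl_tr_vec w.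
    have sumT (w : 'rV[R]_n) : \sum_i t (Some (Some i)) p * w 0 i = cl_coef (T1 p w) S.
      by rewrite T1lin; apply: eq_bigr => l _; rewrite mulrC.
    case: k => [[i|]|]; rewrite sumE /B ?mulr0 ?add0r ?mulr0 ?add0r.
    + have ce := is_pdcl_cst v (cl_vec (e i)) z.
      have h1 := is_pdcl_mul (is_pdcl_mul da ce) (is_pdcl_tr dd).
      have h2 := is_pdcl_mul (is_pdcl_mul db ce) (is_pdcl_tr dc).
      apply: is_pd_eq (is_pdcl_add h1 h2 S) _.
      have a1 := cl_clifford (F x v z) (e i); have a2 := cl_clifford (Fc x v z) (e i).
      rewrite (pairing_pd_vec r (a p) (b p) (c p) (d p) (vecT _) (vecT _) a1 a2).
      rewrite cl_coefD !cl_coefZ !dotE !dot_delta big1 ?addr0 => [|l _]; last by rewrite mulr0.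
      by congr (_ + _); [rewrite mulrC|rewrite mulrC [r * _]mulrA [r * - 2]mulrC].
    + apply: is_pd_eq (is_pdcl_mul db (is_pdcl_tr dd) S) _.
      apply: etrans _ (esym (sumT (F x v z))); apply: (congr1 (fun q : Cl => cl_coef q S)).
      have := pairing_pd_corner 1 (b p) (a p) (d p) (c p) (vecT (F x v z)).
      by rewrite !scale1r => ->; rewrite /T1 addrC.
    + apply: is_pd_eq (is_pdcl_mul da (is_pdcl_tr dc) S) _.
      apply: etrans (congr1 (fun q : Cl => cl_coef q S)
        (pairing_pd_corner r (a p) (b p) (c p) (d p) (vecT (Fc x v z)))) _.
      rewrite cl_coefZ -/(T1 p (Fc x v z)) -sumT mulr_sumr; apply: eq_bigr => l _.
      by rewrite mulrCA.
  - by move=> [[i|]|] //=; exact: v0.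
move=> p; split; [exact: (H p None)|exact: (H p (Some None))|].
by move=> v; rewrite -/(T1 p v) T1lin big1 // => i _; have /= -> := H p (Some (Some i)); rewrite mulr0.
Qed.

End Rows.

(** * Frames with values in the group *)

Section Frames.
Variables (R : realType) (n : nat) (M : riemannSurface R).
Local Notation C := (R[i]^o).
Local Notation Cl := (clifford R n).
Local Notation Re := (@complex.Re R).
Local Notation Im := (@complex.Im R).
Local Notation "a ^t" := (cl_tr a) (at level 8, format "a ^t").
Implicit Types (x : chart R M) (z v : C) (S : {set 'I_n}).

Definition smooth_cl (a : M -> Cl) := forall S, smooth_on setT (fun p => cl_coef (a p) S).

Lemma smooth_clP (a : M -> Cl) : smooth_cl a <->
  forall x k, rs_atlas x -> class_cl k (chart_img x) (a \o chart_inv x).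
Proof.
split=> [h x k ax U|h U x ax k].
  by have := h U x ax k; rewrite preimage_setT setIT.
by rewrite preimage_setT setIT; exact: h.
Qed.

Variables (f fc : M -> 'rV[R]_n) (r : R).
Hypothesis sf : smooth_vec_on setT f.
Hypothesis sfc : smooth_vec_on setT fc.
Hypothesis wedge : forall x z, rs_atlas x -> chart_img x z ->
  d_cl f x 1 z * d_cl fc x 'i z = d_cl f x 'i z * d_cl fc x 1 z.

Lemma grade_pd (g u : Cl) : cl_grade u = - u -> cl_grade (g * u) = - (cl_grade g * u).
Proof. by move=> e; rewrite cl_gradeM e mulrN. Qed.

Lemma d_cl_grade (g : M -> 'rV[R]_n) x v z : cl_grade (d_cl g x v z) = - d_cl g x v z.
Proof. exact: cl_grade_vec. Qed.

(** The vectors [df] and [df^c] are odd, so [(grade a, - grade b)] solves the same system as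
    [(a, b)]. The combination formed here vanishes at the base point for a suitable sign [k], hence
    everywhere, and the entries of the row are homogeneous. *)
Lemma row_parity (k : R) a b : row_solution f fc r a b ->
  row_solution f fc r (fun p => a p - k *: cl_grade (a p)) (fun p => b p + k *: cl_grade (b p)).
Proof.
move=> [sa sb dab]; split.
- apply/smooth_clP => x m ax; have oD := @chart_img_open _ _ x.
  have h := (smooth_clP a).1 sa x m ax.
  have -> : (fun p => a p - k *: cl_grade (a p)) \o chart_inv x =
      fun z => a (chart_inv x z) + (- k) *: cl_grade (a (chart_inv x z)).
    by apply/funext => z /=; rewrite scaleNr.
  exact: class_cl_add oD h (class_cl_scale (- k) oD (class_cl_grade oD h)).
- apply/smooth_clP => x m ax; have oD := @chart_img_open _ _ x.
  have h := (smooth_clP b).1 sb x m ax.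
  exact: class_cl_add oD h (class_cl_scale k oD (class_cl_grade oD h)).
move=> x z v ax iz hv; have [da db] := dab x z v ax iz hv; split.
  apply: is_pdcl_eq (is_pdcl_sub da (is_pdcl_scale k (is_pdcl_grade da))) _.
  rewrite cl_gradeZ (grade_pd _ (d_cl_grade _ _ _ _)) mulrDl -scalerAl scalerDr.
  by rewrite !scalerN opprK !scalerA mulrC.
apply: is_pdcl_eq (is_pdcl_add db (is_pdcl_scale k (is_pdcl_grade db))) _.
by rewrite (grade_pd _ (d_cl_grade _ _ _ _)) mulrBl -scalerAl scalerN.
Qed.

Lemma pairing_pd_zero (a b c d u u' : Cl) : u^t = u -> u'^t = u' ->
  (r *: (b * u')) * d^t + a * (c * u)^t - ((a * u) * c^t + b * (r *: (d * u'))^t) = 0.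
Proof.
move=> ut ut'; rewrite cl_trZ !cl_trM ut ut' -scalerAl -scalerAr !mulrA.
exact: etrans (congr1 (fun q => q - _) (addrC _ _)) (subrr _).
Qed.

Lemma row_det_constant (p0 : M) (a b c d : M -> Cl) :
  row_solution f fc r a b -> row_solution f fc r c d ->
  forall p, a p * (d p)^t - b p * (c p)^t = a p0 * (d p0)^t - b p0 * (c p0)^t.
Proof.
move=> [_ _ dab] [_ _ dcd] p; apply/clP => S.
apply: (@zero_pd_constant _ M (fun p => cl_coef (a p * (d p)^t - b p * (c p)^t) S) p0).
move=> x z v ax iz hv; have [da db] := dab x z v ax iz hv; have [dc dd] := dcd x z v ax iz hv.
have h := is_pdcl_sub (is_pdcl_mul da (is_pdcl_tr dd)) (is_pdcl_mul db (is_pdcl_tr dc)).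
apply: is_pd_eq (h S) _.
have -> : (0 : R) = cl_coef (0 : Cl) S by rewrite cl_coef0.
by apply: (congr1 (fun q : Cl => cl_coef q S)); apply: pairing_pd_zero; exact: d_cl_tr.
Qed.

(** The rows start at [(1, 0)] and [(w, 1)]. Each condition of [vahlen_frame] is checked at [p0] and
    propagated: parity by [row_parity], determinant and symmetries by [row_det_constant] applied to
    pairs of rows, reality and vector conditions by [row_pairing_vanish], one coordinate at a
    time. *)
Lemma frame_exists (p0 : M) (w : 'rV[R]_n) : simply_connected R M ->
  exists a b c d : M -> Cl, [/\ row_solution f fc r a b, row_solution f fc r c d,
    c p0 = cl_vec w, d p0 = 1 & forall p, vahlen_frame 1 (a p) (b p) (c p) (d p)].
Proof.
move=> sc.
have [a [b [ab a0 b0]]] := row_solution_exists r sf sfc wedge p0 1 0 sc.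
have [c [d [cd c0 d0]]] := row_solution_exists r sf sfc wedge p0 (cl_vec w) 1 sc.
exists a, b, c, d; split=> // p.
have wt : (cl_vec w)^t = cl_vec w := cl_tr_vec w.
have par1 := row_solution_unique sf sfc (row_parity 1 ab) (p0 := p0).
have par2 := row_solution_unique sf sfc (row_parity (-1) cd) (p0 := p0).
have g0 : cl_grade (0 : Cl) = 0 by rewrite -(scale0r (0 : Cl)) cl_gradeZ !scale0r.
have [pa pb] : a p - 1 *: cl_grade (a p) = 0 /\ b p + 1 *: cl_grade (b p) = 0.
  apply: par1; first by rewrite a0 cl_grade1 scale1r subrr.
  by rewrite b0 g0 scaler0 addr0.
have [pc pd] : c p - (-1) *: cl_grade (c p) = 0 /\ d p + (-1) *: cl_grade (d p) = 0.
  apply: par2; first by rewrite c0 cl_grade_vec scaleN1r opprK subrr.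
  by rewrite d0 cl_grade1 scaleN1r subrr.
have ww : is_real (cl_vec w * cl_vec w) by exists (- dot w w); rewrite cl_vec_sqr scaleNr.
have r0 : is_real (0 : Cl) by exists 0; rewrite scale0r.
have r1 : is_real (1 : Cl) by exists 1; rewrite scale1r.
have V S : #|S| != 1%N -> [/\ cl_coef (a p * (c p)^t) S = 0, cl_coef (b p * (d p)^t) S = 0 &
    forall v : 'rV[R]_n, cl_coef (a p * cl_vec v * (d p)^t + b p * cl_vec v * (c p)^t) S = 0].
  move=> S1; apply: (row_pairing_vanish sf sfc ab cd (p0 := p0)).
  - by rewrite a0 c0 mul1r wt cl_coef_vecN1.
  - by rewrite b0 mul0r cl_coef0.
  - by move=> v; rewrite a0 b0 d0 cl_tr1 !mul0r addr0 mul1r mulr1 cl_coef_vecN1.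
have Ra S : S != finset.set0 -> [/\ cl_coef (a p * (a p)^t) S = 0, cl_coef (b p * (b p)^t) S = 0 &
    forall v : 'rV[R]_n, cl_coef (a p * cl_vec v * (b p)^t + b p * cl_vec v * (a p)^t) S = 0].
  move=> S0; apply: (row_pairing_vanish sf sfc ab ab (p0 := p0)).
  - by rewrite a0 cl_tr1 mulr1 cl_coef1 (negPf S0).
  - by rewrite b0 mul0r cl_coef0.
  - by move=> v; rewrite b0 cl_tr0 mulr0 !mul0r addr0 cl_coef0.
have Rc S : S != finset.set0 -> [/\ cl_coef (c p * (c p)^t) S = 0, cl_coef (d p * (d p)^t) S = 0 &
    forall v : 'rV[R]_n, cl_coef (c p * cl_vec v * (d p)^t + d p * cl_vec v * (c p)^t) S = 0].
  move=> S0; apply: (row_pairing_vanish sf sfc cd cd (p0 := p0)).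
  - by rewrite c0 wt; apply: (is_realP _).1.
  - by rewrite d0 cl_tr1 mulr1 cl_coef1 (negPf S0).
  - move=> v; rewrite c0 d0 cl_tr1 mulr1 mul1r wt cl_clifford.
    by apply: (is_realP _).1 => //; exists (- 2 * \sum_i w 0 i * v 0 i).
split.
- by rewrite mulr1.
- split.
  + by move/eqP: pa; rewrite subr_eq0 scale1r => /eqP <-; rewrite scale1r.
  + by move/eqP: pb; rewrite addrC addr_eq0 scale1r => /eqP ->; rewrite scaleN1r.
  + by move/eqP: pc; rewrite scaleN1r opprK addrC addr_eq0 => /eqP ->; rewrite scaleN1r.
  + by move/eqP: pd; rewrite scaleN1r subr_eq0 => /eqP <-; rewrite scale1r.
- split.
  + by rewrite (row_det_constant p0 ab cd) a0 b0 c0 d0 cl_tr1 mulr1 mul0r subr0.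
  + apply/eqP; rewrite -subr_eq0; apply/eqP.
    by rewrite (row_det_constant p0 ab ab) a0 b0 cl_tr0 mulr0 mul0r subr0.
  + apply/eqP; rewrite -subr_eq0; apply/eqP.
    by rewrite (row_det_constant p0 cd cd) c0 d0 cl_tr1 mulr1 mul1r wt subrr.
- by split; apply/is_realP => S /[dup] /Ra [h1 h2 _] /Rc [h3 h4 _].
- split.
  + by apply/is_vectorP => S /V [].
  + by apply/is_vectorP => S /V [].
  + by move=> v; apply/is_vectorP => S /V [].
  + by move=> v; apply/is_realP => S /Ra [].
  + by move=> v; apply/is_realP => S /Rc [].
Qed.

End Frames.

(** * Primitives of closed 1-forms *)

Section Primitive.
Variables (R : realType) (M : riemannSurface R).
Local Notation C := (R[i]^o).
Local Notation Re := (@complex.Re R).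
Local Notation Im := (@complex.Im R).

(** The form is placed in the corner of a nilpotent 2 by 2 connection, whose quadratic term
    vanishes, so that flatness is closedness. The solution starting at [(1, 0)] keeps its first
    entry 1, and its second entry is the primitive. *)
Lemma closed_form_primitive (theta : chart R M -> C -> C -> R) : simply_connected R M -> M ->
  (forall c v k, rs_atlas c -> dir v -> class_C k (chart_img c) (theta c v)) ->
  (forall c c' z v, rs_atlas c -> rs_atlas c' -> overlap c c' z -> dir v ->
     let tau := transition c c' in
     theta c v z = Re (derive1 tau z * v) * theta c' 1 (tau z) +
                   Im (derive1 tau z * v) * theta c' 'i (tau z)) ->
  (forall c z, rs_atlas c -> chart_img c z -> pd 'i (theta c 1) z = pd 1 (theta c 'i) z) ->
  exists u : M -> R, smooth_on setT u /\
    forall c z v, rs_atlas c -> chart_img c z -> dir v -> is_pd v (u \o chart_inv c) z (theta c v z).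
Proof.
move=> sc p0 sth tth cth.
pose A : mx_form M 2 := fun c v i j z => if (i == 0) && (j == 1) then theta c v z else 0.
have sA : form_smooth A.
  move=> c ac k v i j hv; rewrite /A; case: (_ && _); [exact: sth|exact: class_C_cst].
have tA : form_transition A.
  move=> c c' z v i j ac ac' oz hv tau; rewrite /A; case: (_ && _); first exact: tth.
  by rewrite !mulr0 addr0.
have AA c v w k j z : \sum_l A c v k l z * A c w l j z = 0.
  apply: big1 => l _; rewrite /A; case: (l =P 0) => [->|_]; last by rewrite mulr0.
  by rewrite andbF mul0r.
have fA : form_flat A.
  move=> c z k j ac iz; rewrite (AA c 'i 1) (AA c 1 'i) !addr0 /A.
  by case: (_ && _); [exact: cth|rewrite !(is_pd_val (is_pd_cst _ _ _))].
have [y [y0 sy dy]] := surface_frobenius p0 (fun i => (i == 0)%:R) sA tA fA sc.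
have y1 p : y 0 p = 1.
  have -> : y 0 p = y 0 p0; last by rewrite y0 eqxx.
  apply: (@zero_pd_constant _ M) => c z v ac iz hv.
  apply: is_pd_eq (dy c z ac iz I v 0 hv) _.
  by apply: big1 => i _; rewrite /A andbF mulr0.
exists (y 1); split=> // c z v ac iz hv.
apply: is_pd_eq (dy c z ac iz I v 1 hv) _.
rewrite (bigD1 0) //= /A /= y1 mul1r big1 ?addr0 // => i /negPf i0.
by rewrite i0 mulr0.
Qed.

End Primitive.

(** * Restoring the determinant after the exchange of columns *)

Section Orientation.
Variables (R : realType) (n : nat).
Local Notation Cl := (clifford R n).
Local Notation "a ^t" := (cl_tr a) (at level 8, format "a ^t").
Implicit Types (a b c d al de : Cl) (v : 'rV[R]_n) (k r : R) (S : {set 'I_n}).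

Lemma clifford_group_scaleM (i0 : 'I_n) k a : k != 0 -> clifford_group a -> clifford_group (k *: a).
Proof.
move=> k0 Ga; rewrite -mulAl; apply: clifford_groupM => //; exact: clifford_group_scale.
Qed.

Lemma clifford_group_base (i0 : 'I_n) S : clifford_group (cl_base R S).
Proof.
move: {2}#|S| (erefl #|S|) => m; elim: m S => [|m IH] S Sm.
  by move/eqP: Sm; rewrite cards_eq0 => /eqP ->; rewrite cl_base0; exact: clifford_group1.
have /card_gt0P[i iS] : (0 < #|S|)%N by rewrite Sm.
pose S' := symdiff [set i]%SET S.
have S'E : S' = (S :\ i)%SET.
  apply/setP => j; rewrite !inE; have [->|ji] := eqVneq j i; first by rewrite iS.
  by case: (j \in S).
have /IH GS : #|S'| = m.
  by apply/eqP; rewrite S'E -eqSS -Sm (cardsD1 i S) iS.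
have := cl_baseM R [set i]%SET S'; rewrite /S' symdiffK -/S' => h.
have -> : cl_base R S = (-1) ^+ cl_exp [set i]%SET S' *: (cl_base R [set i]%SET * cl_base R S').
  by rewrite h scalerA -expr2 sqrr_sign scale1r.
apply: clifford_group_scaleM => //; first by rewrite signr_eq0.
apply: clifford_groupM => //; rewrite -cl_vec_delta; apply: clifford_group_vec.
by apply/eqP => /rowP/(_ i); rewrite !mxE !eqxx => /eqP; rewrite oner_eq0.
Qed.

(* The volume element omega satisfies omega v = - (-1)^n v omega and omega omega^t = (-1)^n. *)
Lemma orientation_reversal (i0 : 'I_n) : exists al de : Cl,
  [/\ clifford_group al, clifford_group de, forall v, al * cl_vec v = cl_vec v * de,
      al * de^t = -1 & is_real (de * de^t) /\ is_real (al^t * al) /\ is_real (de^t * de)].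
Proof.
pose T : {set 'I_n} := finset.setTfor 'I_n.
pose om : Cl := cl_base R T.
pose s : R := (-1) ^+ n.
have ss : s * s = 1 by rewrite -expr2 sqrr_sign.
have cT : #|T| = n by rewrite cardsT card_ord.
have oo : om * om^t = s%:A.
  rewrite /om cl_tr_base -scalerAr cl_baseM symdiffss cl_base0 scalerA cT.
  rewrite cl_exp_diag cT exprD mulrA -expr2 sqrr_sign mul1r //.
have s0 : s != 0 by rewrite signr_eq0.
have oo' : om^t * om = s%:A.
  have e1 : om * (s *: om^t) = 1 by rewrite -scalerAr oo scalerA ss scale1r.
  have := falg_mulVr e1; rewrite -scalerAl => e2.
  by rewrite -[LHS]scale1r -ss -scalerA e2.
have Gom : clifford_group om by exact: clifford_group_base.
have comm v : om * cl_vec v = cl_vec v * ((- s) *: om).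
  rewrite /cl_vec mulr_sumr mulr_suml; apply: eq_bigr => i _.
  rewrite -scalerAr -scalerAl -scalerAr; congr (_ *: _).
  apply/clP => U; rewrite cl_coefZ cl_coef_mul_basel cl_coef_mul_baser !cl_coef_base.
  case: eqP => [e|_]; last by rewrite !mulr0.
  rewrite e !mulr1 cl_sgn1 cT inE -/s expr1.
  have -> : - s * (s * -1 * (-1) ^+ cl_exp T [set i]%SET) =
    s * s * (-1) ^+ cl_exp T [set i]%SET :> R by ring.
  by rewrite ss mul1r.
exists om, ((- s) *: om); split=> //.
- by apply: clifford_group_scaleM => //; rewrite oppr_eq0.
- by rewrite cl_trZ -scalerAr oo scalerA mulNr ss scaleN1r.
- split; [|split].
  + by exists (- s * (- s * s)); rewrite cl_trZ -scalerAr -scalerAl oo !scalerA mulrA.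
  + by exists s.
  + by exists (- s * (- s * s)); rewrite cl_trZ -scalerAr -scalerAl oo' !scalerA mulrA.
Qed.

(** Here [k] is the inverse square root of [|r|]. For [r < 0] the rescaling alone suffices, with
    [al = de = 1]; for [r > 0] the missing sign is [al de^t = -1] for the volume element. *)
Lemma twist_exists (i0 : 'I_n) r : r != 0 -> exists al de : Cl, exists k : R,
  [/\ k != 0, clifford_group al, clifford_group de, forall v, al * cl_vec v = cl_vec v * de &
      (k * k * r) *: (al * de^t) = -1 /\
      [/\ is_real (de * de^t), is_real (al^t * al) & is_real (de^t * de)]].
Proof.
move=> r0; have sq (x : R) : 0 < x -> (Num.sqrt x)^-1 * (Num.sqrt x)^-1 * x = 1.
  move=> x0; rewrite -invfM -expr2 sqr_sqrtr ?ltW // mulVf // gt_eqF //.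
have sq0 (x : R) : 0 < x -> (Num.sqrt x)^-1 != 0 by move=> x0; rewrite invr_eq0 sqrtr_eq0 -ltNge.
have [rp|rn|] := ltgtP r 0; last by move=> e; rewrite e eqxx in r0.
- have rp' : 0 < - r by rewrite oppr_gt0.
  exists 1, 1, (Num.sqrt (- r))^-1; split.
  + exact: sq0.
  + exact: clifford_group1.
  + exact: clifford_group1.
  + by move=> v; rewrite mul1r mulr1.
  + rewrite cl_tr1 !mulr1; split; last by split; exists 1; rewrite scale1r.
    have := sq _ rp'; rewrite mulrN => /eqP; rewrite eqr_oppLR => /eqP ->.
    by rewrite scaleN1r.
- have [al [de [Ga Gd com ad [r1 [r2 r3]]]]] := orientation_reversal i0.
  exists al, de, (Num.sqrt r)^-1; split=> //; first exact: sq0.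
  by split=> //; rewrite sq // scale1r.
Qed.

(** The new determinant is [- k^2 r al de^t]. The vector conditions survive because
    [al v de^t = v de de^t] with [de de^t] real, and because [al^t al] and [de^t de] are real. *)
Lemma SL_twist (i0 : 'I_n) a b c d al de k r : k != 0 -> r != 0 ->
  clifford_group al -> clifford_group de -> (forall v, al * cl_vec v = cl_vec v * de) ->
  (k * k * r) *: (al * de^t) = -1 ->
  is_real (de * de^t) -> is_real (al^t * al) -> is_real (de^t * de) ->
  SL_Gamma (mx2 a b c d) ->
  SL_Gamma (mx2 ((k * r) *: (al * b)) (k *: (al * a)) ((k * r) *: (de * d)) (k *: (de * c))).
Proof.
move=> k0 r0 Ga Gd com ad [x1 h1] [x2 h2] [x3 h3] [].
rewrite !mxE /= => G [vac vbd] [vab vcd] det.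
have kr0 : k * r != 0 by rewrite mulf_neq0.
have g (y x : Cl) (l : R) : l != 0 -> clifford_group y -> x = 0 \/ clifford_group x ->
    l *: (y * x) = 0 \/ clifford_group (l *: (y * x)).
  move=> l0 Gy [->|Gx]; first by left; rewrite mulr0 scaler0.
  by right; apply: clifford_group_scaleM => //; exact: clifford_groupM.
have G00 : a = 0 \/ clifford_group a by have := G 0 0; rewrite mxE.
have G01 : b = 0 \/ clifford_group b by have := G 0 1; rewrite mxE.
have G10 : c = 0 \/ clifford_group c by have := G 1 0; rewrite mxE.
have G11 : d = 0 \/ clifford_group d by have := G 1 1; rewrite mxE.
have vec1 (x y : Cl) (l m : R) : is_vector (x * y^t) -> is_vector (l *: (al * x) * (m *: (de * y))^t).
  move=> [v e]; exists ((l * m * x1) *: v).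
  rewrite cl_trZ cl_trM -scalerAl -scalerAr scalerA.
  have -> : al * x * (y^t * de^t) = x1 *: cl_vec v.
    by rewrite mulrA -(mulrA al) e com -mulrA h1 mulAr.
  by rewrite scalerA cl_vecZ.
have vec2 (x y z : Cl) (l m q : R) : z^t * z = q%:A -> is_vector (y^t * x) ->
    is_vector ((l *: (z * x))^t * (m *: (z * y))).
  move=> zz vxy; have := is_vectorZ (l * m * q) (is_vector_tr vxy).
  have -> : (l *: (z * x))^t * (m *: (z * y)) = (l * m * q) *: (x^t * y).
    rewrite cl_trZ cl_trM -scalerAr -scalerAl mulrA -(mulrA x^t) zz mulAr -scalerAl !scalerA.
    by congr (_ *: _); ring.
  by rewrite cl_trM cl_trK.
split; rewrite ?mxE /=.
- move=> i j; rewrite mxE; case: (i == 0); case: (j == 0); exact: g.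
- by split; apply: vec1.
- by split; apply: vec2; eassumption.
rewrite !cl_trZ !cl_trM -!scalerAl -!scalerAr !scalerA.
have -> : al * b * (c^t * de^t) = al * (b * c^t) * de^t by rewrite !mulrA.
have -> : al * a * (d^t * de^t) = al * (a * d^t) * de^t by rewrite !mulrA.
have -> : k * r * k = k * k * r by ring.
have -> : k * (k * r) = k * k * r by ring.
rewrite -scalerBr -mulrBl -mulrBr -[b * c^t - _]opprB det mulrN1 mulNr scalerN ad.
exact: opprK.
Qed.

End Orientation.

(** * From rows to frames of the two T-transforms *)

Section TFrame.
Variables (R : realType) (n : nat) (M : riemannSurface R).
Local Notation Cl := (clifford R n).
Local Notation "a ^t" := (cl_tr a) (at level 8, format "a ^t").

Lemma row_solution_T_frame (f fc : M -> 'rV[R]_n) (r : R) (a b c d : M -> Cl) :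
  row_solution f fc r a b -> row_solution f fc r c d ->
  (forall p, SL_Gamma (mx2 (a p) (b p) (c p) (d p))) ->
  T_frame r f fc (fun p => mx2 (a p) (b p) (c p) (d p)).
Proof.
move=> [sa sb dab] [sc sd dcd] SL; split=> //.
  move=> i j S; under [X in smooth_on _ X]funext do rewrite mxE.
  by case: (i == 0); case: (j == 0); [exact: sa|exact: sb|exact: sc|exact: sd].
move=> x z ax iz _ v hv; have [da db] := dab x z v ax iz hv; have [dc dd] := dcd x z v ax iz hv.
apply/matrixP => i j.
have E : (fun w => ((fun p => mx2 (a p) (b p) (c p) (d p)) \o chart_inv x) w i j) =
    if i == 0 then (if j == 0 then a \o chart_inv x else b \o chart_inv x)
    else (if j == 0 then c \o chart_inv x else d \o chart_inv x).
  by apply/funext => w; rewrite /= mxE; case: (i == 0); case: (j == 0).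
rewrite [LHS]mxE E [RHS]mxE big_ord_recl big_ord1 !mxE /=.
case: (i == 0); case: (j == 0).
- by rewrite (is_pdcl_val da) mulr0 add0r -scalerAr.
- by rewrite (is_pdcl_val db) mulr0 addr0.
- by rewrite (is_pdcl_val dc) mulr0 add0r -scalerAr.
- by rewrite (is_pdcl_val dd) mulr0 addr0.
Qed.

(** Exchanging the entries of a row exchanges [df] and [r df^c]; the additional factor [r] on one
    entry moves [r] back in front of the lower-left form. Constant left factors commute with the
    system. *)
Lemma row_solution_swap (f fc : M -> 'rV[R]_n) (r : R) (a b : M -> Cl) (al : Cl) (k : R) :
  row_solution f fc r a b ->
  row_solution fc f r (fun p => (k * r) *: (al * b p)) (fun p => k *: (al * a p)).
Proof.
move=> [sa sb dab]; split.
- apply/smooth_clP => x m ax; have oD := @chart_img_open _ _ x.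
  have h := (smooth_clP b).1 sb x m ax.
  exact: class_cl_scale _ oD (class_cl_mul oD (@class_cl_cst _ _ m _ al) h).
- apply/smooth_clP => x m ax; have oD := @chart_img_open _ _ x.
  have h := (smooth_clP a).1 sa x m ax.
  exact: class_cl_scale _ oD (class_cl_mul oD (@class_cl_cst _ _ m _ al) h).
move=> x z v ax iz hv; have [da db] := dab x z v ax iz hv; split.
  apply: is_pdcl_eq (is_pdcl_scale (k * r) (is_pdcl_mul (is_pdcl_cst v al z) db)) _.
  by rewrite mul0r add0r -scalerAl scalerA [r * k]mulrC mulrA.
apply: is_pdcl_eq (is_pdcl_scale k (is_pdcl_mul (is_pdcl_cst v al z) da)) _.
by rewrite mul0r add0r -scalerAr scalerA -scalerAl mulrA.
Qed.

End TFrame.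

(** * The Darboux transformation *)

Section Sandwich.
Variables (R : realType) (n : nat).
Local Notation Cl := (clifford R n).
Local Notation "a ^t" := (cl_tr a) (at level 8, format "a ^t").
Implicit Types (a b c d x : Cl) (v w : 'rV[R]_n) (k : R).

Definition cl_norm d : R := cl_coef (d * d^t) finset.set0.

(* The inverse of d as soon as d is a unit and d d^t is real; unlike d^-1 it is manifestly a
   smooth expression in d. *)
Definition cl_rinv d : Cl := (cl_norm d)^-1 *: d^t.

Lemma cl_norm_real d : is_real (d * d^t) -> d * d^t = (cl_norm d)%:A.
Proof. by rewrite /cl_norm => -[k ->]; rewrite cl_coefZ cl_coef1 eqxx mulr1. Qed.

Lemma cl_norm0 : cl_norm 0 = 0.
Proof. by rewrite /cl_norm mul0r cl_coef0. Qed.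

Lemma cl_norm_neq0 d : d \is a GRing.unit -> is_real (d * d^t) -> cl_norm d != 0.
Proof.
move=> ud /cl_norm_real e; apply/eqP => k0; move: e; rewrite k0 scale0r => e.
have t0 : d^t = 0 by rewrite -(mulKr ud d^t) e mulr0.
by move: ud; rewrite -(cl_trK d) t0 cl_tr0 unitr0.
Qed.

Lemma cl_mul_rinv d : d \is a GRing.unit -> is_real (d * d^t) -> d * cl_rinv d = 1.
Proof.
move=> ud rd; rewrite /cl_rinv -scalerAr cl_norm_real // scalerA mulVf ?scale1r //.
exact: cl_norm_neq0.
Qed.

Lemma cl_invE d : d \is a GRing.unit -> is_real (d * d^t) -> d^-1 = cl_rinv d.
Proof. by move=> ud rd; apply: inv_of_mul; exact: cl_mul_rinv. Qed.

Lemma dot_eq_scale v w v' w' k :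
  cl_vec v' * cl_vec w' + cl_vec w' * cl_vec v' =
    k *: (cl_vec v * cl_vec w + cl_vec w * cl_vec v) ->
  dot v' w' = k * dot v w.
Proof.
rewrite !cl_clifford scalerA => /(congr1 (fun a => cl_coef a finset.set0)).
rewrite !cl_coefZ !cl_coef1 eqxx !mulr1 -/(dot v' w') -/(dot v w) => h.
have := congr1 (fun x : R => - 2^-1 * x) h; rewrite mulrA => h'.
transitivity (- 2^-1 * -2 * dot v' w'); first by field.
by rewrite h'; field.
Qed.

Section Unit.
Variables (d e : Cl) (k : R).
Hypotheses (de : d * e = 1) (ek : e = k *: d^t).

Let ed : e * d = 1. Proof. exact: falg_mulVr. Qed.
Let ekt : e^t = k *: d. Proof. by rewrite ek cl_trZ cl_trK. Qed.
Let ett : e^t * d^t = 1. Proof. by rewrite -cl_trM de cl_tr1. Qed.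
Let tet : d^t * e^t = 1. Proof. by rewrite -cl_trM ed cl_tr1. Qed.
Let eet : e * e^t = k%:A. Proof. by rewrite ekt -scalerAr ed. Qed.
Let ete : e^t * e = k%:A. Proof. by rewrite ekt -scalerAl de. Qed.

(** Since [e e^t = k] is real, [x => e^t x e] is multiplicative up to [k]; applied to the Clifford
    relation, this makes it conformal on vectors. *)
Lemma sandwich_mul x y : e^t * x * e * (e^t * y * e) = k *: (e^t * (x * y) * e).
Proof.
transitivity (e^t * x * (e * e^t) * (y * e)); first by rewrite !mulrA.
by rewrite eet mulAr -scalerAl !mulrA.
Qed.

Lemma sandwich_dot v w v' w' : cl_vec v' = e^t * cl_vec v * e -> cl_vec w' = e^t * cl_vec w * e ->
  dot v' w' = k * k * dot v w.
Proof.
move=> hv hw; apply: dot_eq_scale; rewrite hv hw !sandwich_mul -scalerDr -mulrDl -mulrDr.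
by rewrite cl_clifford mulAr -scalerAl ete scalerA scalerA scalerA mulrAC.
Qed.

(** The maps [x => e^t x e] and [x => d x d^t] are proportional and scale lengths by reciprocal
    factors, so mixed inner products are unchanged. This is what preserves [Q] for the new
    Christoffel pair. *)
Lemma sandwich_dot_dual v w v' w' : cl_vec v' = e^t * cl_vec v * e -> cl_vec w' = d * cl_vec w * d^t ->
  dot v' w' = dot v w.
Proof.
move=> hv hw; rewrite -[RHS]mul1r; apply: dot_eq_scale; rewrite hv hw scale1r.
have -> : e^t * cl_vec v * e * (d * cl_vec w * d^t) = e^t * (cl_vec v * cl_vec w) * d^t.
  rewrite -mulrA -(mulrA d) (mulrA e) ed mul1r !mulrA //.
have -> : d * cl_vec w * d^t * (e^t * cl_vec v * e) = e^t * (cl_vec w * cl_vec v) * d^t.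
  transitivity (d * cl_vec w * (d^t * e^t) * (cl_vec v * e)); first by rewrite !mulrA.
  by rewrite tet mulr1 ekt ek -!scalerAr -!scalerAl !mulrA.
by rewrite -mulrDl -mulrDr cl_clifford mulAr -scalerAl ett.
Qed.

Lemma sandwich_inj x : e^t * x * e = 0 -> x = 0.
Proof.
move=> h; have := congr1 (fun y => d^t * y * d) h.
by rewrite /= mulr0 mul0r !mulrA tet mul1r -mulrA ed mulr1.
Qed.

Lemma sandwich_wedge x y x' y' : x * y = x' * y' ->
  e^t * x * e * (d * y * d^t) - e^t * x' * e * (d * y' * d^t) = 0.
Proof.
have E (u w : Cl) : e^t * u * e * (d * w * d^t) = e^t * (u * w) * d^t.
  transitivity (e^t * u * (e * d) * (w * d^t)); first by rewrite !mulrA.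
  by rewrite ed mulr1 !mulrA.
by move=> h; rewrite !E h subrr.
Qed.

End Unit.

(** Induction on generators, for [d] and [d^-1] together so as to pass through inverses. For a
    generator, [w v w = |w|^2 v - 2 (v, w) w]. *)
Lemma clifford_group_sandwich d : clifford_group d ->
  (forall v, is_vector (d * cl_vec v * d^t)) /\ (forall v, is_vector (d^-1 * cl_vec v * (d^-1)^t)).
Proof.
have vv w v : is_vector (cl_vec w * cl_vec v * cl_vec w).
  rewrite cl_vec_anticomm mulrBl mulAl -mulrA cl_vec_sqr mulrN opprK mulAr.
  by apply: is_vectorD; apply: is_vectorZ; eexists.
elim=> [w w0||a b /clifford_group_unit ua [a1 a2] /clifford_group_unit ub [b1 b2]|a Ga [a1 a2]].
- split=> v; first by rewrite cl_tr_vec.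
  have -> : (cl_vec w)^-1 = cl_vec (- (dot w w)^-1 *: w).
    apply: inv_of_mul; rewrite cl_vecZ -scalerAr cl_vec_sqr scalerN scaleNr opprK scalerA mulVf ?scale1r //.
    exact/lt0r_neq0/dot_gt0.
  by rewrite cl_tr_vec.
- by rewrite invr1 cl_tr1; split=> v; rewrite mul1r mulr1; exists v.
- split=> v.
    have [w e] := b1 v; have [w' e'] := a1 w; exists w'; rewrite -e' -e cl_trM.
    by rewrite !mulrA.
  have [w e] := a2 v; have [w' e'] := b2 w; exists w'; rewrite -e' -e (invrM ua ub) cl_trM.
  by rewrite !mulrA.
- by rewrite invrK; split.
Qed.

(** The symmetry [c d^t = d c^t] says that [d^-1 c] and [c^-1 d] equal their transposes; replacing
    them by these brings out the determinant. *)
Lemma frame_ratio_sub a b c d di ci : d * di = 1 -> c * ci = 1 ->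
  a * d^t - b * c^t = 1 -> c * d^t = d * c^t ->
  [/\ a - b * di * c = di^t, b - a * ci * d = - ci^t & a * ci - b * di = di^t * ci].
Proof.
move=> dd cc det cdt; have dd' := falg_mulVr dd; have cc' := falg_mulVr cc.
have ddt : d^t * di^t = 1 by rewrite -cl_trM dd' cl_tr1.
have cct : c^t * ci^t = 1 by rewrite -cl_trM cc' cl_tr1.
have e1 : di * c = c^t * di^t.
  transitivity (di * (c * d^t) * di^t); first by rewrite -!mulrA ddt mulr1.
  by rewrite cdt !mulrA dd' mul1r.
have e2 : ci * d = d^t * ci^t.
  transitivity (ci * (d * c^t) * ci^t); first by rewrite -!mulrA cct mulr1.
  by rewrite -cdt !mulrA cc' mul1r.
have h1 : a - b * di * c = di^t.
  by rewrite -mulrA e1 -[RHS]mul1r -det mulrBl -!mulrA ddt mulr1.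
split=> //.
  rewrite -mulrA e2 -[ci^t in RHS]mul1r -det mulrBl -!mulrA cct mulr1.
  by rewrite opprB.
by rewrite -h1 mulrBl -[b * di * c * ci]mulrA cc mulr1.
Qed.

End Sandwich.

Section RinvCalculus.
Variables (R : realType) (n : nat).
Local Notation C := (R[i]^o).
Local Notation Cl := (clifford R n).
Local Notation "a ^t" := (cl_tr a) (at level 8, format "a ^t").
Implicit Types (a : C -> Cl) (z v : C) (D : set C).

Lemma class_C_norm k D a : open D -> class_cl k D a -> class_C k D (fun x => cl_norm (a x)).
Proof. by move=> oD ha; exact: (class_cl_mul oD ha (class_cl_tr oD ha)). Qed.

Lemma class_cl_rinv k D a : open D -> class_cl k D a -> (forall z, D z -> cl_norm (a z) != 0) ->
  class_cl k D (fun x => cl_rinv (a x)).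
Proof.
move=> oD ha a0 S; under [X in class_C _ _ X]funext do rewrite cl_coefZ.
apply: class_C_mul => //; first exact: class_C_inv (class_C_norm oD ha).
exact: class_cl_tr.
Qed.

(** The explicit formula for [cl_rinv] gives differentiability, and differentiating [a a^-1 = 1]
    gives the value. *)
Lemma is_pdcl_rinv v a z da : is_pdcl v a z da -> cl_norm (a z) != 0 ->
  (\forall x \near z, a x * cl_rinv (a x) = 1) ->
  is_pdcl v (fun x => cl_rinv (a x)) z (- (cl_rinv (a z) * da * cl_rinv (a z))).
Proof.
move=> ha a0 ai1; have a1 : a z * cl_rinv (a z) = 1 := nbhs_singleton ai1.
have [e he] : exists e, is_pdcl v (fun x => cl_rinv (a x)) z e.
  have hn := is_pdcl_mul ha (is_pdcl_tr ha) finset.set0.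
  have hi := is_pd_inv a0 hn.
  pose l := (- cl_coef (da * (a z)^t + a z * da^t) finset.set0 *
    ((cl_norm (a z))^-1 * (cl_norm (a z))^-1)).
  exists (l *: (a z)^t + (cl_norm (a z))^-1 *: da^t) => S.
  rewrite cl_coefD 2!cl_coefZ; under [X in is_pd _ X]funext do rewrite cl_coefZ.
  exact: is_pd_mul hi (is_pdcl_tr ha S).
have h1 := is_pdcl_mul ha he.
have h0 : is_pdcl v (fun x => a x * cl_rinv (a x)) z 0.
  apply: is_pdcl_near (is_pdcl_cst v 1 z).
  by apply: filterS ai1 => x ->.
have E : da * cl_rinv (a z) + a z * e = 0.
  by rewrite -(is_pdcl_val h1) (is_pdcl_val h0).
apply: is_pdcl_eq he _; move/eqP: E; rewrite addrC addr_eq0 => /eqP E.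
transitivity (cl_rinv (a z) * (a z * e)); first by rewrite mulrA (falg_mulVr a1) mul1r.
by rewrite E mulrN mulrA.
Qed.

End RinvCalculus.

Section DotDz.
Variables (R : realType) (n : nat).
Local Notation C := (R[i]^o).

Lemma complex_sum (I : finType) (x y : I -> R) :
  \sum_i (x i +i* y i) = (\sum_i x i) +i* (\sum_i y i) :> R[i].
Proof. by elim/big_rec3: _ => [//|i s t u _ ->]. Qed.

(** This reduces the condition on the (2,0)-part to real inner products of first derivatives. *)
Lemma dot_dz (f g : C -> 'rV[R]_n) z :
  let p := pd_vec 1 f z in let q := pd_vec 'i f z in
  let p' := pd_vec 1 g z in let q' := pd_vec 'i g z in
  dot (dz_vec f z) (dz_vec g z) =
    ((dot p p' - dot q q') / 4) +i* (- ((dot p q' + dot q p') / 4)).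
Proof.
move=> p q p' q'; rewrite /dot -sumrB -big_split /= !mulr_suml -sumrN -complex_sum.
apply: eq_bigr => j _; rewrite ![dz_vec _ _ _ _]mxE -/p -/q -/p' -/q'.
move: (p 0 j) (q 0 j) (p' 0 j) (q' 0 j) => x y x' y'.
by apply/eqP; rewrite eq_complex /=; apply/andP; split; apply/eqP; field.
Qed.

End DotDz.

(** The product rule for [b d^-1] when [b' = a w] and [d' = c w]: the derivative collapses onto
    [a - b d^-1 c], which [frame_ratio_sub] evaluates. *)
Lemma quotient_pd (K : pzRingType) (a b c di w : K) :
  a * w * di + b * (- (di * (c * w) * di)) = (a - b * di * c) * w * di.
Proof. by rewrite mulrN !mulrBl !mulrA. Qed.

Lemma quotient_pd_scale (R : realType) (n : nat) (r : R) (a b c di w : clifford R n) :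
  r *: (a * w) * di + b * (- (di * (r *: (c * w)) * di)) = r *: ((a - b * di * c) * w * di).
Proof.
have -> : r *: ((a - b * di * c) * w * di) = (a - b * di * c) * (r *: w) * di.
  by rewrite -scalerAr -scalerAl.
by rewrite -quotient_pd -!scalerAr.
Qed.

Lemma mul_comb_mul (R : realType) (n : nat) (s t : R) (a x y b : clifford R n) :
  a * (s *: x + t *: y) * b = s *: (a * x * b) + t *: (a * y * b).
Proof. by rewrite mulrDr mulrDl -!scalerAr -!scalerAl. Qed.

(** * The Darboux equation for the two representatives *)

Section DarbouxOfFrame.
Variables (R : realType) (n : nat) (M : riemannSurface R) (Q : quadraticDifferential M).
Local Notation C := (R[i]^o).
Local Notation Cl := (clifford R n).
Local Notation Re := (@complex.Re R).
Local Notation Im := (@complex.Im R).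
Local Notation "a ^t" := (cl_tr a) (at level 8, format "a ^t").
Implicit Types (x : chart R M) (z v : C) (p : M).
Variables (f fc : M -> 'rV[R]_n) (r : R) (a b c d : M -> Cl).
Hypothesis sc : simply_connected R M.
Hypothesis cif : conformal_immersion_on setT f.
Hypothesis chf : christoffel_on Q setT f fc.
Hypothesis ab : row_solution f fc r a b.
Hypothesis cd : row_solution f fc r c d.
Hypothesis Gc : forall p, c p = 0 \/ clifford_group (c p).
Hypothesis Gd : forall p, d p = 0 \/ clifford_group (d p).
Hypothesis rc : forall p, is_real (c p * (c p)^t).
Hypothesis rd : forall p, is_real (d p * (d p)^t).
Hypothesis det : forall p, a p * (d p)^t - b p * (c p)^t = 1.
Hypothesis cdt : forall p, c p * (d p)^t = d p * (c p)^t.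

Let U : set M := [set p | d p != 0 /\ c p != 0].
Let D x : set C := chart_img x `&` chart_inv x @^-1` U.
Let sf : smooth_vec_on setT f := cif.1.
Let sfc : smooth_vec_on setT fc := chf.1.

Lemma christoffel_wedge x z : rs_atlas x -> chart_img x z ->
  d_cl f x 1 z * d_cl fc x 'i z = d_cl f x 'i z * d_cl fc x 1 z.
Proof. by move=> ax iz; have [/eqP e _] := chf.2 x z ax iz I; apply/eqP; rewrite -subr_eq0. Qed.

Let norm_neq0 (h : M -> Cl) p : (h p = 0 \/ clifford_group (h p)) -> is_real (h p * (h p)^t) ->
  (h p != 0) = (cl_norm (h p) != 0).
Proof.
move=> [->|/clifford_group_unit u] rh; first by rewrite cl_norm0 !eqxx.
rewrite cl_norm_neq0 //; apply/eqP => h0; move: u; rewrite h0 unitr0 //.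
Qed.

(** Through the norms, [U] is the locus where two continuous real functions do not vanish, hence
    open in every chart. *)
Let UE p : U p <-> cl_norm (d p) != 0 /\ cl_norm (c p) != 0.
Proof. by rewrite /U /= (norm_neq0 (Gd p) (rd p)) (norm_neq0 (Gc p) (rc p)). Qed.

Let row_class k x (h : M -> Cl) : (forall S, smooth_on setT (fun p => cl_coef (h p) S)) -> rs_atlas x ->
  class_cl k (chart_img x) (h \o chart_inv x).
Proof. by move=> sh ax; apply: (smooth_clP h).1. Qed.

Let norm_locus_open x (h : M -> Cl) : (forall S, smooth_on setT (fun p => cl_coef (h p) S)) ->
  rs_atlas x -> open (chart_img x `&` [set z | cl_norm (h (chart_inv x z)) != 0]).
Proof.
move=> sh ax; have oi := @chart_img_open _ _ x.
have [cn _] := class_C_norm oi (row_class 0%N sh ax).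
apply: (preimage_within_open (W := [set t : R | t != 0]) oi cn); exact: open_neq.
Qed.

Let D_open x : rs_atlas x -> open (D x).
Proof.
move=> ax; have [_ sd _] := cd; have [scc _ _] := cd.
have -> : D x = (chart_img x `&` [set z | cl_norm (d (chart_inv x z)) != 0]) `&`
    (chart_img x `&` [set z | cl_norm (c (chart_inv x z)) != 0]).
  apply/seteqP; split=> [z [iz /UE [h1 h2]]|z [[iz h1] [_ h2]]] //.
  by split=> //; apply/UE.
by apply: openI; apply: norm_locus_open.
Qed.

Let mul_rinv (h : M -> Cl) p : (h p = 0 \/ clifford_group (h p)) -> is_real (h p * (h p)^t) ->
  h p != 0 -> h p * cl_rinv (h p) = 1.
Proof. by move=> [->|/clifford_group_unit u] rh h0; [rewrite eqxx in h0|exact: cl_mul_rinv]. Qed.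

Let ddi p : U p -> d p * cl_rinv (d p) = 1.
Proof. by move=> [dp _]; exact: mul_rinv. Qed.

Let cci p : U p -> c p * cl_rinv (c p) = 1.
Proof. by move=> [_ cp]; exact: mul_rinv. Qed.

Let ratio p (Up : U p) := frame_ratio_sub (ddi Up) (cci Up) (det p) (cdt p).

Let pd_ratio_d x z v : rs_atlas x -> D x z -> dir v ->
  is_pdcl v (fun w => b (chart_inv x w) * cl_rinv (d (chart_inv x w))) z
   ((cl_rinv (d (chart_inv x z)))^t * d_cl f x v z * cl_rinv (d (chart_inv x z))).
Proof.
move=> ax Dz hv; have [iz Uz] := Dz; have [_ _ dab] := ab; have [_ _ dcd] := cd.
have [_ db] := dab x z v ax iz hv; have [_ dd] := dcd x z v ax iz hv.
have n0 := ((UE _).1 Uz).1.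
have ni : \forall y \near z, d (chart_inv x y) * cl_rinv (d (chart_inv x y)) = 1.
  by apply: open_near (D_open ax) Dz _ => y [_ Uy]; exact: ddi.
apply: is_pdcl_eq (is_pdcl_mul db (is_pdcl_rinv dd n0 ni)) _.
have [<- _ _] := ratio Uz; exact: quotient_pd.
Qed.

Let pd_ratio_c x z v : rs_atlas x -> D x z -> dir v ->
  is_pdcl v (fun w => a (chart_inv x w) * cl_rinv (c (chart_inv x w))) z
   (- r *: ((cl_rinv (c (chart_inv x z)))^t * d_cl fc x v z * cl_rinv (c (chart_inv x z)))).
Proof.
move=> ax Dz hv; have [iz Uz] := Dz; have [_ _ dab] := ab; have [_ _ dcd] := cd.
have [da _] := dab x z v ax iz hv; have [dc _] := dcd x z v ax iz hv.
have n0 := ((UE _).1 Uz).2.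
have ni : \forall y \near z, c (chart_inv x y) * cl_rinv (c (chart_inv x y)) = 1.
  by apply: open_near (D_open ax) Dz _ => y [_ Uy]; exact: cci.
apply: is_pdcl_eq (is_pdcl_mul da (is_pdcl_rinv dc n0 ni)) _.
have [_ e _] := ratio Uz; apply: etrans (quotient_pd_scale _ _ _ _ _ _) _.
by rewrite e !mulNr scalerN scaleNr.
Qed.

Variables u uh : M -> 'rV[R]_n.
Hypothesis uE : forall p, U p -> cl_vec (u p) = b p * cl_rinv (d p).
Hypothesis uhE : forall p, U p -> cl_vec (uh p) = a p * cl_rinv (c p).

Let pd_vec_of (g : M -> 'rV[R]_n) (h : M -> Cl) x z v e : rs_atlas x -> D x z ->
  (forall p, U p -> cl_vec (g p) = h p) -> is_pdcl v (h \o chart_inv x) z e ->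
  (forall j, is_pd v (fun w => g (chart_inv x w) 0 j) z (pd_vec v (g \o chart_inv x) z 0 j)) /\
  cl_vec (pd_vec v (g \o chart_inv x) z) = e.
Proof.
move=> ax Dz gh he.
have hg : is_pdcl v (fun w => cl_vec (g (chart_inv x w))) z e.
  apply: is_pdcl_near he; apply: open_near (D_open ax) Dz _ => y [_ Uy].
  by rewrite /= gh.
have hj j : is_pd v (fun w => g (chart_inv x w) 0 j) z (cl_coef e [set j]%SET).
  have := hg [set j]%SET; under [X in is_pd _ X]funext do rewrite cl_coef_vec.
  exact.
have hj' j : is_pd v (fun w => g (chart_inv x w) 0 j) z (pd_vec v (g \o chart_inv x) z 0 j).
  by rewrite mxE (is_pd_val (hj j)); exact: hj.
split=> //; rewrite -(is_pdcl_val hg) (is_pdcl_val (is_pdcl_vec hj')) //.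
Qed.

Let smooth_of (g : M -> 'rV[R]_n) (h : M -> Cl) :
  (forall p, U p -> cl_vec (g p) = h p) ->
  (forall x k, rs_atlas x -> class_cl k (D x) (h \o chart_inv x)) -> smooth_vec_on U g.
Proof.
move=> gh sh j x ax k; apply: class_C_ext (D_open ax) _ (sh x k ax [set j]%SET).
by move=> z [_ Uz] /=; rewrite -gh // cl_coef_vec.
Qed.

Let ratio_class (h e : M -> Cl) x k : (forall S, smooth_on setT (fun p => cl_coef (h p) S)) ->
  (forall S, smooth_on setT (fun p => cl_coef (e p) S)) -> rs_atlas x ->
  (forall p, U p -> cl_norm (e p) != 0) ->
  class_cl k (D x) ((fun p => h p * cl_rinv (e p)) \o chart_inv x).
Proof.
move=> sh se ax e0; have oD := D_open ax.
have sub (g : M -> Cl) : (forall S, smooth_on setT (fun p => cl_coef (g p) S)) ->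
    class_cl k (D x) (g \o chart_inv x).
  move=> sg S; apply: class_C_sub (row_class k sg ax S); exact: subIsetl.
apply: (class_cl_mul oD (sub h sh)); apply: (class_cl_rinv oD (sub e se)).
by move=> z [_ Uz]; exact: e0.
Qed.

Let u_smooth : smooth_vec_on U u.
Proof.
have [_ sb _] := ab; have [_ sd _] := cd.
by apply: smooth_of uE _ => x k ax; apply: ratio_class => // p /UE [].
Qed.

Let uh_smooth : smooth_vec_on U uh.
Proof.
have [sa _ _] := ab; have [scc _ _] := cd.
by apply: smooth_of uhE _ => x k ax; apply: ratio_class => // p /UE [].
Qed.

Let pd_u x z v : rs_atlas x -> D x z -> dir v -> cl_vec (pd_vec v (u \o chart_inv x) z) =
  (cl_rinv (d (chart_inv x z)))^t * d_cl f x v z * cl_rinv (d (chart_inv x z)).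
Proof. by move=> ax Dz hv; have [] := pd_vec_of ax Dz uE (pd_ratio_d ax Dz hv). Qed.

(** The differential of [u] is the image of [df] under [x => (d^-1)^t x d^-1], which scales all
    inner products by one common factor and is injective. *)
Let conformal_u : conformal_immersion_on U u.
Proof.
split; first exact: u_smooth.
move=> x z ax iz Uz fx fy; have [_ /(_ x z ax iz I) /= [e1 e2 li]] := cif.
have Dz : D x z by [].
have d1 := pd_u ax Dz (or_introl erefl : dir 1).
have di := pd_u ax Dz (or_intror erefl : dir 'i).
have sd := sandwich_dot (ddi Uz) (erefl : cl_rinv _ = _ *: _).
split.
- by rewrite (sd _ _ _ _ d1 d1) (sd _ _ _ _ di di) e1.
- by rewrite (sd _ _ _ _ d1 di) e2 mulr0.
move=> s t st; apply: li; apply: (@cl_vec_inj R n).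
apply: etrans (esym (cl_vec0 R n)); apply: etrans (cl_vecD _ _) _.
apply: etrans (congr2 +%R (cl_vecZ s _) (cl_vecZ t _)) _.
apply: (sandwich_inj (ddi Uz)).
apply: etrans (mul_comb_mul _ _ _ _ _ _) _.
apply: etrans (congr2 (fun X Y => s *: X + t *: Y) (esym d1) (esym di)) _.
apply: etrans (esym (congr2 +%R (cl_vecZ s _) (cl_vecZ t _))) _.
by apply: etrans (esym (cl_vecD _ _)) _; rewrite st cl_vec0.
Qed.

Let theta x v z : Cl := d (chart_inv x z) * d_cl fc x v z * (d (chart_inv x z))^t.

Let theta_vec x v z : cl_vec (cl_unvec (theta x v z)) = theta x v z.
Proof.
have [w e] : is_vector (theta x v z).
  rewrite /theta; case: (Gd (chart_inv x z)) => [->|G].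
    by rewrite !mul0r; exact: is_vector0.
  exact: (clifford_group_sandwich G).1.
by rewrite e cl_vecK.
Qed.

Let theta_smooth x v k : rs_atlas x -> dir v -> class_cl k (chart_img x) (theta x v).
Proof.
move=> ax hv; have oi := @chart_img_open _ _ x; have [_ sd _] := cd.
have hd := row_class k sd ax.
exact: (class_cl_mul oi (class_cl_mul oi hd (d_cl_smooth k sfc ax hv)) (class_cl_tr oi hd)).
Qed.

Let theta_transition x x' z v : rs_atlas x -> rs_atlas x' -> overlap x x' z -> dir v ->
  let tau := transition x x' in
  theta x v z = Re (derive1 tau z * v) *: theta x' 1 (tau z) +
                Im (derive1 tau z * v) *: theta x' 'i (tau z).
Proof.
move=> ax ax' oz hv tau; have [_ dz] := oz.
rewrite /theta /d_cl (pd_vec_transition sfc ax ax' oz hv) -/tau.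
have -> : chart_inv x' (tau z) = chart_inv x z by rewrite /tau /transition /= chart_mapK.
by rewrite cl_vecD !cl_vecZ; exact: mul_comb_mul.
Qed.

(** As [dd = c df], differentiating the outer factors yields [c (df ^ df^c) d^t] and its transposed
    counterpart, which vanish by the wedge relation; the middle factor is closed. *)
Let theta_closed x z : rs_atlas x -> chart_img x z ->
  exists e, is_pdcl 'i (theta x 1) z e /\ is_pdcl 1 (theta x 'i) z e.
Proof.
move=> ax iz; have [e0 [h1 hi]] := d_cl_closed sfc ax iz; have [_ _ dcd] := cd.
have [_ dd1] := dcd x z 1 ax iz (or_introl erefl).
have [_ ddi'] := dcd x z 'i ax iz (or_intror erefl).
have k1 := is_pdcl_mul (is_pdcl_mul ddi' h1) (is_pdcl_tr ddi').
have ki := is_pdcl_mul (is_pdcl_mul dd1 hi) (is_pdcl_tr dd1).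
eexists; split; first exact: k1.
apply: is_pdcl_eq ki _; rewrite /= !cl_trM !d_cl_tr.
have w := christoffel_wedge ax iz; have w' := wedge_tr christoffel_wedge ax iz.
move: w w'; move: (d_cl f x 1 z) (d_cl f x 'i z) (d_cl fc x 1 z) (d_cl fc x 'i z) => F1 Fi G1 Gi w w'.
move: (c _) (d _) => c0 d0.
rewrite !mulrDl -!(mulrA c0) w; congr (_ + _ + _).
by rewrite !mulrA -!(mulrA d0) w'.
Qed.

Lemma darboux_of_frame (p0 : M) : darboux_on Q U (- r) u uh.
Proof.
split; first exact: conformal_u.
pose th j x v z := cl_coef (theta x v z) [set j]%SET.
(* The primitive is taken over all of [M], where [theta] is defined, and only its restriction to [U]
   is a Christoffel transform of [u]. *)
have prim j : exists y : M -> R, smooth_on setT y /\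
    forall x z v, rs_atlas x -> chart_img x z -> dir v -> is_pd v (y \o chart_inv x) z (th j x v z).
  apply: (closed_form_primitive sc p0).
  - by move=> x v k ax hv; exact: theta_smooth.
  - move=> x x' z v ax ax' oz hv tau.
    apply: etrans (congr1 (fun q => cl_coef q _) (theta_transition ax ax' oz hv)) _.
    exact: etrans (cl_coefD _ _ _) (congr2 +%R (cl_coefZ _ _ _) (cl_coefZ _ _ _)).
  - move=> x z ax iz; have [e [h1 h2]] := theta_closed ax iz.
    exact: etrans (is_pd_val (h1 _)) (esym (is_pd_val (h2 _))).
have [y hy] := choice prim.
pose fd p : 'rV[R]_n := \row_j y j p.
have fdE j : (fun p => fd p 0 j) = y j by apply/funext => p; rewrite mxE.
have sfd : smooth_vec_on setT fd by move=> j; rewrite fdE; exact: (hy j).1.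
have pd_fd x z v : rs_atlas x -> chart_img x z -> dir v ->
    cl_vec (pd_vec v (fd \o chart_inv x) z) = theta x v z.
  move=> ax iz hv; rewrite -theta_vec; congr cl_vec; apply/rowP => j; rewrite !mxE.
  apply: etrans _ (is_pd_val ((hy j).2 x z v ax iz hv)); congr (pd _ _ _).
  by apply/funext => w; rewrite /= mxE.
exists fd; split.
  split.
    move=> j x ax k; apply: class_C_sub (sfd j x ax k).
    by move=> z [iz _]; split.
  move=> x z ax iz Uz; have Dz : D x z by [].
  have u1 := pd_u ax Dz (or_introl erefl : dir 1).
  have ui := pd_u ax Dz (or_intror erefl : dir 'i).
  have g1 := pd_fd x z _ ax iz (or_introl erefl : dir 1).
  have gi := pd_fd x z _ ax iz (or_intror erefl : dir 'i).
  have [_ q] := chf.2 x z ax iz I; split.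
    rewrite u1 ui g1 gi /theta; apply: (sandwich_wedge (ddi Uz)).
    exact: christoffel_wedge.
  rewrite -q !dot_dz.
  have sd := sandwich_dot_dual (ddi Uz) (erefl : cl_rinv _ = _ *: _).
  by rewrite (sd _ _ _ _ u1 g1) (sd _ _ _ _ ui gi) (sd _ _ _ _ u1 gi) (sd _ _ _ _ ui g1).
have gE p : U p -> cl_vec (uh p - u p) = (cl_rinv (d p))^t * cl_rinv (c p).
  by move=> Up; rewrite cl_vecB uE // uhE //; have [_ _ ->] := ratio Up.
have gE' p : U p -> cl_vec (uh p - u p) = (cl_rinv (c p))^t * cl_rinv (d p).
  by move=> Up; rewrite -cl_tr_vec gE // cl_trM cl_trK.
split.
- move=> j x ax k; have := class_C_sub_fun (D_open ax) (uh_smooth j ax k) (u_smooth j ax k).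
  apply: class_C_ext (D_open ax) _; move=> z _ /=; by rewrite !mxE.
- move=> p Up; apply/eqP => g0.
  have := gE p Up; rewrite g0 cl_vec0 => e.
  (* With [g = (d^-1)^t c^-1] one has [d^t g c = 1], which excludes [g = 0]. *)
  have : (d p)^t * ((cl_rinv (d p))^t * cl_rinv (c p)) * c p = 1.
    rewrite mulrA -cl_trM (falg_mulVr (ddi Up)) cl_tr1 mul1r.
    exact: falg_mulVr (cci Up).
  by rewrite -e mulr0 mul0r => /esym/eqP; rewrite oner_eq0.
move=> x z ax iz Uz v hv; have Dz : D x z by [].
have hu := pd_ratio_d ax Dz hv; have hc := pd_ratio_c ax Dz hv.
have gh p : U p -> cl_vec (uh p - u p) = a p * cl_rinv (c p) - b p * cl_rinv (d p).
  by move=> Up; rewrite cl_vecB uE // uhE.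
have [_ ->] := pd_vec_of ax Dz gh (is_pdcl_sub hc hu).
rewrite (pd_u ax Dz hv) (pd_fd x z v ax iz hv); congr (_ *: _ - _).
(* The vector [g] equals its transpose. Writing it as [(c^-1)^t d^-1] on the left and as
   [(d^-1)^t c^-1] on the right cancels the outer factors of [d df^c d^t]. *)
rewrite {1}gE' // gE // /theta.
have e1 : cl_rinv (d (chart_inv x z)) * d (chart_inv x z) = 1 := falg_mulVr (ddi Uz).
have e2 : (d (chart_inv x z))^t * (cl_rinv (d (chart_inv x z)))^t = 1.
  by rewrite -cl_trM e1 cl_tr1.
move: e1 e2; move: (d_cl _ _ _ _) (cl_rinv (c _)) (d _) (d _)^t (cl_rinv (d _)) => F ci dd dt di e1 e2.
transitivity (ci^t * (di * dd) * F * (dt * di^t) * ci); last by rewrite !mulrA.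
by rewrite e1 e2 !mulr1.
Qed.

End DarbouxOfFrame.

(** * The represented maps as quotients of entries *)

Section Representatives.
Variables (R : realType) (n : nat).
Local Notation Cl := (clifford R n).
Local Notation "a ^t" := (cl_tr a) (at level 8, format "a ^t").
Implicit Types (a b c d al de : Cl).

Lemma moebius0 a b c d :
  moebius (mx2 a b c d) (Some 0) = if d == 0 then None else Some (cl_unvec (b / d)).
Proof. by rewrite /moebius !mxE /= cl_vec0 !mulr0 !add0r. Qed.

Lemma ratio_vector b d : clifford_group d -> is_real (d * d^t) -> is_vector (b * d^t) ->
  cl_vec (cl_unvec (b / d)) = b * cl_rinv d.
Proof.
move=> /clifford_group_unit ud rd [v e].
have h : b * cl_rinv d = cl_vec ((cl_norm d)^-1 *: v) by rewrite /cl_rinv -scalerAr e cl_vecZ.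
by rewrite cl_invE // h cl_vecK.
Qed.

(** The quotient [a / c] is a vector, so [al (a / c) = (a / c) de]: the diagonal twist acts
    trivially on points. *)
Lemma ratio_twist al de a c (k : R) : k != 0 -> clifford_group de -> clifford_group c ->
  (forall v, al * cl_vec v = cl_vec v * de) -> is_real (c * c^t) -> is_vector (a * c^t) ->
  (k *: (al * a)) / (k *: (de * c)) = a / c.
Proof.
move=> k0 /clifford_group_unit ude Gc com rc vac; have uc := clifford_group_unit Gc.
have h := ratio_vector Gc rc vac; rewrite -cl_invE // in h.
have uy : k *: (de * c) \is a GRing.unit.
  have e : k *: (de * c) * (k^-1 *: (c^-1 * de^-1)) = 1.
    rewrite -scalerAl -scalerAr scalerA mulfV // scale1r mulrA -(mulrA de) mulrV // mulr1.
    exact: mulrV.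
  exact: unit_of_mul e.
have -> : k *: (al * a) = a / c * (k *: (de * c)); last by rewrite mulrK.
rewrite -h -scalerAr; congr (_ *: _); rewrite mulrA -com -mulrA h mulrVK //.
Qed.

End Representatives.

(** In [R^0] the partial derivatives are zero and cannot be linearly independent. *)
Lemma immersion_dim (R : realType) (n : nat) (M : riemannSurface R) (f : M -> 'rV[R]_n) (p0 : M) :
  conformal_immersion_on setT f -> (0 < n)%N.
Proof.
move=> [_ im]; have [x ax px] := rs_cover p0.
have [_ _ li] := im x (x p0) ax (chart_map_img px) I.
rewrite lt0n; apply/eqP => n0.
have [|/eqP] := li 1 0; last by rewrite oner_eq0.
by apply/rowP => -[j jn]; exfalso; rewrite n0 in jn.
Qed.

Theorem theorem2p14 (R : realType) (n : nat) (M : riemannSurface R)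
    (hM : simply_connected R M)
    (Q : quadraticDifferential M) (hQ : qd_nonzero Q)
    (f fc : M -> 'rV[R]_n)
    (hf : conformal_immersion_on setT f)
    (hfc : christoffel_on Q setT f fc)
    (r : R) (hr : r != 0) (p0 : M) :
  exists phi phih : M -> option 'rV[R]_n,
    [/\ T_transform r f fc phi,
        T_transform r fc f phih,
        phi p0 <> None,
        phih p0 <> None &
        darboux_on Q (finite_locus phi `&` finite_locus phih) (- r)
          (finite_part phi) (finite_part phih)].

Proof.
have sf := hf.1; have sfc := hfc.1.
pose i0 : 'I_n := Ordinal (immersion_dim p0 hf).
(* This vector is the value of [c] at [p0]; being nonzero, it makes the second representative finite
   there. *)
have w0 : (delta_mx 0 i0 : 'rV[R]_n) != 0.
  by apply/eqP => /rowP/(_ i0); rewrite !mxE !eqxx => /eqP; rewrite oner_eq0.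
have [a [b [c [d [ab cd c0 d0 V]]]]] :=
  frame_exists r sf sfc (christoffel_wedge hfc) p0 (delta_mx 0 i0) hM.
have [al [de [k [k0 Gal Gde com [ad [r1 r2 r3]]]]]] := twist_exists (R := R) i0 hr.
have SL p : SL_Gamma (mx2 (a p) (b p) (c p) (d p)) := vahlen_frame_SL i0 (V p).
have G p : (c p = 0 \/ clifford_group (c p)) /\ (d p = 0 \/ clifford_group (d p)).
  have [g _ _ _] := SL p.
  by have := g 1 0; have := g 1 1; rewrite !mxE.
have rc p : is_real (c p * cl_tr (c p)) by have [_ _ _ []] := V p.
have rd p : is_real (d p * cl_tr (d p)) by have [_ _ _ []] := V p.
have vac p : is_vector (a p * cl_tr (c p)) by have [_ _ _ _ []] := V p.
have vbd p : is_vector (b p * cl_tr (d p)) by have [_ _ _ _ []] := V p.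
have det p : a p * cl_tr (d p) - b p * cl_tr (c p) = 1 by have [_ _ []] := V p.
have cdt p : c p * cl_tr (d p) = d p * cl_tr (c p) by have [_ _ []] := V p.
(* The columns of the frame exchanged, rescaled, and twisted by the diagonal matrix with entries
   [al] and [de]. *)
pose Fh p := mx2 ((k * r) *: (al * b p)) (k *: (al * a p)) ((k * r) *: (de * d p)) (k *: (de * c p)).
pose phi p := moebius (mx2 (a p) (b p) (c p) (d p)) (Some 0).
pose phih p := moebius (Fh p) (Some 0).
have phiE p : phi p = if d p == 0 then None else Some (cl_unvec (b p / d p)) := moebius0 _ _ _ _.
have phihE p : phih p = if c p == 0 then None else Some (cl_unvec (a p / c p)).
  rewrite /phih moebius0 scaler_eq0 (negPf k0) /=.
  have -> : (de * c p == 0) = (c p == 0).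
    apply/eqP/eqP => [e|->]; last by rewrite mulr0.
    by rewrite -(mulKr (clifford_group_unit Gde) (c p)) e mulr0.
  case: eqP => // /eqP cp; congr (Some (cl_unvec _)); apply: ratio_twist => //.
  by case: (G p).1 => // e; rewrite e eqxx in cp.
have GU p : d p != 0 /\ c p != 0 -> clifford_group (d p) /\ clifford_group (c p).
  move=> [dp cp]; have [[ce|Gc] [dde|Gd]] := G p; try by split.
  - by rewrite ce eqxx in cp.
  - by rewrite ce eqxx in cp.
  - by rewrite dde eqxx in dp.
exists phi, phih; split.
- exists (fun p => mx2 (a p) (b p) (c p) (d p)) => //.
  exact: row_solution_T_frame.
- exists Fh => //; apply: row_solution_T_frame; [exact: row_solution_swap ab|exact: row_solution_swap cd|].
  by move=> p; exact: SL_twist (SL p).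
- by rewrite phiE d0 oner_eq0.
- rewrite phihE c0; case: eqP => // /(congr1 (@cl_unvec R n)) /eqP.
  by rewrite -(cl_vec0 R n) !cl_vecK (negPf w0).
have -> : finite_locus phi `&` finite_locus phih = [set p | d p != 0 /\ c p != 0].
  apply/seteqP; split=> p; rewrite /finite_locus /= phiE phihE.
    by case: (d p == 0) => [[]|] //; case: (c p == 0) => [[]|].
  by move=> [/negPf -> /negPf ->].
apply: (darboux_of_frame hM hf hfc ab cd (fun p => (G p).1) (fun p => (G p).2) rc rd det cdt) => //.
- move=> p Up; have [Gd Gc] := GU p Up.
  by rewrite /finite_part phiE (negPf Up.1) /= ratio_vector.
- move=> p Up; have [Gd Gc] := GU p Up.
  by rewrite /finite_part phihE (negPf Up.2) /= ratio_vector.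
Qed.
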